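(* Let $\alpha\in(0,\min\{1,\frac n2\})$, $\beta_\alpha:=\frac{n-2\alpha}{n}$, and let $\varphi:\mathbb R^n\to\mathbb R^n$ be $\eta$-quasisymmetric, with the additional assumption that $J_\varphi,J_{\varphi^{-1}}\in A_\infty(\mathbb R)$ when $n=1$. Fix $Q_0\in\mathcal D(\mathbb R^n)$ and assume that $\{d_I\}_{I\in\mathcal D(Q_0)}$ is a nonnegative sequence satisfying the $(\beta_\alpha,\varphi)$-packing condition on $Q_0$. For any $N\in\mathbb N$, define $$f_N:=\sum_{I\in\mathcal D(Q_0),\ \ell(I)\ge2^{-N}\ell(Q_0)}\ \sum_{\nu\in E_*}\sqrt{|I|\,d_I}\;\psi_I^\nu .$$ Then there exists a positive constant $C=C(\eta,n,\alpha,[J_{\varphi^{-1}}]_{A_\infty(\mathbb R^n)})$ such that $$\sum_{I\in\mathcal D(Q_0),\ \ell(I)\ge2^{-N}\ell(Q_0)}d_I\left(\frac{|I|}{|Q_0|}\right)^{1-\frac{2\alpha}{n}}\le C\,\|f_N\|_{\mathcal Q_\alpha(\mathbb R^n)}^2\qquad\text{and}\qquad\|f_N\circ\varphi\|_{\mathcal Q_\alpha(\mathbb R^n)}\le C .$$ In particular, the constant $C$ is independent of $N$, $Q_0$ and the sequence $\{d_I\}_{I\in\mathcal D(Q_0)}$.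
   Context: **Cubes.** Cubes have sides parallel to the axes; $\ell(Q)$ is side length, $|E|$ Lebesgue measure. $\mathcal D(\mathbb R^n)=\{2^{-k}(m+[0,1)^n):k\in\mathbb Z,m\in\mathbb Z^n\}$. For a cube $Q$, $\mathcal D(Q)=\bigcup_{k\ge0}\mathcal D_k(Q)$, where $\mathcal D_k(Q)$ consists of the $2^{kn}$ subcubes of side length $2^{-k}\ell(Q)$ obtained by $k$ successive bisections of the sides of $Q$. **Packing condition.** A nonnegative sequence $\{\mu_J\}_{J\in\mathcal D(Q)}$ satisfies the $(\beta,\varphi)$-packing condition on $Q$ if $$\sup_{R\in\mathcal D(Q)}\ \sum_{J\in\mathcal D(Q),\,J\subset R}\mu_J\left(\frac{|\varphi^{-1}(J)|}{|\varphi^{-1}(R)|}\right)^\beta\le1.$$ **Wavelets.** $E_*:=\{0,1\}^n\setminus\{(0,\dots,0)\}$, and $\{\psi_I^\nu:I\in\mathcal D(\mathbb R^n),\nu\in E_*\}$ is a fixed family of (compactly supported Daubechies-type) wavelets such that: it is an orthonormal basis of $L^2(\mathbb R^n)$; there is $m_*\in[1,\infty)$ with $\operatorname{supp}\psi_I^\nu\subset m_*I$ (the $m_*$-dilate of $I$ about its center) for all $I,\nu$; there is a constant $C_\psi$ with $|\psi_I^\nu(x)|+\ell(I)|\nabla\psi_I^\nu(x)|\le C_\psi|I|^{-1/2}$ for all $I,\nu,x$; and $\int_{\mathbb R^n}\psi_I^\nu\,dx=0$. Constants may depend on this fixed family. **The space $\mathcal Q_\alpha(\mathbb R^n)$.**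 It consists of all $f\in L^2_{\rm loc}(\mathbb R^n)$ with $\|f\|_{\mathcal Q_\alpha(\mathbb R^n)}:=\sup_{\text{cubes }Q}\left(|Q|^{\frac{2\alpha}{n}-1}\int_Q\int_Q\frac{|f(x)-f(y)|^2}{|x-y|^{n+2\alpha}}\,dx\,dy\right)^{1/2}<\infty$. **Quasisymmetric maps.** A homeomorphism $\varphi:\mathbb R^n\to\mathbb R^n$ is $\eta$-quasisymmetric if $\eta:[0,\infty)\to[0,\infty)$ is an increasing homeomorphism with $\eta(0)=0$ and $\frac{|\varphi(x)-\varphi(y)|}{|\varphi(x)-\varphi(z)|}\le\eta\left(\frac{|x-y|}{|x-z|}\right)$ for all distinct $x,y,z$. **Weights and Jacobians.** $A_\infty(\mathbb R^n)$ is the class of weights $w$ (nonnegative, locally integrable) with $[w]_{A_\infty(\mathbb R^n)}:=\sup_Q\left(\frac1{|Q|}\int_Qw\right)\exp\left(-\frac1{|Q|}\int_Q\log w\right)<\infty$. $J_\varphi,J_{\varphi^{-1}}$ are the Jacobians; an assumption $J_\varphi\in A_\infty$ is understood to include $|\varphi(E)|=\int_EJ_\varphi\,dx$ for all measurable $E$ (similarly for $\varphi^{-1}$). For $n\ge2$ quasisymmetry implies (Gehring) that $J_\varphi,J_{\varphi^{-1}}\in A_\infty(\mathbb R^n)$. *)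

(* Defs.v *)
From HB Require Import structures.
From mathcomp Require Import all_boot all_order all_algebra.
From mathcomp Require Import all_classical all_reals all_analysis.
From mathcomp Require Import measurable_realfun.

Set Implicit Arguments.
Unset Strict Implicit.
Unset Printing Implicit Defensive.
Import Order.TTheory GRing.Theory Num.Theory.
Import numFieldNormedType.Exports.

Local Open Scope classical_set_scope.
Local Open Scope ring_scope.

(* The Borel sigma-algebra of R^n = 'rV[R]_n, generated by the coordinates. *)
Section borel_rV.
Context (R : realType) (n : nat).

Let coor (i : 'I_n) (x : 'rV[R]_n) : measurableTypeR R := x 0 i.

Let rV_set0 : g_sigma_preimage coor set0.
Proof. exact: sigma_algebra0. Qed.

Let rV_setC A : g_sigma_preimage coor A -> g_sigma_preimage coor (~` A).
Proof. exact: sigma_algebraC. Qed.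

Let rV_bigcup (F : _^nat) : (forall i, g_sigma_preimage coor (F i)) ->
  g_sigma_preimage coor (\bigcup_i (F i)).
Proof. exact: sigma_algebra_bigcup. Qed.

HB.instance Definition _ := @isMeasurable.Build default_measure_display
  'rV[R]_n (g_sigma_preimage coor) rV_set0 rV_setC rV_bigcup.

Lemma measurable_coor (i : 'I_n) :
  measurable_fun [set: 'rV[R]_n] (fun x : 'rV[R]_n => x 0 i : measurableTypeR R).
Proof.
move=> _ Y mY; rewrite setTI; apply: sub_sigma_algebra => /=.
rewrite -bigcup_seq/=; exists i => /=; first by rewrite mem_index_enum.
by exists Y => //; rewrite setTI.
Qed.

Lemma measurable_fun_rV d (T : measurableType d) (f : T -> 'rV[R]_n) :
  (forall i, measurable_fun [set: T] (fun t => f t 0 i : measurableTypeR R)) ->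
  measurable_fun [set: T] f.
Proof.
move=> mf; suff : g_sigma_preimage (fun i => coor i \o f) `<=` measurable.
  rewrite g_sigma_preimage_comp => prefS _ A mA.
  by apply: prefS; exists A.
apply: smallest_sub; first exact: sigma_algebra_measurable.
rewrite -bigcup_seq; apply: bigcup_sub => i _ A [B mB <-].
by apply: mf.
Qed.

End borel_rV.

(* Lebesgue measure on R^n, by recursion on n: lebesgue_measure on the first
   coordinate times Lebesgue measure on the remaining ones. *)
Section lebesgue_rV_step.
Context (R : realType) (n : nat).
Variable mu : {sigma_finite_measure set 'rV[R]_n -> \bar R}.

Definition cons_rV (p : measurableTypeR R * 'rV[R]_n) : 'rV[R]_n.+1 :=
  \row_i (if unlift ord0 i is Some j then p.2 0 j else p.1).

Lemma measurable_cons_rV : measurable_fun setT cons_rV.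
Proof.
apply: measurable_fun_rV => i; case: (unliftP ord0 i) => [j|] ->.
- under eq_fun do rewrite mxE liftK.
  by apply: (measurableT_comp (measurable_coor j)); exact: measurable_snd.
- under eq_fun do rewrite mxE unlift_none.
  exact: measurable_fst.
Qed.

Let preim_measurable A : measurable A -> measurable (cons_rV @^-1` A).
Proof. by move=> mA; rewrite -[X in measurable X]setTI; exact: measurable_cons_rV. Qed.

Local Open Scope ereal_scope.

Definition lebesgue_rV_step : set 'rV[R]_n.+1 -> \bar R :=
  pushforward ((@lebesgue_measure R) \x mu) cons_rV.

Let step0 : lebesgue_rV_step set0 = 0.
Proof. by rewrite /lebesgue_rV_step /pushforward preimage_set0 measure0. Qed.

Let step_ge0 A : 0 <= lebesgue_rV_step A.
Proof. by rewrite /lebesgue_rV_step /pushforward; exact: measure_ge0. Qed.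

Let step_sigma_additive : semi_sigma_additive lebesgue_rV_step.
Proof.
move=> F mF tF mUF; rewrite /lebesgue_rV_step /pushforward preimage_bigcup.
apply: measure_semi_sigma_additive.
- by move=> k; exact: preim_measurable.
- apply/trivIsetP => /= i j _ _ ij; rewrite -preimage_setI.
  by move/trivIsetP : tF => /(_ _ _ _ _ ij) ->//; rewrite preimage_set0.
- by rewrite -preimage_bigcup; exact: preim_measurable.
Qed.

HB.instance Definition _ := isMeasure.Build _ _ _ lebesgue_rV_step
  step0 step_ge0 step_sigma_additive.

Let step_sigma_finite : sigma_finite setT lebesgue_rV_step.
Proof.
have /sigma_finiteP[F [TF ndF Foo]] := sigma_finiteT (@lebesgue_measure R).
have /sigma_finiteP[G [TG ndG Goo]] := sigma_finiteT mu.
pose H k := F k `*` G k.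
have mH k : measurable (H k) /\ ((@lebesgue_measure R) \x mu) (H k) < +oo.
  have [? ?] := Foo k; have [? ?] := Goo k.
  split; first exact: measurableX.
  by rewrite product_measure1E// lte_mul_pinfty// ge0_fin_numE.
have HT : setT = \bigcup_k H k.
  rewrite -setXTT TF TG predeqE => -[x y]; split.
    move=> [/= [i _ Fix] [k _ Gky]]; exists (maxn i k) => //; split.
    - by move: x Fix; exact/subsetPset/ndF/leq_maxl.
    - by move: y Gky; exact/subsetPset/ndG/leq_maxr.
  by move=> [i _ []/= ? ?]; split; exists i.
pose uncons (x : 'rV[R]_n.+1) : measurableTypeR R * 'rV[R]_n :=
  (x ord0 ord0, \row_j x ord0 (lift ord0 j)).
have unconsK : cancel cons_rV uncons.
  move=> [t y]; rewrite /uncons !mxE unlift_none; congr pair.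
  by apply/rowP => j; rewrite !mxE liftK.
have muncons : measurable_fun setT uncons.
  apply/measurable_fun_pair; first exact: measurable_coor.
  apply: measurable_fun_rV => i; under eq_fun do rewrite mxE.
  exact: measurable_coor.
exists (fun k => uncons @^-1` H k).
  by rewrite -preimage_bigcup -HT preimage_setT.
move=> k; have [mHk Hk] := mH k; split.
  by rewrite -[X in measurable X]setTI; exact: muncons.
rewrite /lebesgue_rV_step /pushforward -comp_preimage.
by rewrite (_ : uncons \o cons_rV = id) ?preimage_id//; apply/funext => p /=.
Qed.

HB.instance Definition _ := @Measure_isSigmaFinite.Build _ _ _
  lebesgue_rV_step step_sigma_finite.

End lebesgue_rV_step.

Fixpoint lebesgue_rV (R : realType) (n : nat) :
    {sigma_finite_measure set 'rV[R]_n -> \bar R} :=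
  match n with
  | 0 => [the {sigma_finite_measure set 'rV[R]_0 -> \bar R} of
            @dirac _ 'rV[R]_0 (0 : 'rV[R]_0) R]
  | m.+1 => [the {sigma_finite_measure set 'rV[R]_m.+1 -> \bar R} of
               lebesgue_rV_step (lebesgue_rV R m)]
  end.

Section cubes.
Context (R : realType) (n : nat).
Implicit Types (A : set 'rV[R]_n) (a : 'rV[R]_n) (l : R).

(* Only used for bounded sets A: fine +oo = 0. *)
Definition vol A : R := fine (lebesgue_rV R n A).

Definition cube a l : set 'rV[R]_n :=
  [set x | forall i, a 0 i <= x 0 i < a 0 i + l].

Definition cubes : set (set 'rV[R]_n) :=
  [set Q | exists a l, 0 < l /\ Q = cube a l].

Definition enorm (x : 'rV[R]_n) : R := Num.sqrt (\sum_i x 0 i ^+ 2).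

End cubes.

Lemma measurable_cube (R : realType) (n : nat) (a : 'rV[R]_n) (l : R) :
  measurable (cube a l).
Proof.
rewrite (_ : cube a l = \bigcap_(i in [set: 'I_n])
    ((fun x : 'rV[R]_n => x 0 i : measurableTypeR R) @^-1`
       `[a 0 i, a 0 i + l[%classic)); last first.
  by apply/seteqP; split=> x /= xa i; have := xa i; rewrite ?in_itv/=; auto.
apply: fin_bigcap_measurable => //= i _.
by rewrite -[X in measurable X]setTI; apply: measurable_coor.
Qed.

Lemma lebesgue_rV_cube (R : realType) (n : nat) (a : 'rV[R]_n) (l : R) :
  0 <= l -> lebesgue_rV R n (cube a l) = (l ^+ n)%:E.
Proof.
move=> l0; elim: n a => [|n IHn] a.
  by rewrite /= diracE expr0 mem_set// => -[].
pose b : 'rV[R]_n := \row_j a 0 (lift ord0 j).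
have -> : lebesgue_rV R n.+1 (cube a l) =
    ((@lebesgue_measure R) \x lebesgue_rV R n)%E
      (`[a 0 ord0, a 0 ord0 + l[%classic `*` cube b l).
  rewrite /= /lebesgue_rV_step /pushforward; congr (_ _).
  apply/seteqP; split=> -[x y] /=.
    move=> h; split; first by have := h ord0; rewrite mxE unlift_none in_itv.
    by move=> j; have := h (lift ord0 j); rewrite !mxE liftK.
  move=> [h1 h2] i; rewrite mxE.
  case: (unliftP ord0 i) => [j|] ->; last by rewrite in_itv in h1.
  by have := h2 j; rewrite mxE.
rewrite product_measure1E//; last exact: measurable_cube.
rewrite [X in (_ * X)%E]IHn//.
rewrite -[X in (X * _)%E]/(lebesgue_measure `[a 0 ord0, a 0 ord0 + l[%classic).
rewrite lebesgue_measure_itv/= lte_fin ltrDl.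
case: ltP => [_|l_le0]; first by rewrite -EFinB -EFinM (addrC (a 0 ord0)) addrK exprS.
have -> : l = 0 by apply/eqP; rewrite eq_le l_le0.
by rewrite mul0e expr0n.
Qed.

(* (k, m) stands for the dyadic cube 2^-k (m + [0, 1)^n). *)
Definition dyadic (n : nat) : Type := (int * 'rV[int]_n)%type.

Definition wtype (n : nat) : Type :=
  {e : {ffun 'I_n -> bool} | e != [ffun => false]}.

HB.instance Definition _ n := Choice.on (dyadic n).
HB.instance Definition _ n := Finite.on (wtype n).

Section dyadic_cubes.
Context (R : realType) (n : nat).
Implicit Types (Q I J : dyadic n).

Definition side Q : R := 2 ^ (- Q.1).

Definition dcube Q : set 'rV[R]_n :=
  cube (\row_i (side Q * (Q.2 0 i)%:~R)) (side Q).

(* (m_i + 1/2) 2^-k are the coordinates of the center of 2^-k (m + [0, 1)^n). *)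
Definition dilate (t : R) Q : set 'rV[R]_n :=
  cube (\row_i (side Q * ((Q.2 0 i)%:~R + 2^-1) - t * side Q / 2))
       (t * side Q).

Definition bisect Q : seq (dyadic n) :=
  [seq (Q.1 + 1, \row_i (2 * Q.2 0 i + (nat_of_bool (e i))%:Z))
     | e : {ffun 'I_n -> bool}].

Definition gen Q (k : nat) : seq (dyadic n) :=
  iter k (fun s => flatten [seq bisect P | P <- s]) [:: Q].

Definition descendants Q : set (dyadic n) := [set J | exists k, J \in gen Q k].

Definition packing_condition (beta : R) (phi : 'rV[R]_n -> 'rV[R]_n) Q
    (mu : dyadic n -> R) : Prop :=
  (ereal_sup [set \esum_(J in [set J | descendants Q J /\
                                       dcube J `<=` dcube P])
                    (mu J * (vol (phi @^-1` dcube J) /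
                             vol (phi @^-1` dcube P)) `^ beta)%:E
             | P in descendants Q] <= 1)%E.

End dyadic_cubes.
Arguments side R {n}.
Arguments dcube R {n}.

Section function_spaces.
Context (R : realType) (n : nat).
Local Notation leb := (lebesgue_rV R n).
Implicit Types f w : 'rV[R]_n -> R.

Definition L2 f : Prop :=
  measurable_fun setT f /\ ('N[leb]_2%:E [EFin \o f] < +oo)%E.

Definition L2loc f : Prop :=
  measurable_fun setT f /\
  forall Q, cubes Q -> (\int[leb]_(x in Q) (f x ^+ 2)%:E < +oo)%E.

Definition orthonormal_basis (K : choiceType) (e : K -> 'rV[R]_n -> R) : Prop :=
  [/\ forall k, L2 (e k),
      forall k l, (\int[leb]_x (e k x * e l x)%:E = (k == l)%:R%:E)%E
    & forall f, L2 f -> forall eps : R, 0 < eps ->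
        exists (s : seq K) (c : K -> R),
          ('N[leb]_2%:E [(fun x => (f x - \sum_(k <- s) c k * e k x)%:E)]
             < eps%:E)%E].

(* The norm of Q_alpha(R^n), with value +oo at functions outside L^2_loc; thus
   f belongs to Q_alpha(R^n) iff Qalpha_norm alpha f < +oo. The integrand is 0
   on the diagonal, where the denominator vanishes. *)
Definition Qalpha_norm (alpha : R) f : \bar R :=
  if `[< L2loc f >] then
    ereal_sup
      [set (((vol Q `^ (2 * alpha / n%:R - 1))%:E *
              \int[leb]_(x in Q) \int[leb]_(y in Q)
                (`|f x - f y| ^+ 2 /
                   enorm (x - y) `^ (n%:R + 2 * alpha))%:E) `^ 2^-1)%E
      | Q in @cubes R n]
  else +oo%E.

Definition weight w : Prop :=
  (forall x, 0 <= w x) /\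
  forall Q, cubes Q -> leb.-integrable Q (EFin \o w).

(* [w]_{A_oo}; here lne 0 = -oo and expeR +oo = +oo, so the second factor is
   +oo when log w has integral -oo on Q. The product is 0 if w = 0 a.e. on Q. *)
Definition Ainfty_char w : \bar R :=
  ereal_sup
    [set ((vol Q)^-1%:E * \int[leb]_(x in Q) (w x)%:E *
          expeR (- ((vol Q)^-1%:E * \int[leb]_(x in Q) lne (w x)%:E)))%E
    | Q in @cubes R n].

Definition Ainfty w : Prop := weight w /\ (Ainfty_char w < +oo)%E.

End function_spaces.

Section wavelets.
Context (R : realType) (n : nat).
Local Notation leb := (lebesgue_rV R n).

Definition gradient (f : 'rV[R]_n -> R) (x : 'rV[R]_n) : 'rV[R]_n :=
  \row_i 'D_(delta_mx 0 i) f x.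

Record wavelet_family (psi : dyadic n -> wtype n -> 'rV[R]_n -> R) : Prop := {
  wavelet_basis :
    orthonormal_basis (fun p : dyadic n * wtype n => psi p.1 p.2);
  wavelet_supp : exists2 m : R, 1 <= m &
    forall I nu, closure [set x | psi I nu x != 0] `<=` dilate m I;
  wavelet_differentiable : forall I nu x, differentiable (psi I nu) x;
  wavelet_bound : exists C : R, forall I nu x,
    `|psi I nu x| + side R I * enorm (gradient (psi I nu) x)
      <= C * vol (dcube R I) `^ (- 2^-1);
  wavelet_mean0 : forall I nu, (\int[leb]_x (psi I nu x)%:E = 0)%E
}.

End wavelets.

Section quasisymmetric_maps.
Context (R : realType) (n : nat).
Implicit Types phi : 'rV[R]_n -> 'rV[R]_n.

(* The inverse of an increasing bijection of [0, +oo) is automatically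
   continuous. *)
Definition increasing_homeo (eta : R -> R) : Prop :=
  [/\ eta 0 = 0,
      {in `[0, +oo[ &, {homo eta : s t / s < t}},
      set_bij `[0, +oo[%classic `[0, +oo[%classic eta
    & {within `[0, +oo[%classic, continuous eta}].

Definition homeomorphism phi phiV : Prop :=
  [/\ cancel phi phiV, cancel phiV phi, continuous phi & continuous phiV].

Definition quasisymmetric (eta : R -> R) phi : Prop :=
  forall x y z, x <> y -> y <> z -> x <> z ->
    enorm (phi x - phi y) / enorm (phi x - phi z)
      <= eta (enorm (x - y) / enorm (x - z)).

Definition jac phi (x : 'rV[R]_n) : R :=
  if `[< differentiable phi x >] then `|\det ('J phi x)| else 0.

Definition Ainfty_jacobian phi : Prop :=
  Ainfty (jac phi) /\
  forall E : set 'rV[R]_n, measurable E ->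
    (lebesgue_rV R n (phi @` E) =
       \int[lebesgue_rV R n]_(x in E) (jac phi x)%:E)%E.

End quasisymmetric_maps.

(* gen Q0 k consists of the cubes of D(Q0) of side length 2^-k l(Q0). *)
Definition wavelet_sum (R : realType) (n : nat)
    (psi : dyadic n -> wtype n -> 'rV[R]_n -> R) (Q0 : dyadic n)
    (d : dyadic n -> R) (N : nat) : 'rV[R]_n -> R :=
  fun x => \sum_(k < N.+1) \sum_(I <- gen Q0 k) \sum_(nu : wtype n)
    Num.sqrt (vol (dcube R I) * d I) * psi I nu x.

(* Main.v *)
(** First estimate. As psi_J has mean zero, its coefficient in f_N is, for every
    y, the integral of (f_N - f_N y) psi_J; hence |J| d_J is at most the integral
    of |f_N - f_N y|^2 over M J, and one averages over y in M J. For given x <> y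
    only the cubes J near x with l(J) >= c |x - y| contribute, so the sum over J
    is a geometric series which produces the kernel |x - y|^-(n + 2 alpha).

    Second estimate. Write f_N = sum_J sqrt(d_J) h_J with h_J bounded,
    C / l(J)-Lipschitz and supported in M J, and put D = |phi x - phi y|.
    Cauchy-Schwarz over the dyadic scales, with weight W u = min (u^q, u^e) where
    2 alpha < q < min (2, n) and e is small, bounds |f_N (phi x) - f_N (phi y)|^2
    by the sum of d_J W (D / l(J)) over the cubes J near phi x or phi y. The
    integral of W (D / l(J)) |x - y|^-(n + 2 alpha) over x in the quasiball
    phi^-1 (M J), of radius r_J, and all y is at most C r_J^(n - 2 alpha): since
    D^n is at most C |phi (B (x, |x - y|))|, Tonelli shows that phi is Lipschitz
    in the L^n mean on that quasiball. On a cube Q, the J with l(J) > diam phi(Q)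
    add up geometrically because d_J <= 1; for the others r_J^(n - 2 alpha) is
    comparable to |phi^-1 (J)|^beta, and the packing condition sums them to
    C l(Q)^(n - 2 alpha). *)

Require Import Defs.
From HB Require Import structures.
From mathcomp Require Import all_boot all_order all_algebra.
From mathcomp Require Import all_classical all_reals all_analysis.
From mathcomp Require Import measurable_realfun.
From mathcomp Require Import ring lra zify.

Set Implicit Arguments.
Unset Strict Implicit.
Unset Printing Implicit Defensive.
Import Order.TTheory GRing.Theory Num.Theory.
Import numFieldNormedType.Exports.

Local Open Scope classical_set_scope.
Local Open Scope ring_scope.

(** * Borel sets and Lebesgue measure in the sup norm *)

(** The obstacle is that a quasisymmetric map is in general only Hölder continuous, while |phi x -
    phi y|^q can absorb the singularity of the kernel only if phi behaves like a Lipschitz map. That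
    behaviour is available in the mean: the n-th power of the radius of phi (B (x, s)), averaged
    over x in B (x0, r), is at most C (s / r)^n times its value for B (x0, r). This dictates the
    exponents: q > 2 alpha for convergence near the diagonal, q <= n so that n-th powers control
    q-th powers, and q < 2 so that Cauchy-Schwarz leaves a weight u^(2 - q) that sums over the
    coarse cubes. Away from the diagonal phi may grow like a large power of |x - y|; the exponent e
    tames it through (K 2)^e <= 2^alpha, and being positive it still sums the dual weight u^(-e)
    over the fine cubes, and W over the cubes larger than phi (Q). Image volumes are estimated by
    inscribed and circumscribed balls, with one control function [K] obtained from [eta] and [n]
    before phi is given; hence the uniformity of the constants. *)

Section sup_norm.
Context (R : realType) (n : nat).
Implicit Types (x y : 'rV[R]_n).

Lemma rV_norm_le x (r : R) : 0 <= r -> (forall i, `|x 0 i| <= r) -> `|x| <= r.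
Proof.
move=> r0 xr; rewrite [X in X <= _]mx_normrE; apply/bigmax_leP; split=> //= -[i j] _ /=.
by rewrite ord1.
Qed.

Lemma rV_norm_lt x (r : R) : 0 < r -> (forall i, `|x 0 i| < r) -> `|x| < r.
Proof.
move=> r0 xr; rewrite [X in X < _]mx_normrE; apply/bigmax_ltP; split=> //= -[i j] _ /=.
by rewrite ord1.
Qed.

Lemma coord_le_norm x i : `|x 0 i| <= `|x|.
Proof.
rewrite [X in _ <= X]mx_normrE; apply: (@le_bigmax_cond _ _ _ _ (0, i) predT
  (fun ij : 'I_1 * 'I_n => `|x ij.1 ij.2|)) => //.
Qed.

Lemma enorm_ge0 x : 0 <= enorm x.
Proof. exact: sqrtr_ge0. Qed.

Lemma norm_le_enorm x : `|x| <= enorm x.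
Proof.
apply: rV_norm_le => [|i]; first exact: enorm_ge0.
rewrite -sqrtr_sqr ler_wsqrtr// (bigD1 i)//= lerDl.
by apply: sumr_ge0 => j _; exact: sqr_ge0.
Qed.

Lemma enorm_le_norm x : enorm x <= n%:R * `|x|.
Proof.
rewrite -[leRHS]ger0_norm ?mulr_ge0// -sqrtr_sqr ler_wsqrtr//.
apply: (@le_trans _ _ (\sum_(i < n) `|x| ^+ 2)).
  apply: ler_sum => i _; rewrite -[x 0 i ^+ 2]real_normK ?num_real//.
  by rewrite lerXn2r ?nnegrE//; exact: coord_le_norm.
rewrite sumr_const card_ord exprMn -[leLHS]mulr_natl ler_wpM2r ?sqr_ge0//.
by rewrite -natrX ler_nat; case: (n) => // m; rewrite expnS leq_pmulr// expn_gt0.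
Qed.

Lemma norm_const_mx1 : (0 < n)%N -> `|const_mx 1 : 'rV[R]_n| = 1.
Proof.
move=> n0; apply/eqP; rewrite eq_le; apply/andP; split.
  by apply: rV_norm_le => // i; rewrite mxE normr1.
by have := coord_le_norm (const_mx 1) (Ordinal n0); rewrite mxE normr1.
Qed.

End sup_norm.

Section borel_rV_open.
Context (R : realType) (n : nat).

Lemma measurable_ball_rV (c : 'rV[R]_n) (r : R) : measurable (ball c r).
Proof.
have [r0|r0] := ltP 0 r; last first.
  rewrite (_ : ball c r = set0)//; apply/seteqP; split => // y.
  by rewrite mx_norm_ball /ball_ /= => /lt_le_trans /(_ r0); rewrite normr_lt0.
rewrite (_ : ball c r = \bigcap_(i in [set: 'I_n])
    ((fun x : 'rV[R]_n => x 0 i : measurableTypeR R) @^-1` (ball (c 0 i) r))).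
  apply: fin_bigcap_measurable => // i _.
  rewrite -[X in measurable X]setTI; apply: measurable_coor => //.
  exact: measurable_ball.
rewrite mx_norm_ball; apply/seteqP; split => y /=.
  move=> h i _ /=; rewrite /ball/=; apply: le_lt_trans h.
  by rewrite -[leLHS](_ : `|(c - y) 0 i| = _) ?coord_le_norm// !mxE.
by move=> h; apply: rV_norm_lt => // i; rewrite !mxE; exact: (h i).
Qed.

(** The sigma-algebra is generated by the coordinates, so sup-norm balls, being products of
    intervals, belong to it; an open set is a countable union of balls with rational centers and
    radii. *)
Lemma measurable_open_rV (U : set 'rV[R]_n) : open U -> measurable U.
Proof.
move=> oU.
pose B (p : 'rV[rat]_n * rat) : set 'rV[R]_n := ball (map_mx ratr p.1 : 'rV[R]_n) (ratr p.2).
rewrite (_ : U = \bigcup_(p in [set p | B p `<=` U]) B p); last first.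
  apply/seteqP; split=> [x Ux|x [p /= + ?]]; last exact.
  have /nbhs_ballP[e/= e0 eU] : nbhs x U by exact: open_nbhs_nbhs.
  have [q] := rat_in_itvoo (divr_gt0 e0 (ltr0n _ 2)).
  rewrite in_itv/= => /andP[q0 qe].
  have hc i : exists c : rat, `|ratr c - x 0 i| < ratr q.
    have xq : x 0 i < x 0 i + ratr q by rewrite ltrDl.
    have [c] := rat_in_itvoo xq.
    rewrite in_itv/= => /andP[c1 c2]; exists c.
    by rewrite gtr0_norm ?subr_gt0// ltrBlDl.
  have /choice[c hc'] := hc.
  have xB : `|(map_mx ratr (\row_i c i) : 'rV[R]_n) - x| < ratr q.
    by apply: rV_norm_lt => // i; rewrite !mxE.
  exists ((\row_i c i), q); last by rewrite /B mx_norm_ball.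
  move=> y; rewrite /B mx_norm_ball /ball_ /= => cy; apply: eU.
  rewrite mx_norm_ball /ball_ /=.
  have -> : x - y = - ((map_mx ratr (\row_i c i) : 'rV[R]_n) - x) + (map_mx ratr (\row_i c i) - y).
    by rewrite opprB addrA subrK.
  rewrite (le_lt_trans (ler_normD _ _))// normrN (splitr e) ltrD//.
    exact: lt_trans qe.
  exact: lt_trans qe.
rewrite bigcup_mkcond; apply: countable_bigcupT_measurable.
  exact: countableP.
by move=> p; case: ifP => // _; exact: measurable_ball_rV.
Qed.

Lemma continuous_measurable_rV (f : 'rV[R]_n -> R) : continuous f ->
  measurable_fun setT f.
Proof.
move=> cf; apply: (measurability _ (RGenOpens.measurableE R)).
move=> _ [_ [a [b ->] <-]]; rewrite setTI.
apply: measurable_open_rV; apply: open_comp; first by move=> x _; exact: cf.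
exact: interval_open.
Qed.

Lemma continuous_measurable_rV_rV m (f : 'rV[R]_n -> 'rV[R]_m) : continuous f ->
  measurable_fun setT f.
Proof.
move=> cf; apply: measurable_fun_rV => i.
have cc : continuous (fun y : 'rV[R]_m => y 0 i : R) by exact: coord_continuous.
apply: (@continuous_measurable_rV (fun t => f t 0 i)) => x.
by apply: (@continuous_comp _ _ _ f (fun y : 'rV[R]_m => y 0 i)); [exact: cf|exact: cc].
Qed.

End borel_rV_open.

Section volumes.
Context (R : realType) (n : nat).
Local Notation leb := (lebesgue_rV R n).
Implicit Types (A : set 'rV[R]_n) (x : 'rV[R]_n).

Definition nball (x : 'rV[R]_n) (r : R) : set 'rV[R]_n := [set y | `|x - y| <= r].

Lemma measurable_nball x r : measurable (nball x r).
Proof.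
have mf : measurable_fun setT (fun y : 'rV[R]_n => `|x - y|).
  apply: continuous_measurable_rV => y.
  apply: continuous_comp; last exact: norm_continuous.
  by apply: continuousB; [exact: cst_continuous|exact: id].
have := mf measurableT _ (@measurable_itv R `]-oo, r]).
by rewrite setTI; congr measurable; apply/seteqP; split => y; rewrite /= in_itv.
Qed.

(** The ball is closed and [cube] is half-open, so the enclosing cube gets side 4 r instead of 2 r.
    For r = 0 the ball lies in cubes of arbitrarily small side; if also n = 0, the bound reads 1. *)
Lemma leb_nball_le x r : 0 <= r -> (leb (nball x r) <= ((4 * r) ^+ n)%:E)%E.
Proof.
rewrite le_eqVlt => /orP[/eqP<-|r0]; last first.
  rewrite -(@lebesgue_rV_cube R n (x - const_mx (2 * r))); last first.
    by rewrite mulr_ge0// ltW.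
  apply: le_measure; rewrite ?inE; [exact: measurable_nball|exact: measurable_cube|].
  move=> y /= yr i; have := le_trans (coord_le_norm (x - y) i) yr.
  by rewrite !mxE ler_norml => /andP[] *; apply/andP; split; lra.
have sub e : 0 < e -> (leb (nball x 0) <= (e ^+ n)%:E)%E.
  move=> e0; rewrite -(@lebesgue_rV_cube R n x); last exact: ltW.
  apply: le_measure; rewrite ?inE; [exact: measurable_nball|exact: measurable_cube|].
  move=> y /= yr i; have := le_trans (coord_le_norm (x - y) i) yr.
  by rewrite !mxE ler_norml => /andP[] *; apply/andP; split; lra.
rewrite mulr0 expr0n; have [n0|n0] := posnP n.
  by rewrite -(expr1n R n); exact: sub.
apply/lee_addgt0Pr => e e0; rewrite add0e.
have e1 : 0 < Num.min e 1 by rewrite lt_min e0/=.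
apply: le_trans (sub _ e1) _; rewrite lee_fin -[in _ ^+ n](prednK n0) exprS.
rewrite (@le_trans _ _ (Num.min e 1))//; last by rewrite ge_min lexx.
rewrite ler_piMr//; first exact: ltW.
by rewrite exprn_ile1//; [exact: ltW|rewrite ge_min lexx orbT].
Qed.

Lemma leb_nball_ge x r : 0 <= r -> ((r ^+ n)%:E <= leb (nball x r))%E.
Proof.
move=> r0; rewrite -(@lebesgue_rV_cube R n x)//.
apply: le_measure; rewrite ?inE; [exact: measurable_cube|exact: measurable_nball|].
move=> y /= yr; apply: rV_norm_le => // i; have := yr i.
by rewrite !mxE ler_norml => /andP[] *; apply/andP; split; lra.
Qed.

End volumes.

(** * Integrals of nonnegative functions *)

Section integral_aux.
Context d (T : measurableType d) (R : realType) (mu : {measure set T -> \bar R}).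

(** The integral of a nonnegative function is a supremum over the simple functions below it, hence
    monotone without measurability. Iterated integrals can thus be bounded before anything is known
    about the inner ones. *)
Lemma ge0_le_integralT (f g : T -> \bar R) : (forall x, (0 <= f x)%E) ->
  (forall x, (f x <= g x)%E) -> (\int[mu]_x f x <= \int[mu]_x g x)%E.
Proof.
move=> f0 fg; have g0 x : (0 <= g x)%E by exact: le_trans (fg x).
rewrite !ge0_integralTE//; apply: le_ereal_sup => _ [h hf <-].
by exists h => // x; exact: le_trans (fg x).
Qed.

Lemma ge0_integralZl_real (f : T -> R) (k : R) : measurable_fun setT f ->
  (forall x, 0 <= f x) -> 0 <= k ->
  (\int[mu]_x (k * f x)%:E = k%:E * \int[mu]_x (f x)%:E)%E.
Proof.
move=> mf f0 k0; rewrite -ge0_integralZl//.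
- exact/measurable_EFinP.
- by move=> x _; rewrite lee_fin.
Qed.

Lemma integral_indicT (A : set T) : measurable A ->
  (\int[mu]_x (\1_A x : R)%:E = mu A)%E.
Proof. by move=> mA; rewrite integral_indic// setIT. Qed.

(** Moves the cube into the integrand, the form in which Tonelli and pointwise majorants apply. *)
Lemma integral_square (Q : set T) (G : T -> T -> R) :
  (\int[mu]_(x in Q) \int[mu]_(y in Q) (G x y)%:E =
   \int[mu]_x \int[mu]_y (\1_Q x * (\1_Q y * G x y))%:E)%E.
Proof.
rewrite integral_mkcond; apply: eq_integral => x _; rewrite patchE.
rewrite [\1_Q x]indicE; case: ifPn => xQ; last first.
  by under eq_integral do rewrite mul0r; rewrite integral0.
under [RHS]eq_integral do rewrite mul1r.
rewrite integral_mkcond; apply: eq_integral => y _; rewrite patchE indicE.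
by case: ifPn => yQ; rewrite ?mul1r ?mul0r.
Qed.

(** Here [f] may change sign: its integral is at most that of its positive part, which [g]
    dominates. *)
Lemma integral_le_ge0 (f g : T -> \bar R) : (forall x, (f x <= g x)%E) ->
  (forall x, (0 <= g x)%E) -> (\int[mu]_x f x <= \int[mu]_x g x)%E.
Proof.
move=> fg g0; rewrite integralE; apply: (@le_trans _ _ (\int[mu]_x f^\+ x)%E).
  by rewrite -[leRHS]sube0 leeB//; exact: integral_ge0.
apply: ge0_le_integralT => // x; by rewrite funeposE ge_max fg g0.
Qed.

Lemma nneseries_le (u : nat -> \bar R) (C : \bar R) : (forall k, (0 <= u k)%E) ->
  (forall N, (\sum_(0 <= k < N) u k <= C)%E) -> (\sum_(k <oo) u k <= C)%E.
Proof.
move=> u0 uC; apply: lime_le; first exact: is_cvg_nneseries.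
by near=> N; exact: uC.
Unshelve. all: by end_near. Qed.

Lemma nneseries_ge_term (u : nat -> \bar R) k : (forall k, (0 <= u k)%E) ->
  (u k <= \sum_(k <oo) u k)%E.
Proof.
move=> u0; apply: le_trans (@nneseries_lim_ge _ u predT 0 k.+1 (fun i _ _ => u0 i)).
by rewrite big_nat_recr//= leeDr// sume_ge0.
Qed.

End integral_aux.

(** * Quasisymmetry in the sup norm *)

Section real_aux.
Context (R : realType).
Implicit Types (x y u l : R).

(* The sum of the terms with x * l ^+ k < 1 is controlled by the potential
   (l - x) / (l - 1), that of the others by a geometric series. *)
Lemma sum_min_geometric l x N : 1 < l -> 0 < x ->
  \sum_(k < N) Num.min (x * l ^+ k) (x * l ^+ k)^-1 <= 2 * l / (l - 1).
Proof.
move=> l1 x0; have l10 : 0 < l - 1 by rewrite subr_gt0.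
have l0 : 0 < l by apply: lt_trans l1.
have big M y : 0 < y ->
    \sum_(k < M) Num.min (y * l ^+ k) (y * l ^+ k)^-1 <= l / (l - 1) * y^-1.
  elim: M y => [|M IH] y y0.
    by rewrite big_ord0 !mulr_ge0 ?invr_ge0 ?ltW.
  rewrite big_ord_recl expr0 mulr1.
  under eq_bigr do rewrite /bump/= exprS mulrA.
  apply: (@le_trans _ _ (y^-1 + l / (l - 1) * (y * l)^-1)).
    rewrite lerD// ?ge_min ?lexx ?orbT//.
    exact: IH (mulr_gt0 y0 l0).
  rewrite le_eqVlt; apply/orP; left; apply/eqP; field.
  by rewrite !gt_eqF.
have small M y : 0 < y -> y <= 1 ->
    \sum_(k < M) Num.min (y * l ^+ k) (y * l ^+ k)^-1
      <= l / (l - 1) + (l - y) / (l - 1).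
  elim: M y => [|M IH] y y0 y1.
    by rewrite big_ord0 addr_ge0// divr_ge0// ?ltW// subr_gt0 (le_lt_trans y1).
  rewrite big_ord_recl expr0 mulr1.
  under eq_bigr do rewrite /bump/= exprS mulrA.
  have [yl|yl] := leP (y * l) 1.
    apply: (@le_trans _ _ (y + (l / (l - 1) + (l - y * l) / (l - 1)))).
      rewrite lerD// ?ge_min ?lexx//.
      exact: IH (mulr_gt0 y0 l0) yl.
    rewrite le_eqVlt; apply/orP; left; apply/eqP; field.
    by rewrite !gt_eqF.
  apply: (@le_trans _ _ (y + l / (l - 1) * (y * l)^-1)).
    rewrite lerD// ?ge_min ?lexx//.
    exact: big (mulr_gt0 y0 l0).
  rewrite addrC lerD//.
    rewrite ler_piMr ?divr_ge0 ?(ltW l0) ?(ltW l10)// invf_le1 ?(ltW yl)//.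
    exact: lt_trans yl.
  have yll : y * l <= l by rewrite ler_piMl// ltW.
  by rewrite ler_pdivlMr//; lra.
have [x1|x1] := leP x 1.
  apply: le_trans (small N x x0 x1) _.
  by rewrite -mulrDl ler_pM2r ?invr_gt0//; lra.
apply: le_trans (big N x x0) _.
have -> : 2 * l / (l - 1) = l / (l - 1) * 2 by rewrite -mulrA mulrC.
rewrite ler_wpM2l ?divr_ge0 ?(ltW l0) ?(ltW l10)//.
rewrite (@le_trans _ _ 1)//; last by lra.
by rewrite invf_le1 ?ltW.
Qed.

Lemma powR_le_exp (v : R) a b : 0 < v -> v <= 1 -> b <= a -> v `^ a <= v `^ b.
Proof.
move=> v0 v1 ba; have -> : v = v^-1 `^ (-1) by rewrite powR_inv1 ?invrK// invr_ge0 ltW.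
rewrite -!powRrM ler_powR//; first by rewrite invf_ge1.
by rewrite !mulN1r lerN2.
Qed.

(** With c = min (a, b) each term is at most min (v^c, v^(-c)), so [sum_min_geometric] applies with
    ratio 2^c. The bound is uniform in [u] and [N]; every sum over dyadic generations is made
    independent of the depth and of the size of the top cube by this lemma. *)
Lemma sum_min_powR (a b : R) : 0 < a -> 0 < b ->
  exists2 C : R, 0 < C & forall u N, 0 < u ->
    \sum_(k < N) Num.min ((2 ^+ k * u) `^ a) ((2 ^+ k * u) `^ (- b)) <= C.
Proof.
move=> a0 b0; pose c := Num.min a b.
have c0 : 0 < c by rewrite lt_min a0.
have l1 : 1 < (2 : R) `^ c.
  have := @gt0_ltr_powR R c c0 1 2.
  by rewrite !nnegrE powR1 => -> //; rewrite ltr1n.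
exists (2 * 2 `^ c / (2 `^ c - 1)).
  by rewrite divr_gt0// ?mulr_gt0// ?subr_gt0// powR_gt0.
move=> u N u0; apply: le_trans (sum_min_geometric N l1 (powR_gt0 c u0)).
apply: ler_sum => k _.
have v0 : 0 < 2 ^+ k * u by rewrite mulr_gt0// exprn_gt0.
have -> : u `^ c * (2 `^ c) ^+ k = (2 ^+ k * u) `^ c.
  rewrite powRM ?exprn_ge0// ?ltW// mulrC; congr (_ * _).
  by rewrite -!powR_mulrn ?powR_ge0// -!powRrM mulrC.
rewrite -powRN; move: (2 ^+ k * u) v0 => v v0.
have [v1|v1] := leP v 1.
  apply: (@le_trans _ _ (v `^ a)); first by rewrite ge_min lexx.
  rewrite le_min; apply/andP; split.
    by apply: powR_le_exp => //; rewrite ge_min lexx.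
  apply: powR_le_exp => //; rewrite (@le_trans _ _ 0)// ?ltW// oppr_lt0//.
apply: (@le_trans _ _ (v `^ (- b))); first by rewrite ge_min lexx orbT.
rewrite le_min; apply/andP; split; apply: ler_powR; rewrite ?(ltW v1)//.
  by rewrite (@le_trans _ _ 0)// ?ltW// oppr_lt0.
by rewrite lerN2 ge_min lexx orbT.
Qed.

(** Cauchy-Schwarz without square roots, by induction on the list. *)
Lemma sqr_sum_le (I : Type) (s : seq I) (x p q : I -> R) :
  (forall i, 0 <= p i) -> (forall i, 0 <= q i) -> (forall i, 0 <= x i) ->
  (forall i, x i ^+ 2 <= p i * q i) ->
  (\sum_(i <- s) x i) ^+ 2 <= (\sum_(i <- s) p i) * (\sum_(i <- s) q i).
Proof.
move=> p0 q0 x0 xpq; elim: s => [|i s IH]; first by rewrite !big_nil expr0n mul0r.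
rewrite !big_cons.
set S := \sum_(j <- s) x j in IH *; set P := \sum_(j <- s) p j in IH *.
set Q := \sum_(j <- s) q j in IH *.
have S0 : 0 <= S by exact: sumr_ge0.
have P0 : 0 <= P by exact: sumr_ge0.
have Q0 : 0 <= Q by exact: sumr_ge0.
have pi0 := p0 i; have qi0 := q0 i; have xi0 := x0 i; have xi := xpq i.
(* The cross term: (S x_i)^2 <= (P q_i) (p_i Q), and then the inequality of arithmetic and geometric
   means. *)
have : 2 * (S * x i) <= P * q i + p i * Q.
  rewrite -ler_sqr ?nnegrE ?mulr_ge0 ?addr_ge0 ?mulr_ge0//.
  have h : (S * x i) ^+ 2 <= (P * Q) * (p i * q i).
    by rewrite exprMn ler_pM ?sqr_ge0.
  have := sqr_ge0 (P * q i - p i * Q).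
  move: h; rewrite exprMn !expr2 => h1 h2; nra.
move: IH xi; rewrite !expr2 => IH xi h; nra.
Qed.

End real_aux.

Section quasisymmetry.
Context (R : realType) (n : nat).
Implicit Types (phi phiV : 'rV[R]_n -> 'rV[R]_n) (K : R -> R).

(* One control function K serves both phi and phiV, and y = z is allowed (whence
   1 <= K t); distances are in the sup norm. *)
Record qs_pair K phi phiV : Prop := {
  qs_can : cancel phi phiV;
  qs_canV : cancel phiV phi;
  qs_cont : continuous phi;
  qs_contV : continuous phiV;
  qs_ge1 : forall t, 1 <= K t;
  qs_le : forall t x y z, 0 <= t -> `|x - y| <= t * `|x - z| ->
    `|phi x - phi y| <= K t * `|phi x - phi z|;
  qs_leV : forall t x y z, 0 <= t -> `|x - y| <= t * `|x - z| ->
    `|phiV x - phiV y| <= K t * `|phiV x - phiV z|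
}.

Lemma qs_pair_sym K phi phiV : qs_pair K phi phiV -> qs_pair K phiV phi.
Proof. by case=> *; split. Qed.

Lemma increasing_homeo_ge0 (eta : R -> R) t :
  increasing_homeo eta -> 0 <= t -> 0 <= eta t.
Proof.
move=> [eta0 ehomo _ _]; rewrite le_eqVlt => /orP[/eqP<-|t0].
  by rewrite eta0.
by rewrite -eta0 ltW// ehomo// in_itv/= ?lexx// ltW.
Qed.

Lemma increasing_homeo_le (eta : R -> R) s t :
  increasing_homeo eta -> 0 <= s -> s <= t -> eta s <= eta t.
Proof.
move=> [eta0 ehomo _ _] s0; rewrite le_eqVlt => /orP[/eqP<-//|st].
by rewrite ltW// ehomo// in_itv/= ?s0//= (le_trans s0)// ltW.
Qed.

(** Comparing the sup norm with the Euclidean one costs a factor [n] in the argument of [eta] and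
    another in front of it. *)
Lemma quasisymmetric_norm (eta : R -> R) phi x y z t : increasing_homeo eta ->
  injective phi -> quasisymmetric eta phi ->
  x <> y -> y <> z -> x <> z -> `|x - y| <= t * `|x - z| ->
  `|phi x - phi y| <= n%:R * eta (n%:R * t) * `|phi x - phi z|.
Proof.
move=> he inj qs xy yz xz xyz.
have pos (u v : 'rV[R]_n) : u <> v -> 0 < `|u - v|.
  by move=> uv; rewrite normr_gt0 subr_eq0; apply/eqP.
have epos (u v : 'rV[R]_n) : u <> v -> 0 < enorm (u - v).
  by move=> uv; rewrite (lt_le_trans (pos _ _ uv))// norm_le_enorm.
have pxz : phi x <> phi z by move/inj.
have := qs x y z xy yz xz; rewrite ler_pdivrMr ?epos// => h.
apply: le_trans (norm_le_enorm _) _; apply: le_trans h _.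
have -> : n%:R * eta (n%:R * t) * `|phi x - phi z| =
  eta (n%:R * t) * (n%:R * `|phi x - phi z|) by ring.
have e0 : 0 <= enorm (x - y) / enorm (x - z) by rewrite divr_ge0 ?enorm_ge0.
apply: ler_pM; [exact: increasing_homeo_ge0|exact: enorm_ge0| |exact: enorm_le_norm].
apply: increasing_homeo_le => //.
rewrite ler_pdivrMr ?epos//; apply: le_trans (enorm_le_norm _) _.
rewrite -mulrA ler_wpM2l//; apply: (le_trans xyz).
rewrite ler_wpM2l ?norm_le_enorm// leNgt; apply/negP => t0.
have := lt_le_trans (pos _ _ xy) xyz; rewrite ltNge => /negP; apply.
by rewrite nmulr_rle0.
Qed.

(** [K] has three summands: 1 for the degenerate case y = z, n eta (n t) for [phi], and the inverse
    of tau (t) for [phiV]. All of them come from [eta] and [n], before [phi] is given. *)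
Lemma quasisymmetric_qs_pair (eta : R -> R) : (0 < n)%N -> increasing_homeo eta ->
  exists2 K, forall t, 1 <= K t & forall phi phiV,
    homeomorphism phi phiV -> quasisymmetric eta phi -> qs_pair K phi phiV.
Proof.
move=> n0 he.
have nR0 : 0 < n%:R :> R by rewrite ltr0n.
(* As [eta] is onto, it takes the value 1 / (n (t + 1)) at some u; then tau = u / n works. *)
have htau t : exists tau : R, 0 <= t -> 0 < tau /\ n%:R * eta (n%:R * tau) * t < 1.
  have [t0|] := leP 0 t; last by exists 0.
  have [eta0 _ [_ _ surj] _] := he.
  have s0 : 0 < (n%:R * (t + 1))^-1.
    by rewrite invr_gt0 mulr_gt0// ltr_wpDl.
  have [|u] := surj (n%:R * (t + 1))^-1; first by rewrite /= in_itv/= ltW.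
  rewrite /= in_itv/= andbT => u0 eu.
  exists (u / n%:R) => _; split.
    rewrite divr_gt0// lt_neqAle u0 andbT; apply/eqP => u0'.
    by move: s0; rewrite -eu -u0' eta0 ltxx.
  rewrite mulrCA mulfV ?gt_eqF// mulr1 eu invfM mulrA mulfV ?gt_eqF// mul1r.
  by rewrite mulrC ltr_pdivrMr ?mul1r ?ltrDl// ltr_wpDl.
have [tau htau'] := choice htau.
pose K t := 1 + n%:R * `|eta (n%:R * t)| + `|(tau t)^-1|.
have K1 t : 1 <= K t by rewrite /K -addrA lerDl addr_ge0// mulr_ge0.
exists K => // phi phiV [canphi canphiV cphi cphiV] qs.
have inj := can_inj canphi; have injV := can_inj canphiV.
split=> //.
  move=> t x y z t0 xyz.
  have [<-|/eqP xy] := eqVneq x y; first by rewrite subrr normr0 mulr_ge0// (le_trans _ (K1 t)).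
  have [<-|/eqP yz] := eqVneq y z; first by rewrite ler_peMl.
  have [xz|/eqP xz] := eqVneq x z.
    by move: xyz; rewrite -xz subrr normr0 mulr0 normr_le0 subr_eq0 => /eqP.
  apply: le_trans (quasisymmetric_norm he inj qs xy yz xz xyz) _.
  rewrite ler_wpM2r// /K addrAC ler_wpDl ?addr_ge0//.
  by rewrite ler_wpM2l// ler_norm.
move=> t u v w t0.
rewrite -[u]canphiV -[v]canphiV -[w]canphiV !canphi.
move: (phiV u) (phiV v) (phiV w) => x y z xyz.
have [<-|/eqP xy] := eqVneq x y; first by rewrite subrr normr0 mulr_ge0// (le_trans _ (K1 t)).
have [<-|/eqP yz] := eqVneq y z; first by rewrite ler_peMl.
have [xz|/eqP xz] := eqVneq x z.
  by move: xyz; rewrite -xz subrr normr0 mulr0 normr_le0 subr_eq0 => /eqP /inj.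
have [tau0 taut] := htau' t t0.
(* If |x - z| <= tau |x - y|, the forward estimate with y and z exchanged would make |phi x - phi z|
   smaller than itself. So |x - y| < |x - z| / tau, the claim for the inverse map. *)
have [h|h] := leP `|x - z| (tau t * `|x - y|); last first.
  apply: (@le_trans _ _ ((tau t)^-1 * `|x - z|)).
    by rewrite mulrC ler_pdivlMr// mulrC ltW.
  rewrite ler_wpM2r//; apply: le_trans (ler_norm _) _.
  by rewrite /K lerDr addr_ge0// mulr_ge0.
have zy : z <> y by move=> e; exact: yz.
have := quasisymmetric_norm he inj qs xz zy xy h.
have eta0 : 0 <= eta (n%:R * tau t).
  by apply: increasing_homeo_ge0 => //; rewrite mulr_ge0// ltW.
move=> h1; have : `|phi x - phi z| < `|phi x - phi z|.
  have p0 : 0 < `|phi x - phi z| by rewrite normr_gt0 subr_eq0; apply/eqP => /inj.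
  apply: (le_lt_trans h1); apply: (@le_lt_trans _ _ (n%:R * eta (n%:R * tau t) * (t * `|phi x - phi z|))).
    by rewrite ler_wpM2l// mulr_ge0.
  by rewrite mulrA -[ltRHS]mul1r ltr_pM2r.
by rewrite ltxx.
Qed.

End quasisymmetry.

(** * Average volume distortion *)

Section powR_aux.
Context (R : realType).
Implicit Types (x s t : R).

Lemma powR_expn x a k : 0 <= x -> (x ^+ k) `^ a = (x `^ a) ^+ k.
Proof.
by move=> x0; rewrite -!powR_mulrn ?powR_ge0// -!powRrM mulrC.
Qed.

Lemma powR_lt1 x a : 0 < x -> x < 1 -> 0 < a -> x `^ a < 1.
Proof.
move=> x0 x1 a0; have := @gt0_ltr_powR R a a0 x 1.
by rewrite !nnegrE powR1 ltW// => -> //.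
Qed.

(** Separate t <= s from t > s. This is where q <= n enters: a bound on the mean of the n-th power
    gives one for the q-th power, at the cost of the additive 1. *)
Lemma powR_le_expn t s q n : 0 <= t -> 0 < s -> 0 <= q -> q <= n%:R ->
  t `^ q <= s `^ q * (1 + (t / s) ^+ n).
Proof.
move=> t0 s0 q0 qn; have u0 : 0 <= t / s by rewrite divr_ge0// ltW.
have {1}-> : t = s * (t / s) by rewrite mulrCA mulfV ?gt_eqF ?mulr1.
rewrite powRM ?(ltW s0)// ler_wpM2l ?powR_ge0//.
have [u1|u1] := leP (t / s) 1.
  rewrite ler_wpDr ?exprn_ge0//.
  by have := @ge0_ler_powR R q q0 (t / s) 1; rewrite !nnegrE powR1; apply.
by rewrite ler_wpDl// -powR_mulrn// ler_powR// ltW.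
Qed.

Lemma geometric_sum_le x N : 0 <= x -> x < 1 -> \sum_(k < N) x ^+ k <= (1 - x)^-1.
Proof.
move=> x0 x1; rewrite -[leRHS]mul1r ler_pdivlMr ?subr_gt0// mulrC.
rewrite -[1 - x]opprB mulNr -subrX1 opprB.
by rewrite gerBl exprn_ge0.
Qed.

Lemma dyadic_scale_small t : 0 < t -> t <= 1 ->
  exists k : nat, 2^-1 ^+ k.+1 < t <= 2^-1 ^+ k.
Proof.
move=> t0 t1.
have ex : exists k, 2^-1 ^+ k.+1 < t.
  exists (Num.bound t^-1); rewrite exprVn -ltf_pV2 ?posrE// ?invr_gt0 ?exprn_gt0//.
  by rewrite invrK upper_nthrootP.
have [k hk kmin] := ex_minnP ex; exists k; rewrite hk/=.
case: k hk kmin => [|k] hk kmin; first by rewrite expr0.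
by rewrite leNgt; apply/negP => /kmin; rewrite ltnn.
Qed.

Lemma dyadic_scale_large t : 1 < t -> exists k : nat, 2 ^+ k < t <= 2 ^+ k.+1.
Proof.
move=> t1; have t0 : 0 < t by rewrite (lt_trans _ t1).
have ex : exists k, t <= 2 ^+ k.+1.
  by exists (Num.bound t); apply: ltW; rewrite upper_nthrootP.
have [k hk kmin] := ex_minnP ex; exists k; rewrite hk andbT.
case: k hk kmin => [|k] hk kmin; first by rewrite expr0.
by rewrite ltNge; apply/negP => /kmin; rewrite ltnn.
Qed.

End powR_aux.

Section image_radius.
Context (R : realType) (n : nat) (n0 : (0 < n)%N).
Local Notation leb := (lebesgue_rV R n).
Implicit Types (phi phiV : 'rV[R]_n -> 'rV[R]_n) (K : R -> R) (x y z : 'rV[R]_n).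

(* Comparable to the radius of the quasiball phi (B (x, s)). *)
Definition img_rad phi x (s : R) : R := `|phi x - phi (x + s *: const_mx 1)|.

Lemma norm_shift x (s : R) : 0 <= s -> `|x - (x + s *: const_mx 1)| = s.
Proof.
move=> s0; rewrite opprD addrA subrr sub0r normrN normrZ ger0_norm//.
by rewrite norm_const_mx1// mulr1.
Qed.

Lemma img_rad_ge0 phi x s : 0 <= img_rad phi x s.
Proof. exact: normr_ge0. Qed.

Lemma qs_img_rad K phi phiV t x y s : qs_pair K phi phiV -> 0 <= t -> 0 <= s ->
  `|x - y| <= t * s -> `|phi x - phi y| <= K t * img_rad phi x s.
Proof.
by move=> H t0 s0 xy; apply: (qs_le H) => //; rewrite norm_shift.
Qed.

Lemma img_rad_gt0 K phi phiV x s : qs_pair K phi phiV -> 0 < s -> 0 < img_rad phi x s.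
Proof.
move=> H s0; rewrite normr_gt0 subr_eq0; apply/eqP => /(can_inj (qs_can H)) e.
by have := norm_shift x (ltW s0); rewrite -e subrr normr0 => /esym/eqP; rewrite gt_eqF.
Qed.

(** Otherwise quasisymmetry with t = 2 would give img_rad <= K 2 |phi x - z| <= img_rad / 2. So phi
    (B (x, s / 2)) contains a ball about phi x of radius comparable to [img_rad]. *)
Lemma qs_inner K phi phiV x z s : qs_pair K phi phiV -> 0 < s ->
  `|phi x - z| <= (2 * K 2)^-1 * img_rad phi x s -> `|x - phiV z| <= s / 2.
Proof.
move=> H s0 hz; rewrite leNgt; apply/negP => sz.
have K2 : 0 < K 2 by rewrite (lt_le_trans ltr01)// (qs_ge1 H).
have : img_rad phi x s <= K 2 * `|phi x - z|.
  rewrite -{1}(qs_canV H z); apply: (qs_le H) => //.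
  by rewrite norm_shift ?ltW//; rewrite ltr_pdivrMr// mulrC in sz.
have := img_rad_gt0 x H s0 => r0 h.
have : K 2 * `|phi x - z| <= img_rad phi x s / 2.
  apply: (@le_trans _ _ (K 2 * ((2 * K 2)^-1 * img_rad phi x s))).
    by rewrite ler_wpM2l// ltW.
  rewrite le_eqVlt; apply/orP; left; apply/eqP; field.
  by rewrite gt_eqF.
lra.
Qed.

Lemma measurable_preimage_rV (f : 'rV[R]_n -> 'rV[R]_n) (A : set 'rV[R]_n) :
  continuous f -> measurable A -> measurable (f @^-1` A).
Proof.
by move=> cf mA; rewrite -[X in measurable X]setTI; exact: continuous_measurable_rV_rV.
Qed.

(** The image of a set under [phi] is written as its preimage under [phiV], so that measurability
    follows from continuity. *)
Lemma leb_preimage_ge K phi phiV x s : qs_pair K phi phiV -> 0 < s ->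
  ((((2 * K 2)^-1 * img_rad phi x s) ^+ n)%:E <= leb (phiV @^-1` nball x (s / 2)))%E.
Proof.
move=> H s0; have K2 : 0 < K 2 by rewrite (lt_le_trans ltr01)// (qs_ge1 H).
apply: le_trans (leb_nball_ge (phi x) _) _.
  by rewrite mulr_ge0 ?img_rad_ge0// invr_ge0 mulr_ge0// ltW.
apply: le_measure; rewrite ?inE; first exact: measurable_nball.
  exact: measurable_preimage_rV (qs_contV H) (measurable_nball _ _).
by move=> z /= hz; exact: (qs_inner H).
Qed.

Lemma leb_preimage_le K phi phiV x s t : qs_pair K phi phiV -> 0 <= t -> 0 < s ->
  (leb (phiV @^-1` nball x (t * s)) <= ((4 * (K t * img_rad phi x s)) ^+ n)%:E)%E.
Proof.
move=> H t0 s0; apply: le_trans (leb_nball_le (phi x) _); last first.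
  by rewrite mulr_ge0 ?img_rad_ge0// (le_trans ler01)// (qs_ge1 H).
apply: le_measure; rewrite ?inE; last 1 first.
- move=> z /= hz; rewrite -[z](qs_canV H); apply: (qs_img_rad H) => //; exact: ltW.
- exact: measurable_preimage_rV (qs_contV H) (measurable_nball _ _).
- exact: measurable_nball.
Qed.

Lemma continuous_img_rad K phi phiV s : qs_pair K phi phiV -> continuous (img_rad phi ^~ s).
Proof.
move=> H x; rewrite /img_rad.
apply: (@continuous_comp _ _ _ (fun x => phi x - phi (x + s *: const_mx 1)) Num.norm);
  last exact: norm_continuous.
apply: continuousB; first exact: (qs_cont H).
apply: (@continuous_comp _ _ _ (fun x : 'rV[R]_n => x + s *: const_mx 1) phi);
  last exact: (qs_cont H).
by apply: continuousD; [exact: id|exact: cst_continuous].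
Qed.

Lemma measurable_norm_rV m : measurable_fun setT (fun x : 'rV[R]_m => `|x|).
Proof. by apply: continuous_measurable_rV => x; exact: norm_continuous. Qed.

Lemma measurable_fun_subr_rV d (T : measurableType d) (f g : T -> 'rV[R]_n) :
  measurable_fun setT f -> measurable_fun setT g ->
  measurable_fun setT (fun t => f t - g t).
Proof.
move=> mf mg; apply: measurable_fun_rV => i.
under eq_fun do rewrite !mxE.
by apply: measurable_funB; apply: (measurableT_comp (measurable_coor i)).
Qed.

Lemma measurable_fun_norm_subr d (T : measurableType d) (f g : T -> 'rV[R]_n) :
  measurable_fun setT f -> measurable_fun setT g ->
  measurable_fun setT (fun t => `|f t - g t|).
Proof.
move=> mf mg; apply: (measurableT_comp (@measurable_norm_rV n)).
exact: measurable_fun_subr_rV.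
Qed.

(* Tonelli in the form: the average of the volume of phi (B (x, s)) over x in
   B (x0, r) is at most C s^n |phi (B (x0, 2 r))|. *)
Lemma integral_img_rad_le K phi phiV x0 r s : qs_pair K phi phiV -> 0 < s -> s <= r ->
  (\int[leb]_x (\1_(nball x0 r) x * img_rad phi x s ^+ n)%:E
    <= ((32 * K 2 * K 2) ^+ n * s ^+ n * img_rad phi x0 r ^+ n)%:E)%E.
Proof.
move=> H s0 sr; have r0 : 0 < r by exact: lt_le_trans sr.
have K2 : 0 < K 2 by rewrite (lt_le_trans ltr01)// (qs_ge1 H).
(* [del * img_rad phi x s] is the radius of the ball that [qs_inner] finds inside the image. At the
   end the factors 2 K 2, 4 and 4 K 2 multiply to 32 K 2 K 2. *)
set del := (2 * K 2)^-1; have del0 : 0 < del by rewrite invr_gt0 mulr_gt0.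
(* For fixed x the slice of [S] is phi (B (x, s)), of volume at least (del img_rad)^n; for fixed z
   it is the ball B (phiV z, s), which meets B (x0, r) only if phiV z lies in B (x0, 2 r), because s
   <= r. *)
pose S : set ('rV[R]_n * 'rV[R]_n) := [set p | `|p.1 - phiV p.2| <= s].
have mphiV : measurable_fun setT phiV by exact: continuous_measurable_rV_rV (qs_contV H).
have mS : measurable S.
  have mf : measurable_fun setT (fun p : 'rV[R]_n * 'rV[R]_n => `|p.1 - phiV p.2|).
    apply: measurable_fun_norm_subr; first exact: measurable_fst.
    by apply: (measurableT_comp mphiV); exact: measurable_snd.
  have := mf measurableT _ (@measurable_itv R `]-oo, s]).
  by rewrite setTI; congr measurable; apply/seteqP; split => y; rewrite /= in_itv.
pose f p : R := \1_(nball x0 r) p.1 * \1_S p.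
have f0 p : 0 <= f p by rewrite mulr_ge0.
have mf : measurable_fun setT (EFin \o f).
  apply/measurable_EFinP/measurable_funM; last exact: measurable_indic.
  apply: (measurableT_comp _ measurable_fst).
  by apply: measurable_indic; exact: measurable_nball.
have step1 : (\int[leb]_x (\1_(nball x0 r) x * img_rad phi x s ^+ n)%:E <=
    \int[leb]_x ((del ^- n)%:E * \int[leb]_z (f (x, z))%:E))%E.
  apply: ge0_le_integralT => x; first by rewrite lee_fin mulr_ge0// exprn_ge0// img_rad_ge0.
  have mS1 : measurable_fun setT (fun z => \1_S (x, z) : R).
    apply: (measurableT_comp _ (measurable_pair1 x)).
    exact: measurable_indic.
  rewrite /f/= ge0_integralZl_real//.
  have -> : (\int[leb]_z (\1_S (x, z))%:E)%E = leb (phiV @^-1` nball x s).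
    rewrite -(integral_indicT leb)//.
    exact: measurable_preimage_rV (qs_contV H) (measurable_nball _ _).
  rewrite muleCA EFinM lee_wpmul2l ?lee_fin//.
  have -> : img_rad phi x s ^+ n = del ^- n * (del * img_rad phi x s) ^+ n.
    by rewrite exprMn mulKf// expf_neq0// gt_eqF.
  rewrite EFinM lee_wpmul2l ?lee_fin ?invr_ge0 ?exprn_ge0 ?(ltW del0)//.
  apply: (le_trans (leb_preimage_ge x H s0)); apply: le_measure; rewrite ?inE.
  - exact: measurable_preimage_rV (qs_contV H) (measurable_nball _ _).
  - exact: measurable_preimage_rV (qs_contV H) (measurable_nball _ _).
  - by move=> z /= hz; apply: (le_trans hz); rewrite ler_pdivrMr// ler_peMr ?(ltW s0)// ler1n.
apply: (le_trans step1).
rewrite ge0_integralZl//; first last.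
- by rewrite lee_fin invr_ge0 exprn_ge0// ltW.
- by move=> x _; apply: integral_ge0 => z _; rewrite lee_fin.
- exact: (@measurable_fun_fubini_tonelli_F _ _ _ _ _ leb (EFin \o f)).
rewrite (@fubini_tonelli _ _ _ _ _ leb leb (EFin \o f))//.
have step2 : (\int[leb]_z \int[leb]_x (f (x, z))%:E <=
   \int[leb]_z (((4 * s) ^+ n)%:E * (\1_(phiV @^-1` nball x0 (2 * r)) z)%:E))%E.
  apply: ge0_le_integralT => z; first by apply: integral_ge0 => x _; rewrite lee_fin.
  have [zin|zout] := boolP (phiV z \in nball x0 (2 * r)); last first.
    rewrite integral0_eq; last first.
      move=> x _; rewrite /f/= !indicE.
      have [|] := boolP (x \in _); last by rewrite mul0r.
      have [|] := boolP ((x, z) \in S); last by rewrite mulr0.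
      rewrite !inE /S/= => h1 h2; move: zout; rewrite notin_setE => -[] /=.
      rewrite /nball/= (_ : x0 - phiV z = (x0 - x) + (x - phiV z)); last by rewrite addrA subrK.
      by rewrite (le_trans (ler_normD _ _))// mulr_natl mulr2n lerD// (le_trans h1).
    by rewrite mule_ge0// lee_fin// exprn_ge0// mulr_ge0// ltW.
  have -> : \1_(phiV @^-1` nball x0 (2 * r)) z = 1 :> R.
    by rewrite indicE mem_set//; exact: set_mem zin.
  rewrite mule1; apply: le_trans (leb_nball_le (phiV z) (ltW s0)).
  rewrite -(integral_indicT leb (measurable_nball _ _)).
  apply: ge0_le_integralT => x; first by rewrite lee_fin.
  rewrite lee_fin /f/=; apply: (@le_trans _ _ (\1_S (x, z))).
    by rewrite ler_piMl// indicE lern1 leq_b1.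
  rewrite !indicE ler_nat; have [|//] := boolP ((x, z) \in S).
  by rewrite inE /S/= => xz; rewrite mem_set// /nball/= distrC.
apply: (@le_trans _ _ ((del ^- n)%:E * (((4 * s) ^+ n)%:E * leb (phiV @^-1` nball x0 (2 * r))))%E).
  rewrite lee_wpmul2l ?lee_fin ?invr_ge0 ?exprn_ge0 ?(ltW del0)//.
  apply: (le_trans step2).
  have mp : measurable (phiV @^-1` nball x0 (2 * r)).
    exact: measurable_preimage_rV (qs_contV H) (measurable_nball _ _).
  rewrite ge0_integralZl_real//; last by rewrite exprn_ge0// mulr_ge0// ltW.
  by rewrite integral_indicT.
apply: (@le_trans _ _ ((del ^- n)%:E * (((4 * s) ^+ n)%:E * ((4 * (K 2 * img_rad phi x0 r)) ^+ n)%:E))%E).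
  rewrite !lee_wpmul2l ?lee_fin ?invr_ge0 ?exprn_ge0 ?mulr_ge0 ?(ltW del0) ?(ltW s0)//.
  exact: leb_preimage_le.
rewrite -!EFinM lee_fin -!exprVn -!exprMn le_eqVlt; apply/orP; left; apply/eqP.
by congr (_ ^+ _); rewrite /del invrK; ring.
Qed.

End image_radius.

(** * Energy of a quasisymmetric map on a ball *)

Section energy.
Context (R : realType) (n : nat) (n0 : (0 < n)%N).
Local Notation leb := (lebesgue_rV R n).
Implicit Types (phi phiV : 'rV[R]_n -> 'rV[R]_n) (K : R -> R) (x y z : 'rV[R]_n).

(** [F] is dominated by a sum of constants times indicators of balls about [x]. The family [s]
    serves the points near [x], the family [t] the distant ones; nested balls instead of disjoint
    shells cost only a constant. *)
Lemma integral_shells_le (a s b t : nat -> R) x (F : 'rV[R]_n -> R) :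
  (forall k, 0 <= a k) -> (forall k, 0 <= s k) ->
  (forall k, 0 <= b k) -> (forall k, 0 <= t k) ->
  (forall y, 0 <= F y) ->
  (forall y, F y = 0 \/ (exists k, `|x - y| <= s k /\ F y <= a k) \/
     (exists k, `|x - y| <= t k /\ F y <= b k)) ->
  (\int[leb]_y (F y)%:E
     <= \sum_(k <oo) (a k * (4 * s k) ^+ n + b k * (4 * t k) ^+ n)%:E)%E.
Proof.
move=> a0 s0 b0 t0 F0 Fle.
pose G k y : R := a k * \1_(nball x (s k)) y + b k * \1_(nball x (t k)) y.
have G0 k y : 0 <= G k y by rewrite addr_ge0// mulr_ge0.
have mind (r : R) : measurable_fun setT (\1_(nball x r) : _ -> R).
  by apply: measurable_indic; exact: measurable_nball.
have mG k : measurable_fun setT (G k).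
  by apply: measurable_funD; apply: measurable_funM => //; exact: measurable_cst.
apply: (@le_trans _ _ (\int[leb]_y \sum_(k <oo) (G k y)%:E)%E).
  apply: ge0_le_integralT => y; first by rewrite lee_fin.
  have Ge k : F y <= G k y -> ((F y)%:E <= \sum_(k <oo) (G k y)%:E)%E.
    move=> h; apply: (@le_trans _ _ (G k y)%:E); first by rewrite lee_fin.
    by apply: (@nneseries_ge_term _ (fun k => (G k y)%:E)) => j; rewrite lee_fin.
  have [->|[[k [h1 h2]]|[k [h1 h2]]]] := Fle y.
  - by apply: nneseries_ge0 => k _ _; rewrite lee_fin.
  - apply: (Ge k); apply: (le_trans h2).
    by rewrite /G [in X in _ <= X + _]indicE mem_set// mulr1 lerDl mulr_ge0.
  - apply: (Ge k); apply: (le_trans h2).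
    by rewrite /G [in X in _ <= _ + X]indicE mem_set// mulr1 lerDr mulr_ge0.
rewrite integral_nneseries//; last 2 first.
- by move=> k; apply/measurable_EFinP; exact: mG.
- by move=> k y _; rewrite lee_fin.
apply: lee_nneseries => [k _ _|k _].
  by apply: integral_ge0 => y _; rewrite lee_fin.
have -> : (\int[leb]_y (G k y)%:E = (a k)%:E * leb (nball x (s k))
    + (b k)%:E * leb (nball x (t k)))%E.
  rewrite /G; under eq_integral do rewrite EFinD.
  rewrite ge0_integralD//; last 4 first.
  - by move=> y _; rewrite lee_fin mulr_ge0.
  - by apply/measurable_EFinP/measurable_funM => //; exact: measurable_cst.
  - by move=> y _; rewrite lee_fin mulr_ge0.
  - by apply/measurable_EFinP/measurable_funM => //; exact: measurable_cst.
  rewrite !ge0_integralZl_real// !integral_indicT//; exact: measurable_nball.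
rewrite EFinD !EFinM leeD// lee_wpmul2l ?lee_fin//; exact: leb_nball_le.
Qed.

(* The power q is used for D below the scale, where q > 2 al makes the energy
   converge, the power e above it; see minr_sqr_le_wmin for the dual weight. *)
Definition wmin (q e u : R) : R := Num.min (u `^ q) (u `^ e).

Lemma wmin_ge0 q e u : 0 <= wmin q e u.
Proof. by rewrite le_min !powR_ge0. Qed.

Lemma wmin_lel q e u : wmin q e u <= u `^ q.
Proof. by rewrite ge_min lexx. Qed.

Lemma wmin_ler q e u : wmin q e u <= u `^ e.
Proof. by rewrite ge_min lexx orbT. Qed.

Lemma wmin0 q e : 0 < q -> wmin q e 0 = 0.
Proof.
by move=> q0; rewrite /wmin powR0 ?gt_eqF//; apply/min_idPl; exact: powR_ge0.
Qed.

Lemma powR_shell (h s al : R) : 0 < h -> 0 < s ->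
  (h * s) `^ (- (n%:R + 2 * al)) * (4 * s) ^+ n =
  (h `^ (- (n%:R + 2 * al)) * 4 ^+ n) * s `^ (- (2 * al)).
Proof.
move=> h0 s0; rewrite powRM ?ltW// exprMn -!mulrA; congr (_ * _).
rewrite mulrCA; congr (_ * _); rewrite -powR_mulrn ?ltW// -powRD; last first.
  by rewrite (gt_eqF s0) implybT.
by congr (_ `^ _); rewrite opprD addrAC addNr add0r.
Qed.

(** Each doubling of the radius multiplies [img_rad] by at most [K 2]; this power growth is what the
    exponent [e] has to compensate. *)
Lemma qs_growth K phi phiV x y r k : qs_pair K phi phiV -> 0 < r ->
  `|x - y| <= 2 ^+ k * r -> `|phi x - phi y| <= K 1 * (K 2 ^+ k * img_rad phi x r).
Proof.
move=> H r0 xy.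
have K0 t : 0 <= K t by rewrite (le_trans ler01)// (qs_ge1 H).
apply: (@le_trans _ _ (K 1 * img_rad phi x (2 ^+ k * r))).
  by apply: (qs_img_rad n0 H); rewrite ?mul1r// mulr_ge0 ?exprn_ge0// ltW.
rewrite ler_wpM2l//; elim: k {xy} => [|k IH]; first by rewrite !expr0 !mul1r.
rewrite exprS -mulrA exprS -mulrA; apply: le_trans (ler_wpM2l (K0 2) IH).
rewrite {1}/img_rad; apply: (qs_img_rad n0 H) => //; first by rewrite mulr_ge0 ?exprn_ge0// ltW.
by rewrite norm_shift// !mulr_ge0 ?exprn_ge0// ltW.
Qed.

Lemma img_rad_le_near K phi phiV x0 x r : qs_pair K phi phiV -> 0 < r ->
  `|x0 - x| <= r -> img_rad phi x r <= (K 1 + K 2) * img_rad phi x0 r.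
Proof.
move=> H r0 h; rewrite /img_rad.
rewrite (_ : phi x - _ = (phi x - phi x0) + (phi x0 - phi (x + r *: const_mx 1))); last first.
  by rewrite addrA subrK.
rewrite (le_trans (ler_normD _ _))// mulrDl lerD//.
  by rewrite distrC; apply: (qs_img_rad n0 H); rewrite ?mul1r// ltW.
apply: (qs_img_rad n0 H) => //; first exact: ltW.
rewrite (_ : x0 - _ = (x0 - x) + (x - (x + r *: const_mx 1))); last by rewrite addrA subrK.
by rewrite (le_trans (ler_normD _ _))// mulr_natl mulr2n lerD// norm_shift// ltW.
Qed.

(** On the ball of radius s = 2^(-k) r, kernel times volume is of order s^(-2 al). There W u <= u^q
    and [powR_le_expn] give the decay lam = 2^(-(q - 2 al)), with an n-th power of [img_rad] left to
    be integrated in [x]. At distance 2^k r, W u <= u^e and the growth (K 2)^k give (K 2)^e 2^(-2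
    al) <= 2^(-al) = mu. *)
Lemma energy_pointwise K (al q e L : R) : 0 < al -> 2 * al < q -> q <= n%:R -> 0 < e ->
  K 2 `^ e <= 2 `^ al -> 0 < L ->
  exists c1 c2 lam mu : R, [/\ 0 <= c1, 0 <= c2, 0 < lam < 1, 0 < mu < 1 &
    forall phi phiV, qs_pair K phi phiV -> forall x0 x r rho, 0 < r -> 0 < rho ->
      img_rad phi x0 r <= L * rho -> `|x0 - x| <= r ->
      (\int[leb]_y (wmin q e (`|phi x - phi y| / rho)
                      * `|x - y| `^ (- (n%:R + 2 * al)))%:E
        <= \sum_(k <oo) (r `^ (- (2 * al)) * (c1 * lam ^+ k *
             (1 + (K 1 * img_rad phi x (2^-1 ^+ k * r) / (rho * 2^-1 ^+ k)) ^+ n)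
             + c2 * mu ^+ k))%:E)%E].
Proof.
move=> al0 alq qn e0 K2e L0.
have q0 : 0 < q by apply: lt_trans alq; rewrite mulr_gt0.
set P := n%:R + 2 * al.
have P0 : 0 < P by rewrite ltr_wpDl// mulr_gt0.
have h0 : 0 < 2^-1 :> R by rewrite invr_gt0.
have h1 : 2^-1 < 1 :> R by rewrite invf_lt1// ltr1n.
(* [M0 * K 2 ^+ k.+1] bounds D / rho on the k-th outer ball: [K 1] comes from [qs_growth],
   [K 1 + K 2] from moving the center from [x] to [x0], and [L] from the bound on
   [img_rad phi x0 r]. *)
pose M0 := `|K 1| * (`|K 1| + `|K 2|) * L.
exists (2^-1 `^ (- P) * 4 ^+ n), ((M0 * K 2) `^ e * 8 ^+ n),
  (2^-1 `^ (q - 2 * al)), (2^-1 `^ al).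
split; rewrite ?powR_gt0 ?powR_lt1 ?subr_gt0// ?mulr_ge0 ?powR_ge0 ?exprn_ge0//.
move=> phi phiV H x0 x r rho r0 rho0 hL hx.
have K0 t : 0 <= K t by rewrite (le_trans ler01)// (qs_ge1 H).
have hk0 k : 0 < 2^-1 ^+ k :> R by rewrite exprn_gt0.
have tk0 k : 0 < 2 ^+ k :> R by rewrite exprn_gt0.
pose a k := (K 1 * img_rad phi x (2^-1 ^+ k * r) / rho) `^ q * (2^-1 * (2^-1 ^+ k * r)) `^ (- P).
pose b k := (M0 * K 2 ^+ k.+1) `^ e * (2 ^+ k * r) `^ (- P).
apply: le_trans (@integral_shells_le a (fun k => 2^-1 ^+ k * r)
   b (fun k => 2 ^+ k.+1 * r) x _ _ _ _ _ _ _) _.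
- by move=> k; rewrite mulr_ge0 ?powR_ge0.
- by move=> k; rewrite mulr_ge0 ?ltW.
- by move=> k; rewrite mulr_ge0 ?powR_ge0.
- by move=> k; rewrite mulr_ge0 ?ltW.
- by move=> y; rewrite mulr_ge0 ?powR_ge0 ?wmin_ge0.
- move=> y; have [<-|xy] := eqVneq x y.
    by left; rewrite !subrr !normr0 mul0r wmin0// mul0r.
  have t0 : 0 < `|x - y| by rewrite normr_gt0 subr_eq0.
  right; have [xyr|xyr] := leP (`|x - y| / r) 1.
    left; have [k /andP[k1 k2]] := dyadic_scale_small (divr_gt0 t0 r0) xyr.
    exists k; move: k1 k2; rewrite ltr_pdivlMr// ler_pdivrMr// => k1 k2; split=> //.
    rewrite /a ler_pM ?wmin_ge0 ?powR_ge0//.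
      apply: (le_trans (wmin_lel _ _ _)); rewrite ge0_ler_powR ?nnegrE ?(ltW q0)//.
      - by rewrite divr_ge0// ltW.
      - by rewrite divr_ge0 ?mulr_ge0 ?img_rad_ge0// ltW.
      rewrite ler_pM2r ?invr_gt0//.
      by apply: (qs_img_rad n0 H) => //; rewrite ?mul1r// mulr_ge0 ?ltW.
    rewrite !powRN lef_pV2 ?posrE ?powR_gt0 ?mulr_gt0//.
    rewrite ge0_ler_powR ?nnegrE ?(ltW P0)//; first by rewrite !mulr_ge0 ?ltW.
    by rewrite mulrA -exprS ltW.
  right; have [k /andP[k1 k2]] := dyadic_scale_large xyr.
  exists k; move: k1 k2; rewrite ltr_pdivlMr// ler_pdivrMr// => k1 k2; split=> //.
  have M00 : 0 <= M0 by rewrite !mulr_ge0 ?addr_ge0// ltW.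
  rewrite /b ler_pM ?wmin_ge0 ?powR_ge0//.
    apply: (le_trans (wmin_ler _ _ _)); rewrite ge0_ler_powR ?nnegrE ?(ltW e0)//.
    - by rewrite divr_ge0// ltW.
    - by rewrite mulr_ge0// exprn_ge0.
    rewrite ler_pdivrMr//; apply: (le_trans (qs_growth H r0 k2)).
    rewrite /M0 !ger0_norm//.
    rewrite (_ : _ * L * _ * rho = K 1 * (K 2 ^+ k.+1 * ((K 1 + K 2) * (L * rho)))); last by ring.
    rewrite ler_wpM2l// ler_wpM2l ?exprn_ge0//.
    apply: (le_trans (img_rad_le_near H r0 hx)); rewrite ler_wpM2l ?addr_ge0//.
  rewrite !powRN lef_pV2 ?posrE ?powR_gt0 ?mulr_gt0//.
  by rewrite ge0_ler_powR ?nnegrE ?(ltW P0)//; [rewrite !mulr_ge0 ?ltW|rewrite ltW].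
apply: lee_nneseries => [k _ _|k _].
  have M00 : 0 <= M0 by rewrite !mulr_ge0 ?addr_ge0// ltW.
  by rewrite lee_fin addr_ge0// ?mulr_ge0 ?powR_ge0 ?exprn_ge0 ?mulr_ge0 ?(ltW r0) ?(ltW (hk0 _)) ?(ltW (tk0 _)).
have M00 : 0 <= M0 by rewrite !mulr_ge0 ?addr_ge0// ltW.
rewrite lee_fin mulrDr; apply: lerD.
  rewrite /a -mulrA powR_shell ?mulr_gt0//.
  set c := 2^-1 `^ (- P) * 4 ^+ n.
  have c0 : 0 <= c by rewrite mulr_ge0 ?powR_ge0 ?exprn_ge0.
  apply: (@le_trans _ _ ((2^-1 ^+ k) `^ q * (1 + (K 1 * img_rad phi x (2^-1 ^+ k * r) / rho / 2^-1 ^+ k) ^+ n)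
     * (c * (2^-1 ^+ k * r) `^ (- (2 * al))))).
    rewrite ler_wpM2r ?mulr_ge0 ?powR_ge0//.
    by rewrite powR_le_expn ?(ltW q0)// divr_ge0 ?mulr_ge0 ?img_rad_ge0// ltW.
  rewrite powRM ?(ltW r0) ?(ltW (hk0 _))//.
  have -> : (2^-1 `^ (q - 2 * al)) ^+ k = (2^-1 ^+ k) `^ q * (2^-1 ^+ k) `^ (- (2 * al)) :> R.
    rewrite powRD; last by rewrite (gt_eqF h0) implybT.
    by rewrite exprMn !powR_expn ?(ltW h0).
  rewrite (_ : K 1 * _ / (rho * _) = K 1 * img_rad phi x (2^-1 ^+ k * r) / rho / 2^-1 ^+ k); last first.
    by rewrite invfM mulrA.
  rewrite le_eqVlt; apply/orP; left; apply/eqP; ring.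
rewrite /b -mulrA.
have -> : 4 * (2 ^+ k.+1 * r) = 2 * (4 * (2 ^+ k * r)) by rewrite exprS; ring.
rewrite exprMn [2 ^+ n * _]mulrC.
have := @powR_shell 1 (2 ^+ k * r) al ltr01 (mulr_gt0 (tk0 k) r0).
rewrite mul1r -/P powR1 mul1r => e1.
rewrite [X in _ * X]mulrA e1.
have -> : M0 * K 2 ^+ k.+1 = (M0 * K 2) * K 2 ^+ k by rewrite exprS mulrA.
rewrite [(M0 * K 2 * _) `^ _]powRM ?mulr_ge0 ?exprn_ge0 ?addr_ge0 ?(ltW L0)//.
rewrite [(2 ^+ k * r) `^ _]powRM ?(ltW r0) ?(ltW (tk0 _))// !powR_expn//.
have e8 : 8 ^+ n = 4 ^+ n * 2 ^+ n :> R by rewrite -exprMn; congr (_ ^+ _); ring.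
rewrite e8; set X := (M0 * K 2) `^ e; set Y := r `^ _.
have X0 : 0 <= X by exact: powR_ge0.
have Y0 : 0 <= Y by exact: powR_ge0.
have : (K 2 `^ e) ^+ k * (2 `^ (- (2 * al))) ^+ k <= (2^-1 `^ al) ^+ k.
  rewrite -exprMn lerXn2r ?nnegrE ?mulr_ge0 ?powR_ge0//.
  have -> : 2^-1 `^ al = 2 `^ al * 2 `^ (- (2 * al)) :> R.
    rewrite -powRD ?pnatr_eq0 ?implybT// -powR_inv1// -powRrM; congr (_ `^ _); ring.
  by rewrite ler_wpM2r ?powR_ge0.
move=> h.
apply: (@le_trans _ _ ((Y * (X * (4 ^+ n * 2 ^+ n))) *
    ((K 2 `^ e) ^+ k * (2 `^ (- (2 * al))) ^+ k))).
  by rewrite le_eqVlt; apply/orP; left; apply/eqP; ring.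
apply: (@le_trans _ _ ((Y * (X * (4 ^+ n * 2 ^+ n))) * (2^-1 `^ al) ^+ k)).
  by rewrite ler_wpM2l// !mulr_ge0 ?exprn_ge0.
by rewrite le_eqVlt; apply/orP; left; apply/eqP; ring.
Qed.

(** Integrating [energy_pointwise] over the ball, [integral_img_rad_le] at scale 2^(-k) r yields the
    factors (2^(-k))^n and rho^n, which cancel the denominator (rho 2^(-k))^n. Each k thus
    contributes r^(n - 2 al) times a geometric term. *)
Lemma energy_le K (al q e L : R) : 0 < al -> 2 * al < q -> q <= n%:R -> 0 < e ->
  K 2 `^ e <= 2 `^ al -> 0 < L ->
  exists2 C : R, 0 < C &
    forall phi phiV, qs_pair K phi phiV -> forall x0 r rho, 0 < r -> 0 < rho ->
      img_rad phi x0 r <= L * rho ->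
      (\int[leb]_x \int[leb]_y (\1_(nball x0 r) x *
          (wmin q e (`|phi x - phi y| / rho) * `|x - y| `^ (- (n%:R + 2 * al))))%:E
        <= (C * r `^ (n%:R - 2 * al))%:E)%E.
Proof.
move=> al0 alq qn e0 K2e L0.
have [c1 [c2 [lam [mu [c10 c20 /andP[lam0 lam1] /andP[mu0 mu1] Hpt]]]]] :=
  energy_pointwise al0 alq qn e0 K2e L0.
pose CT := (32 * K 2 * K 2) ^+ n.
(* The absolute values make [c3] nonnegative before a [qs_pair], and with it the sign of [K], is
   available. *)
pose c3 := c1 * (4 ^+ n + `|K 1| ^+ n * `|CT| * L ^+ n).
pose c4 := c2 * 4 ^+ n.
have c30 : 0 <= c3 by rewrite mulr_ge0// addr_ge0 ?exprn_ge0// !mulr_ge0 ?exprn_ge0// ltW.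
have c40 : 0 <= c4 by rewrite mulr_ge0// exprn_ge0.
exists (1 + (c3 * (1 - lam)^-1 + c4 * (1 - mu)^-1)).
  by rewrite ltr_wpDr// addr_ge0// mulr_ge0// invr_ge0 subr_ge0 ltW.
move=> phi phiV H x0 r rho r0 rho0 hL.
have K0 t : 0 <= K t by rewrite (le_trans ler01)// (qs_ge1 H).
have CT0 : 0 <= CT by rewrite exprn_ge0// !mulr_ge0.
have hk0 k : 0 < 2^-1 ^+ k :> R by rewrite exprn_gt0.
pose g k x : R := r `^ (- (2 * al)) * (c1 * lam ^+ k *
             (1 + (K 1 * img_rad phi x (2^-1 ^+ k * r) / (rho * 2^-1 ^+ k)) ^+ n)
             + c2 * mu ^+ k).
have g0 k x : 0 <= g k x.
  rewrite mulr_ge0 ?powR_ge0// addr_ge0 ?mulr_ge0 ?exprn_ge0 ?(ltW lam0) ?(ltW mu0)//.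
  by rewrite addr_ge0// exprn_ge0// divr_ge0 ?mulr_ge0 ?img_rad_ge0 ?(ltW rho0) ?(ltW (hk0 _)).
have mind : measurable_fun setT (\1_(nball x0 r) : _ -> R).
  by apply: measurable_indic; exact: measurable_nball.
have mrad s : measurable_fun setT (img_rad phi ^~ s).
  exact: continuous_measurable_rV (continuous_img_rad H).
have mg k : measurable_fun setT (fun x => \1_(nball x0 r) x * g k x).
  apply: measurable_funM => //; rewrite /g.
  apply: measurable_funM => //; apply: measurable_funD => //.
  apply: measurable_funM => //; apply: measurable_funD => //.
  apply: measurable_funX; apply: measurable_funM => //.
  by apply: measurable_funM.
apply: (@le_trans _ _ (\int[leb]_x \sum_(k <oo) (\1_(nball x0 r) x * g k x)%:E)%E).
  apply: ge0_le_integralT => x.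
    by apply: integral_ge0 => y _; rewrite lee_fin !mulr_ge0 ?wmin_ge0 ?powR_ge0.
  rewrite indicE; have [|] := boolP (x \in _).
    rewrite inE => hx; under eq_integral do rewrite mul1r.
    apply: le_trans (Hpt phi phiV H x0 x r rho r0 rho0 hL hx) _.
    by apply: lee_nneseries => [k _ _|k _]; rewrite ?mul1r// lee_fin; exact: g0.
  move=> _; under eq_integral do rewrite mul0r.
  by rewrite integral0; apply: nneseries_ge0 => k _ _; rewrite mul0r.
rewrite integral_nneseries//; last 2 first.
- by move=> k; exact/measurable_EFinP.
- by move=> k x _; rewrite lee_fin mulr_ge0.
have gk k : (\int[leb]_x (\1_(nball x0 r) x * g k x)%:E <=
    (r `^ (n%:R - 2 * al) * (c3 * lam ^+ k + c4 * mu ^+ k))%:E)%E.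
  set s := 2^-1 ^+ k * r.
  pose A := r `^ (- (2 * al)) * (c1 * lam ^+ k + c2 * mu ^+ k).
  pose B := r `^ (- (2 * al)) * (c1 * lam ^+ k) * (K 1 / (rho * 2^-1 ^+ k)) ^+ n.
  have A0 : 0 <= A.
    by rewrite mulr_ge0 ?powR_ge0// addr_ge0 ?mulr_ge0 ?exprn_ge0 ?(ltW lam0) ?(ltW mu0).
  have B0 : 0 <= B.
    rewrite !mulr_ge0 ?powR_ge0// ?exprn_ge0 ?(ltW lam0)//.
    by rewrite divr_ge0// mulr_ge0 ?(ltW rho0) ?(ltW (hk0 _)).
  have -> : (fun x => (\1_(nball x0 r) x * g k x)%:E) =
     (fun x => (A * \1_(nball x0 r) x)%:E + (B * (\1_(nball x0 r) x * img_rad phi x s ^+ n))%:E)%E.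
    apply/funext => x; rewrite -EFinD; congr EFin; rewrite /g /A /B.
    rewrite (_ : K 1 * _ / _ = (K 1 / (rho * 2^-1 ^+ k)) * img_rad phi x s); last by rewrite mulrAC.
    rewrite exprMn; ring.
  have mrn : measurable_fun setT (fun x => \1_(nball x0 r) x * img_rad phi x s ^+ n).
    by apply: measurable_funM => //; exact: measurable_funX.
  have rn0 x : 0 <= \1_(nball x0 r) x * img_rad phi x s ^+ n.
    by apply: mulr_ge0 => //; apply: exprn_ge0; exact: img_rad_ge0.
  rewrite ge0_integralD//; last 4 first.
  - by move=> x _; rewrite lee_fin mulr_ge0.
  - by apply/measurable_EFinP/measurable_funM.
  - by move=> x _; rewrite lee_fin; apply: mulr_ge0.
  - by apply/measurable_EFinP/measurable_funM.
  rewrite !ge0_integralZl_real//.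
  rewrite integral_indicT; last exact: measurable_nball.
  apply: (@le_trans _ _ (A%:E * ((4 * r) ^+ n)%:E + B%:E * (CT * s ^+ n * img_rad phi x0 r ^+ n)%:E)%E).
    rewrite leeD// lee_wpmul2l ?lee_fin//; first exact/leb_nball_le/ltW.
    apply: (integral_img_rad_le n0 x0 H); first by rewrite mulr_gt0.
    by rewrite ler_piMl ?(ltW r0)// exprn_ile1// invf_le1// ler1n.
  rewrite -!EFinM -EFinD lee_fin.
  apply: (@le_trans _ _ (A * (4 * r) ^+ n + B * (CT * s ^+ n * (L * rho) ^+ n))).
    have Lr0 : 0 <= L * rho by rewrite mulr_ge0 ?(ltW L0) ?(ltW rho0).
    rewrite lerD2l; apply: ler_wpM2l => //; apply: ler_wpM2l.
      by rewrite mulr_ge0// exprn_ge0// mulr_ge0 ?(ltW r0) ?(ltW (hk0 _)).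
    by rewrite lerXn2r ?nnegrE ?img_rad_ge0.
  have -> : r `^ (n%:R - 2 * al) = r `^ (- (2 * al)) * r ^+ n.
    rewrite powRD; last by rewrite (gt_eqF r0) implybT.
    by rewrite powR_mulrn ?ltW// mulrC.
  rewrite /A /B /c3 /c4 /s !ger0_norm// le_eqVlt; apply/orP; left; apply/eqP.
  rewrite !exprMn [(_ * _)^-1 ^+ n]exprVn exprMn invfM.
  have u1 : rho ^+ n != 0 by rewrite expf_neq0// gt_eqF.
  have u2 : (2^-1 ^+ k) ^+ n != 0 :> R by rewrite expf_neq0// gt_eqF.
  move: (rho ^+ n) ((2^-1 ^+ k) ^+ n) u1 u2 => U V u1 u2.
  by field; rewrite u1 u2.
apply: nneseries_le => [k|N].
  by apply: integral_ge0 => x _; rewrite lee_fin mulr_ge0.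
apply: le_trans (lee_sum _ (fun k _ => gk k)) _.
rewrite sumEFin lee_fin -mulr_sumr mulrC ler_wpM2r ?powR_ge0//.
rewrite big_mkord big_split/= -!mulr_sumr ler_wpDl// lerD// ler_wpM2l//.
  exact: geometric_sum_le (ltW lam0) lam1.
exact: geometric_sum_le (ltW mu0) mu1.
Qed.

End energy.

(** * Dyadic cubes and the packing condition *)

Section dyadic_generations.
Context (R : realType) (n : nat).
Implicit Types (Q J P : dyadic n).

Definition corner J : 'rV[R]_n := \row_i (side R J * (J.2 0 i)%:~R).

Lemma side_gt0 J : 0 < side R J.
Proof. by rewrite exprz_gt0. Qed.

Lemma gen_level Q k J : J \in gen Q k -> J.1 = Q.1 + k%:Z.
Proof.
elim: k J => [|k IH] J; first by rewrite inE => /eqP->; rewrite addr0.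
rewrite /gen iterS => /flattenP[s /mapP[P PQ ->]] /mapP[e _ ->] /=.
by rewrite (IH _ PQ) -addrA [k%:Z + 1]addrC -intS.
Qed.

Lemma side_gen Q k J : J \in gen Q k -> side R J = side R Q * 2^-1 ^+ k.
Proof.
move=> /gen_level; rewrite /side => ->.
have two0 : 2 != 0 :> R by rewrite pnatr_eq0.
by rewrite opprD (expfzDr _ _ two0) exprVn -exprnN.
Qed.

Lemma iter_bisect_flatten (s : seq (dyadic n)) j :
  iter j (fun s => flatten [seq bisect P | P <- s]) s =
  flatten [seq gen P j | P <- s].
Proof.
elim: j => [|j IH] /=; first by rewrite /gen/= flatten_seq1.
rewrite IH; elim: s {IH} => //= P s IH.
by rewrite map_cat flatten_cat IH.
Qed.

Lemma gen_add Q k j : gen Q (k + j) = flatten [seq gen P j | P <- gen Q k].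
Proof. by rewrite -iter_bisect_flatten /gen addnC iterD. Qed.

Lemma gen_descendants Q k J : J \in gen Q k -> descendants Q J.
Proof. by move=> ?; exists k. Qed.

Lemma descendants_trans Q P J : descendants Q P -> descendants P J -> descendants Q J.
Proof.
move=> [k Pk] [j Jj]; exists (k + j)%N; rewrite gen_add.
by apply/flattenP; exists (gen P j) => //; apply/mapP; exists P.
Qed.

Lemma bisect_corner P J : J \in bisect P ->
  forall i, corner P 0 i <= corner J 0 i /\
    corner J 0 i + side R J <= corner P 0 i + side R P.
Proof.
move=> JP i; have sJ : side R J = side R P * 2^-1.
  have JP' : J \in gen P 1 by rewrite /gen/= cats0.
  by rewrite (side_gen JP') expr1.
have s0 := side_gt0 P.
move: JP => /mapP[e _ eJ]; rewrite /corner !mxE sJ {sJ}eJ !mxE/=.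
rewrite intrD intrM; case: (e i) => /=.
  by split; nra.
by split; nra.
Qed.

Lemma gen_corner Q k J : J \in gen Q k ->
  forall i, corner Q 0 i <= corner J 0 i /\
    corner J 0 i + side R J <= corner Q 0 i + side R Q.
Proof.
elim: k J => [|k IH] J; first by rewrite inE => /eqP->.
rewrite /gen iterS => /flattenP[s /mapP[P PQ ->]] JP i.
have [a1 a2] := IH _ PQ i; have [b1 b2] := bisect_corner JP i.
by split; [exact: le_trans b1|exact: le_trans a2].
Qed.

Lemma gen_dcube_sub Q k J : J \in gen Q k -> dcube R J `<=` dcube R Q.
Proof.
move=> /gen_corner h x xJ i; have [h1 h2] := h i.
have /andP[x1 x2] := xJ i.
by rewrite (le_trans h1 x1) (lt_le_trans x2 h2).
Qed.

Lemma gen_corner_dist Q k J : J \in gen Q k -> `|corner Q - corner J| <= side R Q.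
Proof.
move=> /gen_corner h; apply: rV_norm_le => [|i]; first exact/ltW/side_gt0.
have [h1 h2] := h i; have s0 := side_gt0 J.
have -> : (corner Q - corner J) 0 i = corner Q 0 i - corner J 0 i.
  by rewrite [LHS]mxE; congr (_ + _); rewrite mxE.
by rewrite ler_norml; apply/andP; split; lra.
Qed.

(** The coordinates 2 m + e of a child determine m and the bit e by parity. *)
Lemma gen_uniq Q k : uniq (gen Q k).
Proof.
elim: k => [|k IH] //; rewrite /gen iterS -/(gen Q k).
apply: (@allpairs_uniq _ _ _ (fun P (e : {ffun 'I_n -> bool}) =>
  (P.1 + 1, \row_i (2 * P.2 0 i + (nat_of_bool (e i))%:Z)) : dyadic n)) => //.
  exact: enum_uniq.
move=> [[P1 P2] e] [[P1' P2'] e'] _ _ /= [h1 h2].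
have h i : 2 * P2 0 i + (nat_of_bool (e i))%:Z = 2 * P2' 0 i + (nat_of_bool (e' i))%:Z.
  by have /rowP/(_ i) := h2; rewrite !mxE.
congr (_, _); last first.
  by apply/ffunP => i; have := h i; case: (e i); case: (e' i) => //=; lia.
congr (_, _); first by apply: (addIr 1).
apply/rowP => i; have := h i; case: (e i); case: (e' i) => //=; lia.
Qed.

(** Different generations have different levels, so their concatenation has no repetition. A single
    list is what Cauchy-Schwarz and the finite subsums of the packing condition work with. *)
Lemma gen_bounded_list Q N : exists s : seq (dyadic n),
  [/\ uniq s, (forall J, J \in s -> exists2 j, (j < N)%N & J \in gen Q j) &
    forall F : dyadic n -> R, \sum_(j < N) \sum_(J <- gen Q j) F J = \sum_(J <- s) F J].
Proof.
elim: N => [|N [s [us sN sF]]]; first by exists [::]; split => // F; rewrite big_ord0 big_nil.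
exists (s ++ gen Q N); split.
- rewrite cat_uniq us gen_uniq andbT; apply/hasPn => J JN; apply/negP => /sN[j jN Jj].
  have := gen_level JN; rewrite (gen_level Jj) => /addrI [e].
  by rewrite e ltnn in jN.
- move=> J; rewrite mem_cat => /orP[/sN[j jN Jj]|JN]; last by exists N.
  by exists j => //; exact: ltnW.
- by move=> F; rewrite big_ord_recr/= sF big_cat.
Qed.

(** Each integer coordinate of such a cube lies in a window of length 2 M, so the offsets from the
    left end of the window inject these cubes into a finite type that depends on [M] and [n]
    only. *)
Lemma count_near (M : R) : 0 <= M -> exists C : nat, forall Q k (u : 'rV[R]_n),
  (count (fun J => `|u - corner J| <= M * side R J)%R (gen Q k) <= C)%N.
Proof.
move=> M0; pose L := (Num.truncn (2 * M)).+2.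
exists #|{ffun 'I_n -> 'I_L.+1}| => Q k u.
pose s := [seq J <- gen Q k | `|u - corner J| <= M * side R J].
pose sg := side R Q * 2^-1 ^+ k.
have sg0 : 0 < sg by rewrite mulr_gt0 ?side_gt0// exprn_gt0// invr_gt0.
(* A coordinate is at most u_i / sg + M < b_i + 1 + 2 M, so its offset stays below trunc (2 M) + 2 =
   L. *)
pose b i : int := Num.floor (u 0 i / sg - M).
pose f J : {ffun 'I_n -> 'I_L.+1} := [ffun i => inord (absz (J.2 0 i - b i)%R)].
have sP J : J \in s -> J.1 = Q.1 + k%:Z /\ forall i, b i <= J.2 0 i /\ (absz (J.2 0 i - b i)%R < L.+1)%N.
  rewrite mem_filter => /andP[hJ Jk]; split; first exact: gen_level.
  move=> i; have sJ := side_gen Jk; rewrite -/sg in sJ.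
  have := le_trans (coord_le_norm (u - corner J) i) hJ.
  rewrite !mxE sJ ler_norml => /andP[h1 h2].
  have uE : u 0 i = sg * (u 0 i / sg) by rewrite mulrCA mulfV ?mulr1// gt_eqF.
  have h3 : u 0 i / sg - M <= (J.2 0 i)%:~R.
    rewrite -(ler_pM2l sg0) mulrBr -uE; lra.
  have h4 : (J.2 0 i)%:~R <= u 0 i / sg + M.
    rewrite -(ler_pM2l sg0) mulrDr -uE; lra.
  have bJ : b i <= J.2 0 i.
    by rewrite -(ler_int R); apply: le_trans h3; exact: ge_floor.
  split=> //.
  have : (J.2 0 i - b i)%:~R < (L%:Z)%:~R :> R.
    have := lt_succ_floor (u 0 i / sg - M); rewrite -/(b i) intrD => h5.
    have h6 : 2 * M < (Num.truncn (2 * M)).+1%:R.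
      by have /andP[] := truncn_itv (mulr_ge0 (ler0n R 2) M0).
    have -> : (L%:Z)%:~R = (Num.truncn (2 * M)).+1%:R + 1 :> R by rewrite -pmulrn natr1.
    move: h5; rewrite !intrD intrN => h5; lra.
  rewrite ltr_int => h; have : 0 <= J.2 0 i - b i by rewrite subr_ge0.
  by move: h; lia.
have us : uniq s by rewrite filter_uniq// gen_uniq.
have finj : {in s &, injective f}.
  move=> J J' Js J's fJ; have [e1 h1] := sP _ Js; have [e2 h2] := sP _ J's.
  case: J Js e1 h1 fJ => [J1 J2] Js /= -> h1 fJ.
  case: J' J's e2 h2 fJ => [J1' J2'] J's /= -> h2 fJ.
  congr (_, _); apply/rowP => i.
  have := congr1 (fun g : {ffun 'I_n -> 'I_L.+1} => nat_of_ord (g i)) fJ.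
  have [a1 a2] := h1 i; have [a3 a4] := h2 i.
  rewrite !ffunE !inordK//= => e; move: e a1 a3; lia.
rewrite -size_filter -/s -(size_map f) -(card_uniqP _) ?map_inj_in_uniq//.
exact: max_card.
Qed.

Lemma sum_near_le (M : R) : 0 <= M -> exists2 C : R, 0 < C &
  forall Q k (u : 'rV[R]_n) (F : dyadic n -> R) (c : R), 0 <= c ->
  (forall J, J \in gen Q k -> F J <= c) ->
  \sum_(J <- gen Q k | `|u - corner J| <= M * side R J) F J <= C * c.
Proof.
move=> M0; have [C hC] := count_near M0; exists C.+1%:R => // Q k u F c c0 Fc.
apply: (@le_trans _ _ (\sum_(J <- gen Q k | `|u - corner J| <= M * side R J) c)).
  rewrite big_seq_cond [leRHS]big_seq_cond.
  by apply: ler_sum => J /andP[Jk _]; exact: Fc.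
rewrite big_const_seq iter_addr_0 -[leLHS]mulr_natl ler_wpM2r// ler_nat.
by apply: leq_trans (hC Q k u) _.
Qed.

End dyadic_generations.

Section packing.
Context (R : realType) (n : nat) (n0 : (0 < n)%N).
Local Notation leb := (lebesgue_rV R n).
Implicit Types (phi phiV : 'rV[R]_n -> 'rV[R]_n) (K : R -> R) (x y z : 'rV[R]_n).
Implicit Types (Q J P : dyadic n).
Local Notation corner := (@corner R n).

(** This is r_J, comparable to the radius of the quasiball phi^-1 (J): [img_rad] of the inverse map
    at the corner. *)
Definition cube_rad phiV J : R := img_rad phiV (corner J) (side R J).

Lemma dcube_sub_nball J : dcube R J `<=` nball (corner J) (side R J).
Proof.
move=> y yJ; apply: rV_norm_le => [|i]; first exact/ltW/side_gt0.
have := yJ i; have := side_gt0 R J.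
rewrite -/(corner J) => s0 /andP[y1 y2].
have -> : (corner J - y) 0 i = corner J 0 i - y 0 i.
  by rewrite [LHS]mxE; congr (_ + _); rewrite mxE.
by rewrite ler_norml; apply/andP; split; lra.
Qed.

Lemma measurable_dcube J : measurable (dcube R J).
Proof. exact: measurable_cube. Qed.

Section qs.
Variables (K : R -> R) (phi phiV : 'rV[R]_n -> 'rV[R]_n).
Hypothesis H : qs_pair K phi phiV.
Let H' : qs_pair K phiV phi := qs_pair_sym H.
Let K0 t : 0 < K t. Proof. by rewrite (lt_le_trans ltr01)// (qs_ge1 H). Qed.
Let mpre A : measurable A -> measurable (phi @^-1` A).
Proof. exact: measurable_preimage_rV (qs_cont H). Qed.

Lemma cube_rad_gt0 J : 0 < cube_rad phiV J.
Proof. by apply: (img_rad_gt0 n0 _ H'); exact: side_gt0. Qed.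

Lemma leb_preimage_dcube_le J :
  (leb (phi @^-1` dcube R J) <= ((4 * (K 1 * cube_rad phiV J)) ^+ n)%:E)%E.
Proof.
apply: le_trans (leb_preimage_le n0 (corner J) H' ler01 (side_gt0 R J)).
apply: le_measure; rewrite ?inE.
- by apply: mpre; exact: measurable_dcube.
- by apply: mpre; exact: measurable_nball.
- by move=> y /dcube_sub_nball; rewrite mul1r.
Qed.

(** The inscribed ball sits at the center of the cube, whereas [cube_rad] is measured from the
    corner; changing the base point costs K 2 K 1. *)
Lemma leb_preimage_dcube_ge J :
  ((((2 * K 2)^-1 / (K 2 * K 1) * cube_rad phiV J) ^+ n)%:E <= leb (phi @^-1` dcube R J))%E.
Proof.
have s0 := side_gt0 R J; set sg := side R J in s0 *.
pose c := corner J + (sg / 2) *: const_mx 1.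
have sg2 : 0 < sg / 2 by rewrite divr_gt0.
apply: (@le_trans _ _ (leb (phi @^-1` nball c (sg / 2 / 2)))); last first.
  apply: le_measure; rewrite ?inE.
  - by apply: mpre; exact: measurable_nball.
  - by apply: mpre; exact: measurable_dcube.
  - move=> y /= hy i; have := le_trans (coord_le_norm (c - phi y) i) hy.
    rewrite /c !mxE -/sg mulr1 ler_norml => /andP[y1 y2].
    by apply/andP; split; lra.
apply: le_trans (leb_preimage_ge n0 c H' sg2).
rewrite lee_fin; apply: lerXn2r; rewrite ?nnegrE.
- by rewrite mulr_ge0 ?img_rad_ge0// divr_ge0 ?mulr_ge0 ?invr_ge0 ?mulr_ge0 ?(ltW (K0 _)).
- by rewrite mulr_ge0 ?img_rad_ge0// ?invr_ge0 ?mulr_ge0 ?(ltW (K0 _)).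
rewrite -mulrA ler_wpM2l ?invr_ge0 ?mulr_ge0 ?(ltW (K0 _))//.
rewrite mulrC ler_pdivrMr ?mulr_gt0// mulrC -mulrA.
have d1 : `|corner J - c| = sg / 2 by rewrite norm_shift// ltW.
apply: (@le_trans _ _ (K 2 * `|phiV (corner J) - phiV c|)).
  apply: (qs_le H') => //; rewrite norm_shift ?(ltW s0)// d1 -/sg; lra.
rewrite ler_wpM2l ?(ltW (K0 _))// distrC.
by apply: (qs_img_rad n0 H'); rewrite ?(ltW sg2)// distrC d1 mul1r.
Qed.

Lemma vol_preimage_dcubeE J :
  leb (phi @^-1` dcube R J) = (vol (phi @^-1` dcube R J))%:E.
Proof.
rewrite /vol fineK// ge0_fin_numE//.
exact: le_lt_trans (leb_preimage_dcube_le J) (ltry _).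
Qed.

Lemma vol_preimage_dcube_gt0 J : 0 < vol (phi @^-1` dcube R J).
Proof.
rewrite -lte_fin -vol_preimage_dcubeE; apply: lt_le_trans (leb_preimage_dcube_ge J).
by rewrite lte_fin exprn_gt0// mulr_gt0 ?cube_rad_gt0// divr_gt0 ?mulr_gt0// invr_gt0 mulr_gt0.
Qed.

Variables (al : R) (Q0 : dyadic n) (d : dyadic n -> R).
Hypotheses (al0 : 0 < al) (aln : 2 * al < n%:R).
Hypothesis d0 : forall J, descendants Q0 J -> 0 <= d J.
Hypothesis pack : packing_condition ((n%:R - 2 * al) / n%:R) phi Q0 d.
Let beta := (n%:R - 2 * al) / n%:R.
Let nR0 : 0 < n%:R :> R. Proof. by rewrite ltr0n. Qed.
Let beta0 : 0 <= beta. Proof. by rewrite divr_ge0 ?subr_ge0// ltW. Qed.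

(** The packing condition tested on [P], with the infinite sum bounded below by a finite subsum and
    the positive volume of phi^-1 (P) cleared from the denominator. *)
Lemma packing_sum_le P N : descendants Q0 P ->
  \sum_(j < N) \sum_(J <- gen P j) d J * vol (phi @^-1` dcube R J) `^ beta
    <= vol (phi @^-1` dcube R P) `^ beta.
Proof.
move=> QP; have [s [us sN sF]] := gen_bounded_list R P N; rewrite sF.
have vP := vol_preimage_dcube_gt0 P.
set VP := vol (phi @^-1` dcube R P) in vP *.
suff : ((\sum_(J <- s) d J * (vol (phi @^-1` dcube R J) / VP) `^ beta)%:E <= 1)%E.
  rewrite lee_fin => h; rewrite -[leRHS]mul1r.
  apply: le_trans (ler_wpM2r (powR_ge0 _ _) h).
  rewrite mulr_suml; apply: ler_sum => J _.
  rewrite -mulrA -powRM ?divr_ge0 ?(ltW vP) ?(ltW (vol_preimage_dcube_gt0 J))//.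
  by rewrite divfK// gt_eqF.
apply: le_trans pack; apply: le_trans; last first.
  by apply: ereal_sup_ubound; exists P.
apply: esum_ge; exists [set` s].
  split; first exact: finite_seq.
  move=> J /= /sN[j _ Jj]; split; last exact: gen_dcube_sub Jj.
  by apply: descendants_trans QP _; exact: gen_descendants Jj.
by rewrite -fsbig_seq// sumEFin.
Qed.

(** Only the term of the cube itself is kept. *)
Lemma packing_le1 J : descendants Q0 J -> d J <= 1.
Proof.
move=> QJ; have := packing_sum_le 1 QJ.
rewrite big_ord1 /gen/= big_seq1 -[leRHS]mul1r ler_pM2r//.
by rewrite powR_gt0// vol_preimage_dcube_gt0.
Qed.

Lemma cube_rad_powR_le J : cube_rad phiV J `^ (n%:R - 2 * al) <=
  ((2 * K 2)^-1 / (K 2 * K 1)) `^ (- (n%:R - 2 * al)) * vol (phi @^-1` dcube R J) `^ beta.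
Proof.
set c := _ / _; have c0 : 0 < c by rewrite divr_gt0 ?invr_gt0 ?mulr_gt0.
have := leb_preimage_dcube_ge J; rewrite vol_preimage_dcubeE lee_fin -/c => h.
have p0 := cube_rad_gt0 J.
rewrite powRN -(ler_pM2l (powR_gt0 (n%:R - 2 * al) c0)) mulrA mulfV ?mul1r ?gt_eqF ?powR_gt0//.
rewrite -powRM ?(ltW c0) ?(ltW p0)//.
have e : n%:R - 2 * al = n%:R * beta by rewrite mulrCA mulfV ?mulr1// gt_eqF.
have cp0 : 0 <= c * cube_rad phiV J := mulr_ge0 (ltW c0) (ltW p0).
rewrite e powRrM powR_mulrn//.
apply: ge0_ler_powR => //; rewrite nnegrE; last exact/ltW/vol_preimage_dcube_gt0.
exact: exprn_ge0.
Qed.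

End qs.

(** The cubes in question lie in boundedly many cubes P of side about rho near phi x0. In each of
    them packing bounds the sum by |phi^-1 (P)|^beta, and phi^-1 (P) lies in a ball of radius K (Lam
    + 2) r; since n beta = n - 2 al, the power of r comes out right. *)
Lemma packing_near_le K (al Lam : R) : 0 < al -> 2 * al < n%:R -> 0 <= Lam ->
  exists2 C : R, 0 < C & forall phi phiV, qs_pair K phi phiV ->
    forall Q0 d, (forall J, descendants Q0 J -> 0 <= d J) ->
      packing_condition ((n%:R - 2 * al) / n%:R) phi Q0 d ->
    forall N x0 r, 0 < r ->
      \sum_(k < N.+1) \sum_(J <- gen Q0 k | (side R J <= img_rad phi x0 r) &&
          (`|phi x0 - corner J| <= Lam * img_rad phi x0 r))
        d J * cube_rad phiV J `^ (n%:R - 2 * al) <= C * r `^ (n%:R - 2 * al).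
Proof.
move=> al0 aln Lam0.
(* The cubes P are within (Lam + 1) rho of phi x0, and rho < 2 side P in the generation used
   below. *)
have L20 : 0 <= (Lam + 1) * 2 by rewrite mulr_ge0// addr_ge0.
have [Cn Cn0 hCn] := sum_near_le n L20.
set beta := (n%:R - 2 * al) / n%:R.
have nR0 : 0 < n%:R :> R by rewrite ltr0n.
pose c1 := ((2 * K 2)^-1 / (K 2 * K 1)) `^ (- (n%:R - 2 * al)).
pose c2 := (4 * K (Lam + 2)) `^ (n%:R - 2 * al).
have c10 : 0 <= c1 by exact: powR_ge0.
have c20 : 0 <= c2 by exact: powR_ge0.
exists (1 + c1 * ((1 + Cn) * c2)).
  by rewrite ltr_pwDl// !mulr_ge0// addr_ge0// ltW.
move=> phi phiV H Q0 d d0 pack N x0 r r0.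
have K0 t : 0 < K t by rewrite (lt_le_trans ltr01)// (qs_ge1 H).
have rho0 : 0 < img_rad phi x0 r by exact: (img_rad_gt0 n0 _ H).
set rho := img_rad phi x0 r in rho0 *.
pose cond J := (side R J <= rho) && (`|phi x0 - corner J| <= Lam * rho).
pose F J := d J * cube_rad phiV J `^ (n%:R - 2 * al).
have F0 k J : J \in gen Q0 k -> 0 <= F J.
  by move=> /gen_descendants/d0 dJ; rewrite mulr_ge0 ?powR_ge0.
pose f k := \sum_(J <- gen Q0 k | cond J) F J.
have f0 k : 0 <= f k.
  by rewrite /f big_seq_cond; apply: sumr_ge0 => J /andP[/F0].
have ex : exists k, side R Q0 * 2^-1 ^+ k <= rho.
  exists (Num.bound (side R Q0 / rho)); rewrite exprVn ler_pdivrMr ?exprn_gt0//.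
  by rewrite mulrC -ler_pdivrMr// ltW// upper_nthrootP.
(* The first generation with side at most rho: earlier ones contribute nothing, and each later J
   descends from a cube of generation k0. *)
have [k0 hk0 k0min] := ex_minnP ex.
have fk0 k : (k < k0)%N -> f k = 0.
  move=> kk0; rewrite /f big_seq_cond big1// => J /andP[Jk /andP[sJ _]].
  move: sJ; rewrite (side_gen R Jk) => /k0min; by rewrite leqNgt kk0.
apply: (@le_trans _ _ (\sum_(j < N.+1) f (k0 + j)%N)).
  apply: (@le_trans _ _ (\sum_(k < k0 + N.+1) f k)).
    rewrite addnC big_split_ord/= lerDl; exact: sumr_ge0.
  rewrite big_split_ord/= [X in X + _]big1 ?add0r// => i _.
  exact: fk0 (ltn_ord i).
pose near P := `|phi x0 - corner P| <= (Lam + 1) * rho.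
have sgP P : P \in gen Q0 k0 -> side R P <= rho by move=> /(side_gen R) ->.
apply: (@le_trans _ _ (\sum_(j < N.+1) \sum_(P <- gen Q0 k0 | near P) \sum_(J <- gen P j) F J)).
  apply: ler_sum => j _; rewrite /f gen_add big_flatten/= big_map.
  rewrite [leRHS]big_mkcond/= big_seq [leRHS]big_seq; apply: ler_sum => P Pk.
  have FP J : J \in gen P j -> 0 <= F J.
    move=> JP; apply: (F0 (k0 + j)%N); rewrite gen_add; apply/flattenP.
    by exists (gen P j) => //; apply/mapP; exists P.
  case: ifPn => nP.
    rewrite big_mkcond/= big_seq [leRHS]big_seq; apply: ler_sum => J JP.
    by case: ifP => // _; exact: FP.
  rewrite big_seq_cond big1// => J /andP[JP /andP[_ hJ]].
  exfalso; move/negP : nP; apply; rewrite /near.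
  rewrite (_ : _ - _ = (phi x0 - corner J) - (corner P - corner J)); last first.
    by rewrite opprB addrA subrK.
  rewrite (le_trans (ler_normB _ _))// mulrDl mul1r lerD//.
  exact: le_trans (gen_corner_dist R JP) (sgP _ Pk).
rewrite exchange_big/=.
apply: (@le_trans _ _ (\sum_(P <- gen Q0 k0 | near P) c1 * (c2 * r `^ (n%:R - 2 * al)))).
  rewrite big_seq_cond [leRHS]big_seq_cond; apply: ler_sum => P /andP[Pk nP].
  have QP : descendants Q0 P by exact: gen_descendants Pk.
  apply: (@le_trans _ _ (c1 * vol (phi @^-1` dcube R P) `^ beta)).
    apply: le_trans (ler_wpM2l c10 (packing_sum_le H pack N.+1 QP)).
    rewrite mulr_sumr; apply: ler_sum => j _; rewrite mulr_sumr.
    rewrite big_seq [leRHS]big_seq; apply: ler_sum => J JP.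
    rewrite mulrCA ler_wpM2l//; last exact: (cube_rad_powR_le H aln).
    by apply: d0; apply: descendants_trans QP _; exact: gen_descendants JP.
  rewrite ler_wpM2l//.
  have vle : vol (phi @^-1` dcube R P) <= (4 * (K (Lam + 2) * r)) ^+ n.
    rewrite -lee_fin -(vol_preimage_dcubeE H).
    apply: le_trans (leb_nball_le x0 _); last by rewrite mulr_ge0 ?(ltW r0) ?(ltW (K0 _)).
    apply: le_measure; rewrite ?inE.
    - exact: measurable_preimage_rV (qs_cont H) (measurable_dcube _).
    - exact: measurable_nball.
    move=> y /dcube_sub_nball hy; rewrite /nball/=.
    have := @qs_leV _ _ K phi phiV H (Lam + 2) (phi x0) (phi y) (phi (x0 + r *: const_mx 1)).
    rewrite !(qs_can H) norm_shift ?(ltW r0)//; apply; first by rewrite addr_ge0.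
    rewrite -/(img_rad phi x0 r) -/rho.
    rewrite (_ : phi x0 - phi y = (phi x0 - corner P) + (corner P - phi y)); last first.
      by rewrite addrA subrK.
    rewrite (le_trans (ler_normD _ _))// (_ : Lam + 2 = (Lam + 1) + 1); last by ring.
    rewrite mulrDl mul1r lerD//; exact: le_trans hy (sgP _ Pk).
  have beta0 : 0 <= beta by rewrite divr_ge0 ?subr_ge0// ltW.
  have e : n%:R - 2 * al = n%:R * beta by rewrite mulrCA mulfV ?mulr1// gt_eqF.
  rewrite /c2 -powRM ?mulr_ge0 ?(ltW r0) ?(ltW (K0 _))// -mulrA [in leRHS]e [in leRHS]powRrM powR_mulrn; last first.
    by rewrite !mulr_ge0 ?(ltW r0) ?(ltW (K0 _)).
  rewrite ge0_ler_powR ?nnegrE// ?exprn_ge0 ?mulr_ge0 ?(ltW r0) ?(ltW (K0 _))//.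
  exact/ltW/(vol_preimage_dcube_gt0 H).
set X := r `^ _; have X0 : 0 <= X by exact: powR_ge0.
have cX0 : 0 <= c1 * (c2 * X) by rewrite !mulr_ge0.
apply: (@le_trans _ _ ((1 + Cn) * (c1 * (c2 * X)))); last first.
  rewrite (_ : (1 + Cn) * (c1 * (c2 * X)) = c1 * ((1 + Cn) * c2) * X); last by ring.
  by rewrite [leRHS]mulrDl mul1r lerDr.
(* If k0 = 0, the side may be far below rho and counting near cubes fails, but Q0 is the only cube;
   hence 1 + Cn. *)
case: (posnP k0) => [k00|k0pos].
  rewrite k00 /gen/= big_cons big_nil; case: ifP => _.
    by rewrite addr0 mulrDl mul1r lerDl mulr_ge0// ltW.
  by rewrite mulr_ge0// addr_ge0// ltW.
have hs : rho < 2 * (side R Q0 * 2^-1 ^+ k0).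
  rewrite ltNge; apply/negP => h.
  have /k0min : side R Q0 * 2^-1 ^+ k0.-1 <= rho.
    apply: le_trans h; rewrite -[in leRHS](prednK k0pos) exprS.
    by rewrite mulrCA [2 * _]mulrA mulfV// mul1r.
  by rewrite leqNgt prednK// leqnn.
apply: (@le_trans _ _ (Cn * (c1 * (c2 * X)))); last by rewrite ler_wpM2r// lerDr.
apply: le_trans (hCn Q0 k0 (phi x0) (fun=> c1 * (c2 * X)) _ cX0 (fun _ _ => lexx _)).
rewrite big_seq_cond [leRHS]big_seq_cond big_mkcond [leRHS]big_mkcond.
apply: ler_sum => P _; case: ifPn => [/andP[Pk nP]|_]; last by case: ifP.
rewrite Pk/= ifT//; apply: (le_trans nP).
by rewrite -mulrA ler_wpM2l ?addr_ge0// (side_gen R Pk) ltW.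
Qed.

End packing.

(** * Wavelets *)

Section differentiable_lipschitz.
Context (R : realType) (n : nat).

Lemma derive_le_gradient (f : 'rV[R]_n -> R) x w : differentiable f x ->
  `|'D_w f x| <= n%:R * `|w| * enorm (gradient f x).
Proof.
move=> df; rewrite deriveE// [w in 'd f x w]row_sum_delta linear_sum.
apply: le_trans (ler_norm_sum _ _ _) _.
apply: (@le_trans _ _ (\sum_(i < n) `|w| * enorm (gradient f x))); last first.
  by rewrite sumr_const card_ord -mulrA mulr_natl.
apply: ler_sum => i _; rewrite linearZ normrM ler_pM ?coord_le_norm//.
rewrite -deriveE//; apply: le_trans (norm_le_enorm _).
by apply: le_trans (coord_le_norm _ i); rewrite mxE.
Qed.

(** The mean value theorem on the segment from v to u; the factor [n] comes from expanding the
    directional derivative in coordinates. *)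
Lemma lipschitz_of_gradient (f : 'rV[R]_n -> R) (C : R) :
  (forall x, differentiable f x) -> (forall x, enorm (gradient f x) <= C) ->
  forall u v, `|f u - f v| <= n%:R * C * `|u - v|.
Proof.
move=> df gC u v; pose w := u - v; pose g (t : R) : R := f (v + t *: w).
have gE t : (fun h : R => h^-1 *: (g (h *: 1 + t) - g t)) =
    (fun h : R => h^-1 *: (f (h *: w + (v + t *: w)) - f (v + t *: w))).
  apply/funext => h; congr (_ *: (_ - _)); rewrite /g; congr f.
  by rewrite [h *: 1]mulr1 scalerDl addrCA.
have dg (t : R) : is_derive t 1 g ('D_w f (v + t *: w)).
  have dfw : derivable f (v + t *: w) w by apply: diff_derivable; exact: df.
  split; first by rewrite /derivable -/(_ @ _) gE.
  by rewrite /derive gE.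
have cg : {within `[0, 1], continuous g}.
  apply: continuous_subspaceT => t; apply: differentiable_continuous.
  by apply/derivable1_diffP; apply: (@ex_derive _ _ _ _ _ _ _ (dg t)).
have [c _] := MVT ltr01 (fun t _ => dg t) cg.
rewrite subr0 mulr1 /g scale1r scale0r addr0 /w [v + _]addrC subrK => ->.
apply: le_trans (derive_le_gradient _ (df _)) _.
by rewrite mulrAC ler_wpM2r// ler_wpM2l.
Qed.

End differentiable_lipschitz.

Section wavelet_bounds.
Context (R : realType) (n : nat).
Implicit Types (I J : dyadic n).

Lemma vol_dcube J : vol (dcube R J) = side R J ^+ n.
Proof. by rewrite /vol lebesgue_rV_cube// ltW// side_gt0. Qed.

(** The h_J of the overview: the factor |J|^(1/2) undoes the L^2 normalization, so that sup and
    scaled Lipschitz bounds are the same for all J. *)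
Definition wavelet_block (psi : dyadic n -> wtype n -> 'rV[R]_n -> R) J x : R :=
  \sum_(nu : wtype n) Num.sqrt (vol (dcube R J)) * psi J nu x.

Lemma wavelet_continuous psi : wavelet_family psi ->
  forall I nu, continuous (psi I nu : 'rV[R]_n -> R).
Proof. by case=> _ _ dpsi _ _ I nu x; exact: differentiable_continuous. Qed.

(** Dilates are taken about the center, half a side away from the corner in each coordinate; 1/2 +
    m/2 <= m because m >= 1. *)
Lemma wavelet_near psi : wavelet_family psi ->
  exists2 m : R, 1 <= m & forall I nu (x : 'rV[R]_n), psi I nu x != 0 ->
    `|x - corner R I| <= m * side R I.
Proof.
case=> _ [m m1 supp] _ _ _; exists m => // I nu x px.
have s0 := side_gt0 R I.
have xI : dilate m I x by apply: (supp I nu); exact: subset_closure.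
apply: rV_norm_le => [|i]; first by rewrite mulr_ge0 ?(ltW s0)// (le_trans ler01).
have -> : (x - corner R I) 0 i = x 0 i - corner R I 0 i.
  by rewrite [LHS]mxE; congr (_ + _); rewrite mxE.
have := xI i; rewrite !mxE => /andP[x1 x2].
have ms : side R I <= m * side R I by rewrite ler_peMl ?(ltW s0).
by rewrite ler_norml; apply/andP; split; lra.
Qed.

Lemma wavelet_block_bounds psi : wavelet_family psi ->
  exists B M : R, [/\ 0 < B, 1 <= M &
   forall J, [/\ forall u, `|wavelet_block psi J u| <= B,
     forall u v, `|wavelet_block psi J u - wavelet_block psi J v| <= B * (`|u - v| / side R J) &
     forall u, wavelet_block psi J u != 0 -> `|u - corner R J| <= M * side R J]].
Proof.
move=> hpsi; have [M M1 Mn] := wavelet_near hpsi.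
case: (hpsi) => _ _ dpsi [C bpsi] _.
have hv J : 0 < vol (dcube R J) by rewrite vol_dcube exprn_gt0// side_gt0.
have sq J : Num.sqrt (vol (dcube R J)) * vol (dcube R J) `^ (- 2^-1) = 1.
  rewrite -powR12_sqrt ?(ltW (hv J))// powRN mulfV// gt_eqF// powR_gt0//.
have h1 J nu u : `|Num.sqrt (vol (dcube R J)) * psi J nu u| <= C.
  rewrite normrM ger0_norm ?sqrtr_ge0// -[leRHS]mulr1 -(sq J) mulrCA.
  rewrite ler_wpM2l ?sqrtr_ge0//; apply: le_trans (bpsi J nu u).
  by rewrite lerDl mulr_ge0 ?enorm_ge0// ltW// side_gt0.
have h2 J nu u v : `|Num.sqrt (vol (dcube R J)) * psi J nu u -
    Num.sqrt (vol (dcube R J)) * psi J nu v| <= n%:R * C * (`|u - v| / side R J).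
  have s0 := side_gt0 R J.
  rewrite -mulrBr normrM ger0_norm ?sqrtr_ge0//.
  have -> : n%:R * C * (`|u - v| / side R J) = Num.sqrt (vol (dcube R J)) *
      (n%:R * (C * vol (dcube R J) `^ (- 2^-1) / side R J) * `|u - v|).
    by rewrite -[LHS]mulr1 -[X in _ * X = _](sq J); ring.
  rewrite ler_wpM2l ?sqrtr_ge0//; apply: lipschitz_of_gradient => // x.
  rewrite ler_pdivlMr// mulrC; apply: le_trans (bpsi J nu x).
  by rewrite lerDr.
pose Nw : R := #|{: wtype n}|%:R.
have Nw0 : 0 <= Nw by [].
(* One constant for both bounds: Nw C for the sup, Nw n C for the Lipschitz constant; the leading 1
   keeps it positive. *)
exists (1 + Nw * (1 + n%:R) * `|C|), M; split => //.
  by rewrite ltr_pwDl// !mulr_ge0// addr_ge0.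
have bigle (F : wtype n -> R) c : (forall nu, `|F nu| <= c) -> `|\sum_nu F nu| <= Nw * c.
  move=> Fc; apply: le_trans (ler_norm_sum _ _ _) _.
  apply: (@le_trans _ _ (\sum_(nu : wtype n) c)); first exact: ler_sum.
  by rewrite sumr_const mulr_natl.
move=> J; have s0 := side_gt0 R J; split.
- move=> u; apply: le_trans (bigle _ _ (fun nu => h1 J nu u)) _.
  rewrite ler_wpDl// -mulrA ler_wpM2l//.
  by rewrite (le_trans (ler_norm C))// ler_peMl// lerDl.
- move=> u v; rewrite -sumrB; apply: le_trans (bigle _ _ (fun nu => h2 J nu u v)) _.
  have D0 : 0 <= `|u - v| / side R J by rewrite divr_ge0// ltW.
  rewrite mulrA ler_wpM2r// ler_wpDl// -mulrA ler_wpM2l//.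
  apply: (@le_trans _ _ (n%:R * `|C|)); first by rewrite ler_wpM2l// ler_norm.
  by rewrite ler_wpM2r// lerDr.
- move=> u; rewrite /wavelet_block => h.
  have [nu hnu] : exists nu, psi J nu u != 0.
    apply: contrapT => hno; move/eqP: h; apply; apply: big1 => nu _.
    have -> : psi J nu u = 0 by apply/eqP/negPn/negP => ?; apply: hno; exists nu.
    by rewrite mulr0.
  exact: Mn hnu.
Qed.

Lemma wavelet_block_continuous psi : wavelet_family psi ->
  forall J, continuous (wavelet_block psi J).
Proof.
move=> hpsi J; rewrite /wavelet_block; apply: continuous_big => [|nu _ x].
  exact: add_continuous.
by apply: (@continuousM _ _ (fun=> Num.sqrt (vol (dcube R J))) (psi J nu)); [exact: cst_continuous|exact: wavelet_continuous].
Qed.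

Lemma wavelet_sumE psi Q0 (d : dyadic n -> R) N x :
  wavelet_sum psi Q0 d N x =
  \sum_(k < N.+1) \sum_(J <- gen Q0 k) Num.sqrt (d J) * wavelet_block psi J x.
Proof.
apply: eq_bigr => k _; apply: eq_bigr => J _.
rewrite mulr_sumr; apply: eq_bigr => nu _.
rewrite sqrtrM; first by rewrite mulrCA mulrA.
by rewrite vol_dcube exprn_ge0// ltW// side_gt0.
Qed.

Lemma wavelet_sum_continuous psi Q0 (d : dyadic n -> R) N : wavelet_family psi ->
  continuous (wavelet_sum psi Q0 d N).
Proof.
move=> hpsi; have -> : wavelet_sum psi Q0 d N = fun x =>
    \sum_(k < N.+1) \sum_(J <- gen Q0 k) Num.sqrt (d J) * wavelet_block psi J x.
  by apply/funext => x; exact: wavelet_sumE.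
apply: continuous_big => [|k _]; first exact: add_continuous.
apply: continuous_big => [|J _ x]; first exact: add_continuous.
by apply: (@continuousM _ _ (fun=> Num.sqrt (d J)) (wavelet_block psi J)); [exact: cst_continuous|exact: wavelet_block_continuous].
Qed.

End wavelet_bounds.

(** * Pointwise estimates *)

Section weights.
Context (R : realType).

(** Write v^2 = v^q v^(2 - q) for v <= 1, and 1 = v^e v^(-e) for v > 1. The second factor decays in
    both directions, so it sums over the dyadic scales. *)
Lemma minr_sqr_le_wmin (q e v : R) : q < 2 -> 0 < e -> e <= q -> 0 < v ->
  Num.min 1 v ^+ 2 <= wmin q e v * Num.min (v `^ (2 - q)) (v `^ (- e)).
Proof.
move=> q2 e0 eq v0.
have two : v ^+ 2 = v `^ q * v `^ (2 - q).
  rewrite -powRD ?(gt_eqF v0) ?implybT// addrC subrK powR_mulrn//; exact: ltW.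
have one : 1 = v `^ e * v `^ (- e) by rewrite powRN mulfV// gt_eqF// powR_gt0.
have [v1|v1] := leP v 1.
  rewrite two ler_pM ?powR_ge0// le_min lexx/=; first exact: powR_le_exp.
  by apply: powR_le_exp => //; lra.
rewrite expr1n {1}one ler_pM ?powR_ge0// le_min lexx ?andbT/=; apply: ler_powR => //.
- exact: ltW.
- exact: ltW.
- by lra.
Qed.

(** Used with v = rho / l(J) for cubes larger than rho: it trades l(J) for rho and gains the
    summable factor v^e. *)
Lemma wminM_le (q e u v : R) : e <= q -> 0 <= u -> 0 < v -> v <= 1 ->
  wmin q e (u * v) <= wmin q e u * v `^ e.
Proof.
move=> eq u0 v0 v1; rewrite /wmin !powRM ?(ltW v0)//.
rewrite [leRHS]minr_pMl ?powR_ge0// le_min; apply/andP; split.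
  by rewrite ge_min ler_wpM2l ?powR_ge0 ?powR_le_exp.
by rewrite ge_min lexx orbT.
Qed.

Lemma exists_small_exponent (K al q : R) : 1 <= K -> 0 < al -> 0 < q ->
  exists e, [/\ 0 < e, e <= q & K `^ e <= 2 `^ al].
Proof.
move=> K1 al0 q0; pose m := (Num.bound K).+1.
have m0 : 0 < m%:R :> R by rewrite ltr0n.
have Km : K <= 2 ^+ m by apply/ltW; rewrite upper_nthrootP.
exists (Num.min q (al / m%:R)); split; first by rewrite lt_min q0 divr_gt0.
  by rewrite ge_min lexx.
set e := Num.min _ _; have e0 : 0 <= e by rewrite le_min (ltW q0) divr_ge0 ?ltW.
apply: (@le_trans _ _ ((2 ^+ m) `^ e)).
  by apply: ge0_ler_powR => //; rewrite nnegrE// ?exprn_ge0// (le_trans ler01).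
rewrite -powR_mulrn// -powRrM ler_powR ?ler1n// -ler_pdivlMl// mulrC.
by rewrite ge_min lexx orbT.
Qed.

End weights.

Section pointwise.
Context (R : realType) (n : nat).
Implicit Types (J Q : dyadic n) (u v : 'rV[R]_n).

Definition near_corner (M : R) u J : bool := `|u - corner R J| <= M * side R J.

Definition wenergy (q e M : R) Q0 (d : dyadic n -> R) N u (D : R) : R :=
  \sum_(k < N.+1) \sum_(J <- gen Q0 k)
     d J * (near_corner M u J)%:R * wmin q e (D / side R J).

(** Cauchy-Schwarz with the splitting of [minr_sqr_le_wmin]. The dual sum is bounded, since each
    generation has boundedly many cubes near [u] and 2 - q and e are both positive. *)
Lemma block_sum_sqr_le (q e M : R) : q < 2 -> 0 < e -> e <= q -> 0 <= M ->
  exists2 C : R, 0 < C & forall Q0 (d : dyadic n -> R) N u D,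
   (forall J, 0 <= d J) -> 0 < D ->
   (\sum_(k < N.+1) \sum_(J <- gen Q0 k)
      Num.sqrt (d J) * Num.min 1 (D / side R J) * (near_corner M u J)%:R) ^+ 2
   <= C * wenergy q e M Q0 d N u D.
Proof.
move=> q2 e0 eq M0; have [Cn Cn0 hCn] := @sum_near_le R n M M0.
have q20 : 0 < 2 - q by rewrite subr_gt0.
have [Cs Cs0 hCs] := sum_min_powR q20 e0.
exists (Cn * Cs); first by rewrite mulr_gt0.
move=> Q0 d N u D d0 D0.
pose G J := (near_corner M u J)%:R * Num.min ((D / side R J) `^ (2 - q)) ((D / side R J) `^ (- e)).
have hG : \sum_(k < N.+1) \sum_(J <- gen Q0 k) G J <= Cn * Cs.
  apply: (@le_trans _ _ (\sum_(k < N.+1) Cn * Num.min ((2 ^+ k * (D / side R Q0)) `^ (2 - q))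
     ((2 ^+ k * (D / side R Q0)) `^ (- e)))).
    apply: ler_sum => k _; rewrite /G.
    set c := Num.min _ _; have c0 : 0 <= c by rewrite le_min !powR_ge0.
    apply: le_trans (hCn Q0 k u (fun J => Num.min ((D / side R J) `^ (2 - q)) ((D / side R J) `^ (- e))) c c0 _); last first.
      move=> J Jk; rewrite (side_gen R Jk) /c.
      by rewrite invfM -exprVn invrK [2 ^+ k * _]mulrC mulrA.
    rewrite [leRHS]big_mkcond/=; apply: ler_sum => J _.
  by rewrite /near_corner; case: ifP => _; rewrite ?mul1r ?mul0r.
  rewrite -mulr_sumr ler_wpM2l ?(ltW Cn0)//; apply: hCs.
  by rewrite divr_gt0 ?side_gt0.
rewrite mulrC; have [s [_ _ sF]] := gen_bounded_list R Q0 N.+1.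
apply: (@le_trans _ _ (wenergy q e M Q0 d N u D * \sum_(k < N.+1) \sum_(J <- gen Q0 k) G J)).
  rewrite /wenergy !sF; apply: sqr_sum_le.
  - by move=> J; rewrite !mulr_ge0 ?wmin_ge0.
  - by move=> J; rewrite /G mulr_ge0// le_min !powR_ge0.
  - by move=> J; rewrite !mulr_ge0 ?sqrtr_ge0// le_min ler01 divr_ge0 ?(ltW D0) ?(ltW (side_gt0 R J)).
  move=> J; rewrite !exprMn sqr_sqrtr// /G.
  case: (near_corner M u J); last by rewrite expr0n !mulr0 !mul0r.
  rewrite expr1n !mulr1 mul1r -mulrA ler_wpM2l//.
  by apply: minr_sqr_le_wmin => //; rewrite divr_gt0 ?side_gt0.
rewrite ler_wpM2l// /wenergy; apply: sumr_ge0 => k _; apply: sumr_ge0 => J _.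
by rewrite !mulr_ge0 ?wmin_ge0.
Qed.

Definition block_sum (Hf : dyadic n -> 'rV[R]_n -> R) Q0 (d : dyadic n -> R) N x : R :=
  \sum_(k < N.+1) \sum_(J <- gen Q0 k) Num.sqrt (d J) * Hf J x.

(** A block varies by at most 2 B min (1, D / l(J)), and only if u or v is near J. The 8 is (2 B)^2
    / B^2 times the 2 from squaring a sum of two terms. *)
Lemma block_diff_le (q e M B : R) : q < 2 -> 0 < e -> e <= q -> 0 <= M -> 0 < B ->
  exists2 C : R, 0 < C & forall Hf : dyadic n -> 'rV[R]_n -> R,
   (forall J, [/\ forall u, `|Hf J u| <= B,
     forall u v, `|Hf J u - Hf J v| <= B * (`|u - v| / side R J) &
     forall u, Hf J u != 0 -> `|u - corner R J| <= M * side R J]) ->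
   forall Q0 (d : dyadic n -> R) N u v, (forall J, 0 <= d J) -> u != v ->
   (block_sum Hf Q0 d N u - block_sum Hf Q0 d N v) ^+ 2 <= C * (wenergy q e M Q0 d N u `|u - v| + wenergy q e M Q0 d N v `|u - v|).
Proof.
move=> q2 e0 eq M0 B0; have [C C0 hC] := block_sum_sqr_le q2 e0 eq M0.
exists (8 * B ^+ 2 * C); first by rewrite !mulr_gt0// exprn_gt0.
move=> Hf hH Q0 d N u v d0 uv.
have D0 : 0 < `|u - v| by rewrite normr_gt0 subr_eq0.
set D := `|u - v| in D0 *.
pose T w := \sum_(k < N.+1) \sum_(J <- gen Q0 k)
      Num.sqrt (d J) * Num.min 1 (D / side R J) * (near_corner M w J)%:R.
have hT w : T w ^+ 2 <= C * wenergy q e M Q0 d N w D by exact: hC.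
have fT : `|block_sum Hf Q0 d N u - block_sum Hf Q0 d N v| <= 2 * B * (T u + T v).
  rewrite /block_sum /T -sumrB -big_split/= mulr_sumr.
  apply: le_trans (ler_norm_sum _ _ _) _; apply: ler_sum => k _.
  rewrite -sumrB -big_split/= mulr_sumr.
  apply: le_trans (ler_norm_sum _ _ _) _; apply: ler_sum => J _.
  have [h1 h2 h3] := hH J; have s0 := side_gt0 R J.
  set a := (near_corner M u J)%:R; set b := (near_corner M v J)%:R.
  have -> : forall s m : R, 2 * B * (s * m * a + s * m * b) = s * (2 * B * m * (a + b)).
    by move=> s m; ring.
  rewrite -mulrBr normrM ger0_norm ?sqrtr_ge0// ler_wpM2l ?sqrtr_ge0// /a /b.
  have Ds0 : 0 < D / side R J by rewrite divr_gt0.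
  have m0 : 0 <= Num.min 1 (D / side R J) by rewrite le_min ler01 ltW.
  have key : `|Hf J u - Hf J v| <= 2 * B * Num.min 1 (D / side R J).
    rewrite minr_pMr ?mulr_ge0 ?(ltW B0)// le_min; apply/andP; split.
      rewrite mulr1 (le_trans (ler_normB _ _))// mulr_natl mulr2n.
      by rewrite lerD.
    apply: le_trans (h2 u v) _; rewrite -/D ler_wpM2r ?(ltW Ds0)//.
    by rewrite ler_peMl ?(ltW B0)// ler1n.
  have [nu|nu] := boolP (near_corner M u J).
    apply: (le_trans key); rewrite ler_peMr ?mulr_ge0 ?(ltW B0)//.
    by rewrite lerDl.
  have [nv|nv] := boolP (near_corner M v J).
    apply: (le_trans key); rewrite ler_peMr ?mulr_ge0 ?(ltW B0)//.
    by rewrite lerDr.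
  have -> : Hf J u = 0 by apply/eqP; apply: contraNT nu; exact: h3.
  have -> : Hf J v = 0 by apply/eqP; apply: contraNT nv; exact: h3.
  by rewrite subrr normr0 addr0 mulr0.
rewrite -real_normK ?num_real//.
have TT w : 0 <= T w.
  apply: sumr_ge0 => k _; apply: sumr_ge0 => J _.
  by rewrite !mulr_ge0 ?sqrtr_ge0// le_min ler01 divr_ge0 ?(ltW D0) ?(ltW (side_gt0 R J)).
have B20 : 0 <= 2 * B by rewrite mulr_ge0// ltW.
apply: (@le_trans _ _ ((2 * B * (T u + T v)) ^+ 2)).
  by rewrite lerXn2r// nnegrE mulr_ge0// addr_ge0.
apply: (@le_trans _ _ (8 * B ^+ 2 * (T u ^+ 2 + T v ^+ 2))).
  have : 0 <= B ^+ 2 * (T u - T v) ^+ 2 by rewrite mulr_ge0 ?sqr_ge0.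
  rewrite !expr2; lra.
rewrite -[in leRHS]mulrA ler_wpM2l ?mulr_ge0 ?exprn_ge0 ?(ltW B0)//.
by rewrite mulrDr lerD.
Qed.

End pointwise.

(** * Composition *)

Section energy_sums.
Context (R : realType) (n : nat) (n0 : (0 < n)%N).
Local Notation leb := (lebesgue_rV R n).
Implicit Types (phi phiV : 'rV[R]_n -> 'rV[R]_n) (K : R -> R) (x y z : 'rV[R]_n).

Definition energy_kernel phi (al q e : R) x0 (r rho : R) x y : R :=
  \1_(nball x0 r) x *
    (wmin q e (`|phi x - phi y| / rho) * `|x - y| `^ (- (n%:R + 2 * al))).

Lemma energy_kernel_ge0 phi al q e x0 r rho x y : 0 <= energy_kernel phi al q e x0 r rho x y.
Proof. by rewrite !mulr_ge0 ?wmin_ge0 ?powR_ge0. Qed.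

Lemma measurable_energy_kernel phi al q e x0 r rho : continuous phi ->
  measurable_fun setT (fun p : 'rV[R]_n * 'rV[R]_n => energy_kernel phi al q e x0 r rho p.1 p.2).
Proof.
move=> cphi; have mphi := continuous_measurable_rV_rV cphi.
have m1 : measurable_fun setT (fun p : 'rV[R]_n * 'rV[R]_n => phi p.1).
  exact: (measurableT_comp mphi measurable_fst).
have m2 : measurable_fun setT (fun p : 'rV[R]_n * 'rV[R]_n => phi p.2).
  exact: (measurableT_comp mphi measurable_snd).
rewrite /energy_kernel; apply: measurable_funM.
  apply: (measurableT_comp _ measurable_fst).
  by apply: measurable_indic; exact: measurable_nball.
apply: measurable_funM.
  have mD : measurable_fun setT (fun p : 'rV[R]_n * 'rV[R]_n => `|phi p.1 - phi p.2| / rho).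
    by apply: measurable_funM => //; exact: measurable_fun_norm_subr.
  apply: measurable_minr; first exact: (measurableT_comp (measurable_powR q) mD).
  exact: (measurableT_comp (measurable_powR e) mD).
apply: (measurableT_comp (measurable_powR _)).
by apply: measurable_fun_norm_subr; [exact: measurable_fst|exact: measurable_snd].
Qed.

(** The kernel with x and y exchanged has the same double integral by Tonelli, whence 2 C. Only the
    majorant has to be measurable, not [F]. *)
Lemma energy_sum_le K (al q e L : R) : 0 < al -> 2 * al < q -> q <= n%:R -> 0 < e ->
  K 2 `^ e <= 2 `^ al -> 0 < L ->
  exists2 C : R, 0 < C & forall phi phiV, qs_pair K phi phiV ->
    forall (I : Type) (s : seq I) (c r rho : I -> R) (x0 : I -> 'rV[R]_n),
      (forall i, 0 <= c i) -> (forall i, 0 < r i) -> (forall i, 0 < rho i) ->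
      (forall i, img_rad phi (x0 i) (r i) <= L * rho i) ->
      forall F : 'rV[R]_n -> 'rV[R]_n -> R, (forall x y, 0 <= F x y) ->
      (forall x y, F x y <= \sum_(i <- s) c i *
         (energy_kernel phi al q e (x0 i) (r i) (rho i) x y +
          energy_kernel phi al q e (x0 i) (r i) (rho i) y x)) ->
      (\int[leb]_x \int[leb]_y (F x y)%:E
         <= (C * \sum_(i <- s) c i * r i `^ (n%:R - 2 * al))%:E)%E.
Proof.
move=> al0 alq qn e0 K2e L0.
have [C C0 hC] := energy_le n0 al0 alq qn e0 K2e L0.
exists (2 * C); first by rewrite mulr_gt0.
move=> phi phiV H I s c r rho x0 c0 r0 rho0 hL F F0 Fle.
pose k i (p : 'rV[R]_n * 'rV[R]_n) := energy_kernel phi al q e (x0 i) (r i) (rho i) p.1 p.2.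
have mk i : measurable_fun setT (k i) by exact: measurable_energy_kernel (qs_cont H).
have mks i : measurable_fun setT (fun p => k i (p.2, p.1)).
  apply: (measurableT_comp (mk i)).
  by apply/measurable_fun_pair; [exact: measurable_snd|exact: measurable_fst].
have k0 i p : 0 <= k i p by exact: energy_kernel_ge0.
pose G p := \sum_(i <- s) c i * (k i p + k i (p.2, p.1)).
have G0 p : 0 <= G p by apply: sumr_ge0 => i _; rewrite mulr_ge0// addr_ge0.
have mG : measurable_fun setT (EFin \o G).
  apply/measurable_EFinP; apply: measurable_sum => i.
  by apply: measurable_funM => //; exact: measurable_funD.
apply: (@le_trans _ _ (\int[leb]_x \int[leb]_y (EFin \o G) (x, y))%E).
  apply: ge0_le_integralT => x; first by apply: integral_ge0 => y _; rewrite lee_fin.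
  apply: ge0_le_integralT => y; first by rewrite lee_fin.
  by rewrite lee_fin; exact: Fle.
rewrite -fubini_tonelli1//=.
have -> : (fun p => (G p)%:E) = (fun p => \sum_(i <- s) (c i * (k i p + k i (p.2, p.1)))%:E)%E.
  by apply/funext => p; rewrite sumEFin.
rewrite ge0_integral_sum//; last 2 first.
- move=> i; apply/measurable_EFinP; apply: measurable_funM => //; exact: measurable_funD.
- by move=> i p _; rewrite lee_fin mulr_ge0// addr_ge0.
rewrite mulr_sumr -sumEFin; apply: lee_sum => i _.
rewrite ge0_integralZl_real//; last 2 first.
- exact: measurable_funD.
- by move=> p; rewrite addr_ge0.
rewrite mulrCA EFinM lee_wpmul2l ?lee_fin//.
have -> : (fun p => (k i p + k i (p.2, p.1))%:E) =
    (fun p => (k i p)%:E + (k i (p.2, p.1))%:E)%E by [].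
rewrite ge0_integralD//; last 4 first.
- by move=> p _; rewrite lee_fin.
- exact/measurable_EFinP.
- by move=> p _; rewrite lee_fin.
- exact/measurable_EFinP.
have -> : 2 * C * r i `^ (n%:R - 2 * al) =
    C * r i `^ (n%:R - 2 * al) + C * r i `^ (n%:R - 2 * al) by ring.
rewrite EFinD; apply: leeD.
  have /measurable_EFinP mki := mk i.
  rewrite (@fubini_tonelli1 _ _ _ _ _ leb leb _ mki)//=; last by move=> p; rewrite lee_fin.
  exact: (hC phi phiV H).
have /measurable_EFinP mksi := mks i.
rewrite (@fubini_tonelli2 _ _ _ _ _ leb leb _ mksi)//=; last by move=> p; rewrite lee_fin.
exact: (hC phi phiV H).
Qed.

(** The cubes larger than rho act together like a single cube of side rho: d_J <= 1, boundedly many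
    per generation are near [u], and [wminM_le] makes their sum geometric. *)
Lemma wenergy_le (q e M : R) : 0 < e -> e <= q -> 0 <= M ->
  exists2 C : R, 0 < C & forall Q0 (d : dyadic n -> R) N u D rho,
    (forall J, 0 <= d J) -> (forall J, descendants Q0 J -> d J <= 1) ->
    0 <= D -> 0 < rho ->
    wenergy q e M Q0 d N u D <= C * wmin q e (D / rho) +
      \sum_(k < N.+1) \sum_(J <- gen Q0 k | side R J <= rho)
        d J * (near_corner M u J)%:R * wmin q e (D / side R J).
Proof.
move=> e0 eq M0; have [Cn Cn0 hCn] := @sum_near_le R n M M0.
have [Cs Cs0 hCs] := sum_min_powR e0 e0.
exists (Cn * Cs); first by rewrite mulr_gt0.
move=> Q0 d N u D rho d0 d1 D0 rho0.
set w := wmin q e (D / rho); have w0 : 0 <= w by exact: wmin_ge0.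
pose v0 := rho / side R Q0; have v00 : 0 < v0 by rewrite divr_gt0 ?side_gt0.
apply: (@le_trans _ _ (\sum_(k < N.+1)
    (Cn * Num.min ((2 ^+ k * v0) `^ e) ((2 ^+ k * v0) `^ (- e)) * w +
     \sum_(J <- gen Q0 k | side R J <= rho)
        d J * (near_corner M u J)%:R * wmin q e (D / side R J)))); last first.
  rewrite big_split/= lerD2r -mulr_suml ler_wpM2r// -mulr_sumr ler_wpM2l ?(ltW Cn0)//.
  exact: hCs.
apply: ler_sum => k _; set m := Num.min _ _.
have m0 : 0 <= m by rewrite le_min !powR_ge0.
have vk J : J \in gen Q0 k -> rho / side R J = 2 ^+ k * v0.
  by move=> Jk; rewrite /v0 (side_gen R Jk) invfM -exprVn invrK; ring.
rewrite (bigID (fun J => side R J <= rho))/= addrC lerD2r -mulrA.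
apply: (@le_trans _ _ (\sum_(J <- gen Q0 k | near_corner M u J)
   (~~ (side R J <= rho))%:R * (w * (rho / side R J) `^ e))).
  rewrite big_mkcond [leRHS]big_mkcond big_seq [leRHS]big_seq; apply: ler_sum => J Jk.
  case: ifPn => hJ; last by rewrite /= mul0r; case: ifP.
  case: ifPn => nJ; last by rewrite mulr0 mul0r.
  rewrite mulr1 mul1r; apply: (@le_trans _ _ (wmin q e (D / side R J))).
    by rewrite ler_piMl ?wmin_ge0// d1//; exact: gen_descendants Jk.
  have s0 := side_gt0 R J.
  have -> : D / side R J = (D / rho) * (rho / side R J).
    by rewrite mulrA divfK// gt_eqF.
  apply: wminM_le => //; rewrite ?divr_ge0 ?divr_gt0 ?(ltW rho0)//.
  by rewrite ler_pdivrMr// mul1r ltW// ltNge.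
rewrite [m * w]mulrC; apply: hCn; first by rewrite mulr_ge0.
move=> J Jk; have s0 := side_gt0 R J; have [sJ|sJ] := boolP (side R J <= rho).
  by rewrite mul0r mulr_ge0.
rewrite mul1r ler_wpM2l// (vk _ Jk) /m le_min lexx/=.
have v1 : 2 ^+ k * v0 <= 1.
  by rewrite -(vk _ Jk) ler_pdivrMr// mul1r ltW// ltNge.
apply: powR_le_exp => //; first by rewrite mulr_gt0// exprn_gt0.
by lra.
Qed.

(** The inequalities on [K] are assumed outright because [e] and [L], and hence the constant, are
    chosen before the pair that would provide them. *)
Lemma composition_energy_le K (al M B : R) : 0 < al -> al < 1 -> 2 * al < n%:R ->
  1 <= M -> 0 < B -> 1 <= K 2 -> 0 < K M -> 1 <= K (K M) ->
  exists2 C : R, 0 < C & forall phi phiV, qs_pair K phi phiV ->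
   forall Hf : dyadic n -> 'rV[R]_n -> R,
   (forall J, [/\ forall u, `|Hf J u| <= B,
     forall u v, `|Hf J u - Hf J v| <= B * (`|u - v| / side R J) &
     forall u, Hf J u != 0 -> `|u - corner R J| <= M * side R J]) ->
   forall Q0 (d : dyadic n -> R), (forall J, 0 <= d J) ->
     packing_condition ((n%:R - 2 * al) / n%:R) phi Q0 d ->
   forall N a l, 0 < l ->
   forall g : 'rV[R]_n -> R, (forall x, g x = block_sum Hf Q0 d N (phi x)) ->
   (\int[leb]_(x in cube a l) \int[leb]_(y in cube a l)
      (`|g x - g y| ^+ 2 / enorm (x - y) `^ (n%:R + 2 * al))%:E
    <= (C * l `^ (n%:R - 2 * al))%:E)%E.
Proof.
move=> al0 al1 aln M1 B0 K2 KM KKM.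
have M0 : 0 <= M by apply: le_trans M1.
(* The midpoint of 2 al and min (2, n), strictly between them since al < 1 and 2 al < n. *)
pose q := (2 * al + Num.min 2 n%:R) / 2.
have [alq q2 qn] : [/\ 2 * al < q, q < 2 & q <= n%:R].
  rewrite /q; have : Num.min 2 n%:R <= 2 :> R by rewrite ge_min lexx.
  have : Num.min 2 n%:R <= n%:R :> R by rewrite ge_min lexx orbT.
  have : 2 * al < Num.min 2 n%:R by rewrite lt_min aln andbT; lra.
  move: (Num.min 2 n%:R) => mm h1 h2 h3; split; lra.
have q0 : 0 < q by apply: lt_trans alq; rewrite mulr_gt0.
have [e [e0 eq K2e]] := exists_small_exponent K2 al0 q0.
(* If phi x is within M l(J) of the corner of J, then x is within K M r_J of its preimage; applying
   [phi] to that ball turns K M into K (K M). *)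
pose L := K (K M); have L0 : 0 < L by exact: lt_le_trans KKM.
have [C1 C10 hC1] := energy_sum_le al0 alq qn e0 K2e L0.
have [C2 C20 hC2] := @wenergy_le q e M e0 eq M0.
have [C3 C30 hC3] := @block_diff_le R n q e M B q2 e0 eq M0 B0.
(* phi x is within K 1 rho of phi a, and the corner of a near cube of side at most rho is within M
   rho of phi x. *)
pose Lam := `|K 1| + M; have Lam0 : 0 <= Lam by rewrite addr_ge0.
have [C4 C40 hC4] := @packing_near_le R n n0 K al Lam al0 aln Lam0.
exists (C1 * (C3 * C2 + C3 * (K M `^ (n%:R - 2 * al) * C4))).
  by rewrite mulr_gt0// ltr_wpDr ?mulr_gt0// !mulr_ge0 ?powR_ge0// ltW.
move=> phi phiV H Hf hH Q0 d d0 pack N a l l0 g gE.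
have K0 t : 0 < K t by rewrite (lt_le_trans ltr01)// (qs_ge1 H).
pose rho := img_rad phi a l; have rho0 : 0 < rho by exact: (img_rad_gt0 n0 _ H).
pose P := n%:R + 2 * al.
have P0 : 0 < P by rewrite ltr_wpDl// mulr_gt0.
have d1 J : descendants Q0 J -> d J <= 1.
  exact: (packing_le1 n0 H pack).
pose small J := (side R J <= rho) && (`|phi a - corner R J| <= Lam * rho).
have [s0 [_ _ s0F]] := gen_bounded_list R Q0 N.+1.
(* None collects all the dyadic cubes larger than phi (cube a l). *)
pose s : seq (option (dyadic n)) := None :: [seq Some J | J <- [seq J <- s0 | small J]].
pose c (i : option (dyadic n)) := if i is Some J then C3 * d J else C3 * C2.
pose r (i : option (dyadic n)) := if i is Some J then K M * cube_rad phiV J else l.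
pose rh (i : option (dyadic n)) := if i is Some J then side R J else rho.
pose x0 (i : option (dyadic n)) := if i is Some J then phiV (corner R J) else a.
pose F x y : R := \1_(cube a l) x * (\1_(cube a l) y *
  (`|g x - g y| ^+ 2 / enorm (x - y) `^ P)).
have F0 x y : 0 <= F x y.
  rewrite /F mulr_ge0// mulr_ge0//; apply: divr_ge0; last exact: powR_ge0.
  exact: exprn_ge0.
have Q_nball x : cube a l x -> `|a - x| <= l.
  move=> xQ; apply: rV_norm_le => [|i]; first exact: ltW.
  have -> : (a - x) 0 i = a 0 i - x 0 i by rewrite [LHS]mxE; congr (_ + _); rewrite mxE.
  by have /andP[x1 x2] := xQ i; rewrite ler_norml; apply/andP; split; lra.
have energy_x x y : cube a l x ->
    wenergy q e M Q0 d N (phi x) `|phi x - phi y| * `|x - y| `^ (- P) <=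
    C2 * energy_kernel phi al q e a l rho x y + \sum_(J <- s0 | small J) d J *
       energy_kernel phi al q e (phiV (corner R J)) (K M * cube_rad phiV J) (side R J) x y.
  move=> xQ; have axl := Q_nball x xQ.
  set p := `|x - y| `^ (- P); have p0 : 0 <= p by exact: powR_ge0.
  apply: (le_trans (ler_wpM2r p0
    (hC2 Q0 d N (phi x) `|phi x - phi y| rho d0 d1 (normr_ge0 _) rho0))).
  rewrite mulrDl lerD//.
    rewrite /energy_kernel indicE mem_set ?mul1r ?mulrA//; exact: axl.
  have -> : \sum_(J <- s0 | small J) d J *
       energy_kernel phi al q e (phiV (corner R J)) (K M * cube_rad phiV J) (side R J) x y =
     \sum_(k < N.+1) \sum_(J <- gen Q0 k) (if small J then d J *
       energy_kernel phi al q e (phiV (corner R J)) (K M * cube_rad phiV J) (side R J) x y else 0).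
    by rewrite s0F big_mkcond.
  rewrite mulr_suml; apply: ler_sum => k _.
  rewrite big_mkcond/= mulr_suml; apply: ler_sum => J _.
  have kp : 0 <= energy_kernel phi al q e (phiV (corner R J)) (K M * cube_rad phiV J) (side R J) x y.
    exact: energy_kernel_ge0.
  case: ifPn => sJ; last by rewrite mul0r; case: ifP => // _; rewrite mulr_ge0.
  have [nJ|nJ] := boolP (near_corner M (phi x) J); last first.
    by rewrite mulr0 !mul0r; case: ifP => // _; rewrite mulr_ge0.
  have -> : small J.
    rewrite /small sJ/=.
    rewrite (_ : phi a - corner R J = (phi a - phi x) + (phi x - corner R J)); last first.
      by rewrite addrA subrK.
    rewrite (le_trans (ler_normD _ _))// /Lam mulrDl lerD//.
      rewrite ger0_norm ?(ltW (K0 _))//.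
      by apply: (qs_img_rad n0 H); rewrite ?mul1r// ltW.
    by apply: (le_trans nJ); rewrite ler_wpM2l.
  rewrite mulr1 -mulrA ler_wpM2l// /energy_kernel indicE mem_set ?mul1r//.
  rewrite /nball/= -{1}(qs_can H x) /cube_rad.
  apply: (qs_img_rad n0 (qs_pair_sym H)) => //; first exact/ltW/side_gt0.
  by rewrite distrC.
have Fle x y : F x y <= \sum_(i <- s) c i *
         (energy_kernel phi al q e (x0 i) (r i) (rh i) x y +
          energy_kernel phi al q e (x0 i) (r i) (rh i) y x).
  have rhs0 : 0 <= \sum_(i <- s) c i *
         (energy_kernel phi al q e (x0 i) (r i) (rh i) x y +
          energy_kernel phi al q e (x0 i) (r i) (rh i) y x).
    apply: sumr_ge0 => i _; rewrite mulr_ge0 ?addr_ge0 ?energy_kernel_ge0//.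
    by case: i => [J|]; rewrite /c mulr_ge0 ?(ltW C30) ?(ltW C20).
  rewrite /F !indicE.
  have [|] := boolP (x \in cube a l); last by rewrite mul0r.
  have [|] := boolP (y \in cube a l); last by rewrite mul0r mulr0.
  rewrite !inE !mul1r => yQ xQ.
  have [xy|xy] := eqVneq x y; first by move: rhs0; rewrite xy !subrr normr0 expr0n mul0r.
  have t0 : 0 < `|x - y| by rewrite normr_gt0 subr_eq0.
  apply: (@le_trans _ _ ((g x - g y) ^+ 2 * `|x - y| `^ (- P))).
    rewrite real_normK ?num_real// ler_wpM2l ?sqr_ge0// powRN.
    have en := norm_le_enorm (x - y).
    rewrite lef_pV2 ?posrE ?powR_gt0 ?(lt_le_trans t0)//.
    by apply: ge0_ler_powR; rewrite ?nnegrE ?enorm_ge0 ?(ltW P0).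
  have pxy : phi x != phi y by rewrite (can_eq (qs_can H)).
  apply: (@le_trans _ _ (C3 * (wenergy q e M Q0 d N (phi x) `|phi x - phi y| +
      wenergy q e M Q0 d N (phi y) `|phi x - phi y|) * `|x - y| `^ (- P))).
    by rewrite !gE ler_wpM2r ?powR_ge0//; exact: hC3.
  rewrite -mulrA mulrDl.
  apply: (@le_trans _ _ (C3 * ((C2 * energy_kernel phi al q e a l rho x y + \sum_(J <- s0 | small J) d J *
       energy_kernel phi al q e (phiV (corner R J)) (K M * cube_rad phiV J) (side R J) x y) +
      (C2 * energy_kernel phi al q e a l rho y x + \sum_(J <- s0 | small J) d J *
       energy_kernel phi al q e (phiV (corner R J)) (K M * cube_rad phiV J) (side R J) y x)))).
    rewrite ler_wpM2l ?(ltW C30)// lerD//; first exact: energy_x.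
    by rewrite [`|phi x - _|]distrC [`|x - y|]distrC; exact: energy_x.
  rewrite /s big_cons big_map big_filter/= /c /x0 /r /rh.
  under [X in _ <= _ + X]eq_bigr do rewrite -mulrA mulrDr.
  rewrite -mulr_sumr big_split/= -mulrA -mulrDr.
  by rewrite le_eqVlt; apply/orP; left; apply/eqP; congr (_ * _); ring.
rewrite integral_square.
have prad0 J : 0 < cube_rad phiV J by exact: (cube_rad_gt0 n0 H).
have hle := hC1 phi phiV H _ s c r rh x0 _ _ _ _ F F0 Fle.
apply: le_trans (hle _ _ _ _) _.
- by case=> [J|]; rewrite /c mulr_ge0 ?(ltW C30) ?(ltW C20).
- by case=> [J|]; rewrite /r// mulr_gt0.
- by case=> [J|]; rewrite /rh// side_gt0.
- case=> [J|]; rewrite /x0 /r /rh; last by rewrite ler_peMl ?(ltW rho0).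
  rewrite -[X in _ <= L * X](norm_shift n0 (corner R J) (ltW (side_gt0 R J))).
  have := @qs_le _ _ K phi phiV H (K M) (phiV (corner R J))
     (phiV (corner R J) + (K M * cube_rad phiV J) *: const_mx 1)
     (phiV (corner R J + side R J *: const_mx 1)) (ltW (K0 _)).
  rewrite !(qs_canV H) /img_rad (qs_canV H); apply.
  by rewrite norm_shift// mulr_ge0 ?(ltW (K0 _)) ?(ltW (prad0 _)).
rewrite lee_fin -mulrA ler_wpM2l ?(ltW C10)//.
rewrite /s big_cons big_map big_filter /c /r /= [leRHS]mulrDl lerD// -mulrA.
set KMp := K M `^ (n%:R - 2 * al).
apply: (@le_trans _ _ (C3 * (KMp * \sum_(J <- s0 | small J) d J * cube_rad phiV J `^ (n%:R - 2 * al)))).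
  rewrite !mulr_sumr le_eqVlt; apply/orP; left; apply/eqP.
  apply: eq_bigr => J _.
  by rewrite powRM ?(ltW (K0 _)) ?(ltW (prad0 _))// /KMp; ring.
rewrite -!mulrA ler_wpM2l ?(ltW C30)// ler_wpM2l ?powR_ge0//.
have := hC4 phi phiV H Q0 d (fun J _ => d0 J) pack N a l l0.
congr (_ <= _).
have := s0F (fun J => if small J then d J * cube_rad phiV J `^ (n%:R - 2 * al) else 0).
rewrite -big_mkcond/= => <-.
by apply: eq_bigr => k _; rewrite [LHS]big_mkcond.
Qed.

End energy_sums.

(** * Wavelet coefficients *)

Section real_squares.
Context (R : realType).

Lemma normM_le_sqr (a b : R) : `|a * b| <= a ^+ 2 + b ^+ 2.
Proof.
have h1 := sqr_ge0 (`|a| - `|b|); have h2 : 0 <= `|a| * `|b| by exact: mulr_ge0.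
rewrite normrM -[a ^+ 2]real_normK ?num_real// -[b ^+ 2]real_normK ?num_real//.
move: h1 h2; move: `|a| `|b| => x y; rewrite !expr2 => h1 h2; lra.
Qed.

Lemma norm_le_sqr (a : R) : `|a| <= 1 + a ^+ 2.
Proof. by have := normM_le_sqr 1 a; rewrite mul1r expr1n. Qed.

End real_squares.

Section wavelet_coefficients.
Context (R : realType) (n : nat).
Local Notation leb := (lebesgue_rV R n).
Variable psi : dyadic n -> wtype n -> 'rV[R]_n -> R.
Hypothesis hpsi : wavelet_family psi.
Implicit Types (J : dyadic n) (nu : wtype n) (p : dyadic n * wtype n).

Let w p := psi p.1 p.2.

Let mw p : measurable_fun setT (w p).
Proof. by apply: continuous_measurable_rV; exact: wavelet_continuous. Qed.

Lemma wavelet_orthonormal p p' : (\int[leb]_x (w p x * w p' x)%:E = (p == p')%:R%:E)%E.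
Proof. by case: hpsi => -[_ orth _] *; exact: orth. Qed.

Let ww1 p : (\int[leb]_x (w p x ^+ 2)%:E = 1)%E.
Proof. by under eq_integral do rewrite expr2; rewrite wavelet_orthonormal eqxx. Qed.

Lemma wavelet_sqr_integrable p : leb.-integrable setT (fun x => (w p x ^+ 2)%:E).
Proof.
apply/integrableP; split; first by apply/measurable_EFinP; exact: measurable_funX.
under eq_integral do rewrite gee0_abs ?lee_fin ?sqr_ge0//.
by rewrite ww1 ltry.
Qed.

Lemma wavelet_mul_integrable p p' : leb.-integrable setT (fun x => (w p x * w p' x)%:E).
Proof.
apply: (@le_integrable _ _ _ _ _ _ _ ((fun x => (w p x ^+ 2)%:E) \+ (fun x => (w p' x ^+ 2)%:E))%E).
- exact: measurableT.
- by apply/measurable_EFinP; exact: measurable_funM.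
- move=> x _ /=; rewrite lee_fin [leRHS]ger0_norm ?addr_ge0 ?sqr_ge0//.
  exact: normM_le_sqr.
- by apply: integrableD => //; exact: wavelet_sqr_integrable.
Qed.

(** Square integrable with bounded support: |w| <= 1 + w^2 there. *)
Lemma wavelet_integrable (M : R) : 1 <= M ->
  (forall J nu x, psi J nu x != 0 -> `|x - corner R J| <= M * side R J) ->
  forall p, leb.-integrable setT (fun x => (w p x)%:E).
Proof.
move=> M1 hM p; pose E := nball (corner R p.1) (M * side R p.1).
have mE : measurable E by exact: measurable_nball.
have Ms0 : 0 <= M * side R p.1.
  by rewrite mulr_ge0 ?(le_trans _ M1)// ltW// side_gt0.
apply: (@le_integrable _ _ _ _ _ _ _ ((fun x => (\1_E x)%:E) \+ (fun x => (w p x ^+ 2)%:E))%E).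
- exact: measurableT.
- exact/measurable_EFinP.
- move=> x _ /=; rewrite lee_fin [leRHS]ger0_norm ?addr_ge0 ?sqr_ge0//.
  have [->|wx] := eqVneq (w p x) 0; first by rewrite normr0 addr_ge0// sqr_ge0.
  rewrite indicE mem_set; last by rewrite /E/nball/= distrC; exact: hM wx.
  exact: norm_le_sqr.
- apply: integrableD => //; last exact: wavelet_sqr_integrable.
  apply/integrableP; split; first by apply/measurable_EFinP; exact: measurable_indic.
  under eq_integral do rewrite gee0_abs ?lee_fin//.
  rewrite integral_indicT//; apply: le_lt_trans (ltry _).
  exact: leb_nball_le.
Qed.

Lemma wavelet_coefficient (t : seq (dyadic n * wtype n)) (c : dyadic n * wtype n -> R) p :
  uniq t -> p \in t ->
  leb.-integrable setT (fun x => ((\sum_(i <- t) c i * w i x) * w p x)%:E) /\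
  (\int[leb]_x ((\sum_(i <- t) c i * w i x) * w p x)%:E = (c p)%:E)%E.
Proof.
move=> ut pt.
have -> : (fun x => ((\sum_(i <- t) c i * w i x) * w p x)%:E) =
    (fun x => \sum_(i <- t) ((c i)%:E * (w i x * w p x)%:E))%E.
  apply/funext => x; rewrite mulr_suml -sumEFin; apply: eq_bigr => i _.
  by rewrite -EFinM mulrA.
have int i : leb.-integrable setT (fun x => (c i)%:E * (w i x * w p x)%:E)%E.
  by apply: integrableZl => //; exact: wavelet_mul_integrable.
split; first by apply: integrable_sum => // i _; exact: int.
rewrite integral_sum//.
rewrite (eq_bigr (fun i => (c i * (i == p)%:R)%:E)); last first.
  move=> i _; rewrite integralZl ?wavelet_orthonormal -?EFinM//.
  exact: wavelet_mul_integrable.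
rewrite sumEFin; congr EFin; rewrite (bigD1_seq p)//= eqxx mulr1 big1 ?addr0// => i ip.
by rewrite (negbTE ip) mulr0.
Qed.

Variables (M : R) (M1 : 1 <= M).
Hypothesis hM : forall J nu x, psi J nu x != 0 -> `|x - corner R J| <= M * side R J.

(* Since a = <f, w> = int (f - f y) w for every y, the bound
   2 a (f - f y) w <= (f - f y)^2 + a^2 w^2 replaces Cauchy-Schwarz. *)
Lemma coefficient_le (f : 'rV[R]_n -> R) p (a : R) y : 0 <= a ->
  leb.-integrable setT (fun x => (f x * w p x)%:E) ->
  (\int[leb]_x (f x * w p x)%:E = a%:E)%E ->
  measurable_fun setT f ->
  ((a ^+ 2)%:E <= \int[leb]_x (\1_(nball (corner R p.1) (M * side R p.1)) x
       * (f x - f y) ^+ 2)%:E)%E.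
Proof.
set E := nball _ _; have mE : measurable E by exact: measurable_nball.
rewrite le_eqVlt => /orP[/eqP<- _ _ _|a0 fw fwa mf].
  rewrite expr0n; apply: integral_ge0 => x _; rewrite lee_fin mulr_ge0// sqr_ge0//.
pose h x := \1_E x * (f x - f y) ^+ 2.
have h0 x : 0 <= h x by rewrite mulr_ge0// sqr_ge0.
have mh : measurable_fun setT h.
  apply: measurable_funM; first exact: measurable_indic.
  by apply: measurable_funX; apply: measurable_funB.
have iw := wavelet_integrable M1 hM p.
have wp0 : (\int[leb]_x (w p x)%:E = 0)%E.
  by case: hpsi => _ _ _ _ mean0; exact: mean0.
have e1 : (\int[leb]_x ((f x - f y) * w p x)%:E = a%:E)%E.
  have -> : (fun x => ((f x - f y) * w p x)%:E) =
     (fun x => (f x * w p x)%:E - ((f y)%:E * (w p x)%:E))%E.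
    by apply/funext => x; rewrite -EFinM -EFinB mulrBl.
  rewrite integralB//; last exact: integrableZl.
  by rewrite fwa integralZl// wp0 mule0 sube0.
have : (a%:E <= ((2 * a)^-1)%:E * \int[leb]_x (h x)%:E + (a / 2)%:E * 1)%E.
  rewrite -e1 -(ww1 p) -!ge0_integralZl_real//; last 4 first.
  - exact: measurable_funX.
  - by move=> x; exact: sqr_ge0.
  - by rewrite divr_ge0// ltW.
  - by rewrite invr_ge0 mulr_ge0// ltW.
  rewrite -ge0_integralD//; last 4 first.
  - by move=> x _; rewrite lee_fin mulr_ge0// invr_ge0 mulr_ge0// ltW.
  - by apply/measurable_EFinP; exact: measurable_funM.
  - by move=> x _; rewrite lee_fin mulr_ge0 ?sqr_ge0// divr_ge0// ltW.
  - by apply/measurable_EFinP; apply: measurable_funM => //; exact: measurable_funX.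
  apply: integral_le_ge0 => x; last first.
    rewrite -EFinD lee_fin addr_ge0// mulr_ge0 ?sqr_ge0// ?invr_ge0 ?divr_ge0 ?mulr_ge0 ?(ltW a0)//.
  rewrite -EFinD lee_fin.
  have [->|wx] := eqVneq (w p x) 0.
    by rewrite mulr0 expr0n mulr0 addr0 mulr_ge0// invr_ge0 mulr_ge0// ltW.
  rewrite /h indicE mem_set; last by rewrite /E/nball/= distrC; exact: hM wx.
  rewrite mul1r; set u := f x - f y; set v := w p x.
  have := sqr_ge0 (u - a * v) => sq.
  have -> : (2 * a)^-1 * u ^+ 2 + a / 2 * v ^+ 2 = (2 * a)^-1 * (u ^+ 2 + (a * v) ^+ 2).
    by field; rewrite gt_eqF.
  rewrite ler_pdivlMl ?mulr_gt0//.
  by move: sq; rewrite !expr2; lra.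
rewrite mule1; case: (\int[leb]_x (h x)%:E)%E => [r| |] //=; last first.
- rewrite gt0_muleNy ?lte_fin ?invr_gt0 ?mulr_gt0//.
- by rewrite leey.
rewrite -EFinM -EFinD !lee_fin => hr.
have : a * a <= a * ((2 * a)^-1 * r + a / 2) by rewrite ler_wpM2l// ltW.
have -> : a * ((2 * a)^-1 * r + a / 2) = (r + a * a) / 2 by field; rewrite gt_eqF.
rewrite expr2; lra.
Qed.

End wavelet_coefficients.

(** * The coefficient sum and the energy of the wavelet sum *)

Section coefficient_sum.
Context (R : realType) (n : nat) (n0 : (0 < n)%N).
Local Notation leb := (lebesgue_rV R n).

Lemma wtype_inhabited : wtype n.
Proof.
exists [ffun => true]; apply/eqP => /ffunP/(_ (Ordinal n0)).
by rewrite !ffunE.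
Qed.

Lemma measurable_enorm : measurable_fun setT (@enorm R n).
Proof.
have -> : @enorm R n = fun x => (\sum_i x 0 i ^+ 2) `^ 2^-1.
  apply/funext => x; rewrite powR12_sqrt//; apply: sumr_ge0 => i _; exact: sqr_ge0.
apply: (measurableT_comp (measurable_powR _)); apply: measurable_sum => i.
by apply: measurable_funX; exact: measurable_coor.
Qed.

(** The norm is a supremum of square roots, possibly infinite; this returns to the energy itself. *)
Lemma poweR_half_le (X s : \bar R) : (0 <= X)%E -> (X `^ 2^-1 <= s)%E -> (X <= s ^+ 2)%E.
Proof.
have h2 : 2^-1 != 0 :> R by rewrite invr_eq0 pnatr_eq0.
case: X => [x| |] // X0.
  rewrite poweR_EFin; case: s => [r| |] //; last by move=> _; rewrite expe2 mulyy leey.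
  rewrite lee_fin -EFin_expe !lee_fin => xr.
  have := lerXn2r 2 (powR_ge0 x 2^-1) (le_trans (powR_ge0 x 2^-1) xr) xr.
  by rewrite powR12_sqrt -?lee_fin// sqr_sqrtr -?lee_fin.
rewrite poweRE (negbTE h2) eqxx leye_eq => /eqP->.
by rewrite expe2 mulyy.
Qed.

Lemma coefficient_sum_le psi (al : R) : wavelet_family psi -> 0 < al ->
  2 * al < n%:R ->
  exists2 C : R, 0 < C & forall Q0 (d : dyadic n -> R) N, (forall J, 0 <= d J) ->
    ((\sum_(k < N.+1) \sum_(J <- gen Q0 k)
           d J * (vol (dcube R J) / vol (dcube R Q0)) `^ (1 - 2 * al / n%:R))%:E
         <= C%:E * Qalpha_norm al (wavelet_sum psi Q0 d N) ^+ 2)%E.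
Proof.
move=> hpsi al0 aln.
have nR0 : 0 < n%:R :> R by rewrite ltr0n.
have [M M1 hM] := wavelet_near hpsi.
have M0 : 0 < M by exact: lt_le_trans M1.
have [Cn Cn0 hCn] := @sum_near_le R n M (ltW M0).
pose P := n%:R + 2 * al; have P0 : 0 < P by rewrite ltr_wpDl// mulr_gt0.
have [Cs Cs0 hCs] := sum_min_powR P0 P0.
(* Two points of M J are at sup distance at most 2 M l(J), hence at Euclidean distance at most Lam
   l(J). *)
have [Lam LamE Lam0] : exists2 Lam, Lam = n%:R * (2 * M) & 0 < Lam.
  by exists (n%:R * (2 * M)) => //; rewrite !mulr_gt0.
(* The cube of side mu l(Q0) centered at the corner of Q0 contains all M J, which stay within (M +
   1) l(Q0) of that corner. *)
pose mu := 4 * (M + 1); have mu0 : 0 < mu by rewrite mulr_gt0// addr_gt0.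
pose C1 := Lam `^ P * (Cn * Cs).
have C10 : 0 < C1 by rewrite mulr_gt0 ?powR_gt0// mulr_gt0.
exists (C1 * mu `^ (n%:R - 2 * al)); first by rewrite mulr_gt0// powR_gt0.
move=> Q0 d N d0; set f := wavelet_sum psi Q0 d N.
have [s [us sN sF]] := gen_bounded_list R Q0 N.+1.
have cf : continuous f by exact: wavelet_sum_continuous.
have mf : measurable_fun setT f by exact: continuous_measurable_rV.
pose E (J : dyadic n) := nball (corner R J) (M * side R J).
have mE J : measurable (E J) by exact: measurable_nball.
have s0 (J : dyadic n) : 0 < side R J by exact: side_gt0.
pose nu0 := wtype_inhabited.
have coef J : J \in s -> forall y,
    ((side R J ^+ n * d J)%:E <= \int[leb]_x (\1_(E J) x * (f x - f y) ^+ 2)%:E)%E.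
  move=> Js y; pose c (p : dyadic n * wtype n) := Num.sqrt (vol (dcube R p.1) * d p.1).
  pose t := [seq (J', nu) | J' <- s, nu <- enum {: wtype n}].
  have ut : uniq t.
    by apply: allpairs_uniq => //; [exact: enum_uniq|move=> [? ?] [? ?]].
  have Jt : (J, nu0) \in t by apply/allpairsP; exists (J, nu0); rewrite mem_enum.
  have fE : f = fun x => \sum_(p <- t) c p * psi p.1 p.2 x.
    apply/funext => x; rewrite /t big_allpairs /f /wavelet_sum sF.
    by apply: eq_bigr => J' _; rewrite big_enum.
  have [int coefE] := wavelet_coefficient hpsi c ut Jt.
  have vd : 0 <= vol (dcube R J) * d J.
    by rewrite mulr_ge0// vol_dcube exprn_ge0// ltW.
  have := @coefficient_le _ _ psi hpsi M M1 hM f (J, nu0) (c (J, nu0)) y (sqrtr_ge0 _).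
  rewrite {1 2}fE => /(_ int coefE mf) /=.
  by rewrite /c/= sqr_sqrtr// vol_dcube.
pose k J (p : 'rV[R]_n * 'rV[R]_n) : R :=
  side R J `^ (- P) * (\1_(E J) p.1 * (\1_(E J) p.2 * (f p.1 - f p.2) ^+ 2)).
have k0 J p : 0 <= k J p.
  by apply: mulr_ge0; [exact: powR_ge0|do 2 apply: mulr_ge0 => //; exact: sqr_ge0].
have mf1 : measurable_fun setT (fun p : 'rV[R]_n * 'rV[R]_n => f p.1).
  exact: (measurableT_comp mf measurable_fst).
have mf2 : measurable_fun setT (fun p : 'rV[R]_n * 'rV[R]_n => f p.2).
  exact: (measurableT_comp mf measurable_snd).
have mi1 A : measurable A -> measurable_fun setT (fun p : 'rV[R]_n * 'rV[R]_n => \1_A p.1 : R).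
  by move=> mA; apply: (measurableT_comp _ measurable_fst); exact: measurable_indic.
have mi2 A : measurable A -> measurable_fun setT (fun p : 'rV[R]_n * 'rV[R]_n => \1_A p.2 : R).
  by move=> mA; apply: (measurableT_comp _ measurable_snd); exact: measurable_indic.
have msq : measurable_fun setT (fun p : 'rV[R]_n * 'rV[R]_n => (f p.1 - f p.2) ^+ 2).
  by apply: measurable_funX; exact: measurable_funB.
have mk J : measurable_fun setT (k J).
  apply: measurable_funM => //; apply: measurable_funM; first exact: mi1.
  by apply: measurable_funM => //; exact: mi2.
(* Averages the coefficient bound over its base point in M J, a set of volume at least l(J)^n:
   l(J)^(-P) l(J)^n l(J)^n = l(J)^(n - 2 al). *)
have kJ J : J \in s -> ((d J * side R J `^ (n%:R - 2 * al))%:E <= \int[leb \x leb]_p (k J p)%:E)%E.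
  move=> Js; have mkJ : measurable_fun setT (EFin \o k J) by exact/measurable_EFinP.
  rewrite (@fubini_tonelli1 _ _ _ _ _ leb leb (EFin \o k J))//=; last first.
    by move=> p; rewrite lee_fin.
  rewrite /fubini_F/=.
  apply: (@le_trans _ _ (\int[leb]_x (side R J `^ (- P) * (side R J ^+ n * d J) * \1_(E J) x)%:E)%E).
    have mIE : measurable_fun setT (\1_(E J) : _ -> R).
      by apply: measurable_indic; exact: mE.
    rewrite ge0_integralZl_real//; last first.
      by rewrite !mulr_ge0 ?powR_ge0 ?exprn_ge0 ?(ltW (s0 J)).
    rewrite integral_indicT//.
    have hE : ((side R J ^+ n)%:E <= leb (E J))%E.
      apply: le_trans (leb_nball_ge _ _); last by rewrite mulr_ge0 ?(ltW M0) ?(ltW (s0 J)).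
      rewrite lee_fin lerXn2r ?nnegrE ?mulr_ge0 ?(ltW M0) ?(ltW (s0 J))//.
      by rewrite ler_peMl ?(ltW (s0 J)).
    apply: le_trans (lee_wpmul2l _ hE); last first.
      by rewrite lee_fin !mulr_ge0 ?powR_ge0 ?exprn_ge0 ?(ltW (s0 J)).
    rewrite -EFinM lee_fin.
    have -> : side R J `^ (n%:R - 2 * al) = side R J `^ (- P) * side R J ^+ n * side R J ^+ n.
      rewrite -!powR_mulrn ?(ltW (s0 J))// -!powRD ?(gt_eqF (s0 J)) ?implybT//.
      by congr (_ `^ _); rewrite /P; ring.
    by rewrite le_eqVlt; apply/orP; left; apply/eqP; ring.
  apply: ge0_le_integralT => x.
    by rewrite lee_fin !mulr_ge0 ?powR_ge0 ?exprn_ge0 ?(ltW (s0 J)).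
  have [xE|xE] := boolP (x \in E J); last first.
    rewrite indicE (negbTE xE) mulr0; apply: integral_ge0 => y _.
    by rewrite lee_fin; exact: k0.
  rewrite /k/= indicE xE mulr1; under eq_integral do rewrite mul1r.
  have mEf : measurable_fun setT (fun y => \1_(E J) y * (f x - f y) ^+ 2).
    apply: measurable_funM; first by apply: measurable_indic; exact: mE.
    by apply: measurable_funX; exact: measurable_funB.
  have Ef0 y : 0 <= \1_(E J) y * (f x - f y) ^+ 2.
    by apply: mulr_ge0 => //; exact: sqr_ge0.
  rewrite ge0_integralZl_real ?powR_ge0//.
  rewrite EFinM lee_wpmul2l ?lee_fin ?powR_ge0//.
  apply: le_trans (coef J Js x) _.
  apply: ge0_le_integralT => y; first by rewrite lee_fin mulr_ge0 ?sqr_ge0.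
  by rewrite -[f y - _]opprB sqrrN.
pose sg0 := side R Q0; have sg00 : 0 < sg0 by exact: s0.
pose lq := mu * sg0; have lq0 : 0 < lq by rewrite mulr_gt0.
pose aq : 'rV[R]_n := corner R Q0 - const_mx (lq / 2).
pose Q := cube aq lq; have mQ : measurable Q by exact: measurable_cube.
pose F (p : 'rV[R]_n * 'rV[R]_n) : R := \1_Q p.1 * (\1_Q p.2 *
    (`|f p.1 - f p.2| ^+ 2 / enorm (p.1 - p.2) `^ P)).
have F0 p : 0 <= F p.
  by rewrite /F mulr_ge0// mulr_ge0//; apply: divr_ge0; [exact: exprn_ge0|exact: powR_ge0].
have mF : measurable_fun setT F.
  apply: measurable_funM; first exact: mi1.
  apply: measurable_funM; first exact: mi2.
  apply: measurable_funM.
    by apply: measurable_funX; apply: measurableT_comp => //; exact: measurable_funB.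
  have -> : (fun p : 'rV[R]_n * 'rV[R]_n => (enorm (p.1 - p.2) `^ P)^-1) =
     (fun p => enorm (p.1 - p.2) `^ (- P)) by apply/funext => p; rewrite powRN.
  apply: (measurableT_comp (measurable_powR _)); apply: (measurableT_comp measurable_enorm).
  by apply: measurable_fun_subr_rV; [exact: measurable_fst|exact: measurable_snd].
have EQ J : J \in s -> forall x, E J x -> Q x.
  move=> Js x xE i; have [j _ Jj] := sN _ Js.
  have sJ : side R J <= sg0.
    rewrite (side_gen R Jj) ler_piMr ?(ltW (s0 _))// exprn_ile1 ?invr_ge0//.
    by rewrite invf_le1// ler1n.
  have : `|corner R Q0 - x| <= (M + 1) * sg0.
    rewrite (_ : corner R Q0 - x = (corner R Q0 - corner R J) + (corner R J - x)); last first.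
      by rewrite addrA subrK.
    rewrite (le_trans (ler_normD _ _))// mulrDl mul1r addrC lerD//; last exact: gen_corner_dist Jj.
    by apply: (le_trans xE); rewrite ler_wpM2l// ltW.
  move=> /(le_trans (coord_le_norm _ i)).
  have -> : (corner R Q0 - x) 0 i = corner R Q0 0 i - x 0 i.
    by rewrite [LHS]mxE; congr (_ + _); rewrite mxE.
  have -> : aq 0 i = corner R Q0 0 i - lq / 2.
    by rewrite [LHS]mxE; congr (_ + _); rewrite !mxE.
  have : (M + 1) * sg0 < lq / 2.
    have : 0 < (M + 1) * sg0 by rewrite mulr_gt0// addr_gt0.
    rewrite /lq /mu; lra.
  by move=> h; rewrite ler_norml => /andP[h1 h2]; apply/andP; split; lra.
(* If M J contains both x and y, then l(J) >= T / Lam. With boundedly many such cubes per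
   generation, the powers l(J)^(-P) sum to a multiple of T^(-P), the kernel. *)
have kF p : \sum_(J <- s) k J p <= C1 * F p.
  case: p => x y; have [xy|xy] := eqVneq x y.
    rewrite big1 ?(mulr_ge0 (ltW C10) (F0 _))// => J _.
    by rewrite /k/= xy subrr expr0n !mulr0.
  have [xyQ|xyQ] := boolP ((x \in Q) && (y \in Q)); last first.
    rewrite big_seq big1 ?(mulr_ge0 (ltW C10) (F0 _))// => J Js.
    rewrite /k/= !indicE.
    have [|_] := boolP (x \in E J); last by rewrite mul0r mulr0.
    have [|_] := boolP (y \in E J); last by rewrite mul0r !mulr0.
    rewrite !inE => /(EQ _ Js) yQ /(EQ _ Js) xQ.
    by move: xyQ; rewrite !mem_set.
  have /andP[xQ yQ] := xyQ.
  have t0 : 0 < enorm (x - y).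
    by apply: lt_le_trans (norm_le_enorm _); rewrite normr_gt0 subr_eq0.
  set T := enorm (x - y) in t0.
  pose v0 := T / Lam / sg0; have v00 : 0 < v0 by rewrite !divr_gt0.
  have [ff ffE ff0] : exists2 ff, (f x - f y) ^+ 2 = ff & 0 <= ff.
    by exists ((f x - f y) ^+ 2) => //; exact: sqr_ge0.
  apply: (@le_trans _ _ (\sum_(i < N.+1) ff * (Lam `^ P * T `^ (- P)) *
      (Cn * Num.min ((2 ^+ i * v0) `^ P) ((2 ^+ i * v0) `^ (- P))))); last first.
    rewrite -mulr_sumr -mulr_sumr /F/= !indicE xQ yQ !mul1r real_normK ?num_real//.
    rewrite ffE -/T -powRN /C1.
    apply: (@le_trans _ _ (ff * (Lam `^ P * T `^ (- P)) * (Cn * Cs))).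
      apply: ler_wpM2l; last by apply: ler_wpM2l; [exact: ltW|exact: hCs].
      by apply: mulr_ge0 => //; apply: mulr_ge0; exact: powR_ge0.
    by rewrite le_eqVlt; apply/orP; left; apply/eqP; ring.
  rewrite -sF; apply: ler_sum => i _.
  set m := Num.min _ _; have m0 : 0 <= m by rewrite le_min !powR_ge0.
  have cc0 : 0 <= ff * (Lam `^ P * T `^ (- P)) * m.
    apply: mulr_ge0 => //; apply: mulr_ge0 => //.
    by apply: mulr_ge0; exact: powR_ge0.
  apply: (@le_trans _ _ (\sum_(J <- gen Q0 i | `|x - corner R J| <= M * side R J)
      (if y \in E J then k J (x, y) else 0))).
    rewrite [leRHS]big_mkcond; apply: ler_sum => J _.
    rewrite /k/= !indicE; have [hx|hx] := boolP (x \in E J).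
      have -> : `|x - corner R J| <= M * side R J by rewrite distrC; exact: set_mem hx.
      by case: (y \in E J); rewrite //= mul0r !mulr0.
    rewrite mul0r mulr0; case: ifP => // hx'.
    by case: ifP => // _; rewrite mul0r mulr0.
  apply: le_trans (hCn Q0 i x _ _ cc0 _) _; last by rewrite mulrCA.
  move=> J Ji; case: ifPn => // yE; rewrite /k/= !indicE yE.
  have [xE|xE] := boolP (x \in E J); last by rewrite mul0r mulr0.
  rewrite !mul1r ffE mulrC -!mulrA ler_wpM2l//.
  have vi : 2 ^+ i * v0 = T / Lam / side R J.
    rewrite /v0 (side_gen R Ji) -/sg0 exprVn.
    have divE (b c z : R) : b != 0 -> c != 0 -> c * (z / b) = z / (b / c).
      by move=> b0 c0; field; rewrite b0 c0.
    by apply: divE; [rewrite gt_eqF|rewrite expf_neq0].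
  have v1 : T / Lam / side R J <= 1.
    rewrite ler_pdivrMr// mul1r ler_pdivrMr// /T.
    apply: (le_trans (enorm_le_norm _)).
    have -> : side R J * Lam = n%:R * (2 * M * side R J) by rewrite LamE; ring.
    rewrite ler_wpM2l//.
    move: xE yE; rewrite !inE => xE yE.
    rewrite (_ : x - y = (corner R J - y) - (corner R J - x)); last by rewrite opprB [RHS]addrC addrA subrK.
    rewrite (le_trans (ler_normB _ _))//.
    have -> : 2 * M * side R J = M * side R J + M * side R J by ring.
    exact: lerD.
  have vpos : 0 < T / Lam / side R J by rewrite !divr_gt0.
  have -> : m = (T / Lam / side R J) `^ P.
    rewrite /m vi; apply/min_idPl; apply: powR_le_exp => //.
    by rewrite (@le_trans _ _ 0) ?(ltW P0)// oppr_le0 ltW.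
  rewrite !powRM ?divr_ge0 ?invr_ge0 ?(ltW t0) ?(ltW Lam0) ?(ltW (s0 J))//.
  have pV (z : R) : 0 < z -> z^-1 `^ P = (z `^ P)^-1.
    by move=> z0; rewrite -powR_inv1 ?(ltW z0)// -powRrM mulN1r powRN.
  rewrite !pV// !powRN.
  have a1 : Lam `^ P != 0 by rewrite gt_eqF// powR_gt0.
  have a2 : T `^ P != 0 by rewrite gt_eqF// powR_gt0.
  have a3 : side R J `^ P != 0 by rewrite gt_eqF// powR_gt0.
  move: (Lam `^ P) (T `^ P) (side R J `^ P) a1 a2 a3 => b1 b2 b3 a1 a2 a3.
  by rewrite le_eqVlt; apply/orP; left; apply/eqP; field; rewrite a1 a2 a3.
pose En := (\int[leb]_(x in Q) \int[leb]_(y in Q)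
   (`|f x - f y| ^+ 2 / enorm (x - y) `^ (n%:R + 2 * al))%:E)%E.
have mF' : measurable_fun setT (EFin \o F) by exact/measurable_EFinP.
have IE : En = (\int[leb \x leb]_p (F p)%:E)%E.
  rewrite /En integral_square.
  by rewrite (@fubini_tonelli1 _ _ _ _ _ leb leb (EFin \o F)).
have key : ((\sum_(J <- s) d J * side R J `^ (n%:R - 2 * al))%:E <= C1%:E * En)%E.
  rewrite -sumEFin big_seq.
  apply: (@le_trans _ _ (\sum_(J <- s | J \in s) \int[leb \x leb]_p (k J p)%:E)%E).
    by apply: lee_sum => J; exact: kJ.
  rewrite -big_seq -ge0_integral_sum//; last 2 first.
  - by move=> J; exact/measurable_EFinP.
  - by move=> J p _; rewrite lee_fin.
  rewrite IE -ge0_integralZl_real ?(ltW C10)//.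
  apply: ge0_le_integralT => p.
    by apply: sume_ge0 => J _; rewrite lee_fin.
  by rewrite sumEFin lee_fin.
have be : n%:R * (1 - 2 * al / n%:R) = n%:R - 2 * al.
  by rewrite mulrBr mulr1 mulrCA mulfV ?mulr1// gt_eqF.
have nal0 : 0 <= n%:R - 2 * al by rewrite subr_ge0 ltW.
rewrite sF (_ : \sum_(J <- s) _ =
    sg0 `^ (- (n%:R - 2 * al)) * \sum_(J <- s) d J * side R J `^ (n%:R - 2 * al)); last first.
  rewrite mulr_sumr; apply: eq_bigr => J _.
  rewrite !vol_dcube -expr_div_n -/sg0 -powR_mulrn ?divr_ge0 ?(ltW (s0 J)) ?(ltW sg00)//.
  rewrite -powRrM be powRM ?invr_ge0 ?(ltW (s0 J)) ?(ltW sg00)//.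
  by rewrite -powR_inv1 ?(ltW sg00)// -powRrM mulN1r mulrA mulrC.
rewrite EFinM; apply: le_trans (lee_wpmul2l _ key) _; first by rewrite lee_fin powR_ge0.
(* Outside [L2loc] the norm is +oo by definition, and the bound is trivial. *)
rewrite /Qalpha_norm; case: asboolP => fL2; last first.
  by rewrite expe2 mulyy gt0_muley ?lte_fin ?mulr_gt0 ?powR_gt0// leey.
set S := ereal_sup _.
pose vq := lq `^ (- (n%:R - 2 * al)); have vq0 : 0 < vq by exact: powR_gt0.
have volQ : vol Q `^ (2 * al / n%:R - 1) = vq.
  rewrite /vol lebesgue_rV_cube ?(ltW lq0)//= -powR_mulrn ?(ltW lq0)// -powRrM.
  by rewrite /vq -be; congr (_ `^ _); ring.
have I0 : (0 <= En)%E.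
  apply: integral_ge0 => x _; apply: integral_ge0 => y _; rewrite lee_fin.
  by rewrite divr_ge0 ?powR_ge0 ?exprn_ge0.
have hS : (vq%:E * En <= S ^+ 2)%E.
  apply: poweR_half_le; first by rewrite mule_ge0// lee_fin ltW.
  apply: ereal_sup_ubound; exists Q; first by exists aq, lq.
  by rewrite volQ.
have -> : C1 * mu `^ (n%:R - 2 * al) = sg0 `^ (- (n%:R - 2 * al)) * C1 / vq.
  rewrite /vq !powRN invrK /lq powRM ?(ltW mu0) ?(ltW sg00)//.
  have : sg0 `^ (n%:R - 2 * al) != 0 by rewrite gt_eqF// powR_gt0.
  by move: (sg0 `^ _) => X X0; field.
have -> : ((sg0 `^ (- (n%:R - 2 * al)))%:E * (C1%:E * En) =
    (sg0 `^ (- (n%:R - 2 * al)) * C1 / vq)%:E * (vq%:E * En))%E.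
  by rewrite !muleA -!EFinM divfK// gt_eqF.
rewrite lee_wpmul2l// lee_fin.
by apply: divr_ge0; [apply: mulr_ge0; [exact: powR_ge0|exact: ltW]|exact: ltW].
Qed.

End coefficient_sum.

(** * From energies on cubes to the norm, and the theorem *)

Section composition_norm.
Context (R : realType) (n : nat).
Local Notation leb := (lebesgue_rV R n).

Lemma packing_condition_eq (be : R) (phi : 'rV[R]_n -> 'rV[R]_n) Q0 (d d' : dyadic n -> R) :
  (forall J, descendants Q0 J -> d J = d' J) ->
  packing_condition be phi Q0 d -> packing_condition be phi Q0 d'.
Proof.
move=> dd'; rewrite /packing_condition; congr (is_true (ereal_sup (_ @` _) <= _)%E).
apply/funext => P; apply: eq_esum => J [QJ _].
by rewrite (dd' _ QJ).
Qed.

(** [B] serves only to place [g] in [L2loc], so that the norm is the supremum; it does not enter the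
    bound. The factor |Q|^(2 al / n - 1) = l^(-(n - 2 al)) cancels the power of l in the energy. *)
Lemma Qalpha_norm_le (al C : R) (g : 'rV[R]_n -> R) (B : R) : (0 < n)%N -> 0 <= C ->
  continuous g -> (forall x, `|g x| <= B) ->
  (forall a l, 0 < l ->
    (\int[leb]_(x in cube a l) \int[leb]_(y in cube a l)
      (`|g x - g y| ^+ 2 / enorm (x - y) `^ (n%:R + 2 * al))%:E
    <= (C * l `^ (n%:R - 2 * al))%:E)%E) ->
  (Qalpha_norm al g <= (C `^ 2^-1)%:E)%E.
Proof.
move=> n0 C0 cg gB hg.
have nR0 : 0 < n%:R :> R by rewrite ltr0n.
have gL2 : L2loc g.
  split; first exact: continuous_measurable_rV.
  move=> Q [a [l [l0 ->]]].
  have mQ : measurable (cube a l) by exact: measurable_cube.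
  apply: (@le_lt_trans _ _ (\int[leb]_x (B ^+ 2 * \1_(cube a l) x)%:E)%E).
    rewrite integral_mkcond; apply: ge0_le_integralT => x; rewrite patchE.
      by case: ifP => // _; rewrite lee_fin sqr_ge0.
    rewrite indicE; case: ifP => _; rewrite lee_fin ?mulr1 ?mulr0//.
    rewrite -[g x ^+ 2]real_normK ?num_real// lerXn2r ?nnegrE//.
    exact: le_trans (gB x).
  have mI : measurable_fun setT (\1_(cube a l) : _ -> R) by exact: measurable_indic.
  rewrite ge0_integralZl_real ?sqr_ge0//.
  by rewrite integral_indicT// [X in (_ * X)%E](lebesgue_rV_cube a (ltW l0)) -EFinM ltry.
rewrite /Qalpha_norm; case: asboolP => // _.
apply: ge_ereal_sup => _ [Q [a [l [l0 ->]]] <-].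
have := hg a l l0; set In := (\int[leb]_(x in cube a l) _)%E => hI.
have I0 : (0 <= In)%E.
  apply: integral_ge0 => x _; apply: integral_ge0 => y _; rewrite lee_fin.
  by apply: divr_ge0; [exact: exprn_ge0|exact: powR_ge0].
have -> : In = (fine In)%:E.
  by rewrite fineK// ge0_fin_numE//; exact: le_lt_trans hI (ltry _).
have i0 : 0 <= fine In by exact: fine_ge0.
have hi : fine In <= C * l `^ (n%:R - 2 * al).
  by rewrite -lee_fin fineK// ge0_fin_numE//; exact: le_lt_trans hI (ltry _).
rewrite -EFinM poweR_EFin lee_fin; apply: ge0_ler_powR.
- by rewrite invr_ge0.
- by rewrite nnegrE mulr_ge0 ?powR_ge0.
- by rewrite nnegrE.
rewrite /vol lebesgue_rV_cube ?(ltW l0)//= -powR_mulrn ?(ltW l0)// -powRrM.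
have -> : n%:R * (2 * al / n%:R - 1) = - (n%:R - 2 * al).
  by field; rewrite gt_eqF.
rewrite powRN mulrC ler_pdivrMr//; exact: powR_gt0.
Qed.

End composition_norm.

Theorem theorem5p6 (R : realType) (n : nat)
    (psi : dyadic n -> wtype n -> 'rV[R]_n -> R)
    (hpsi : wavelet_family psi)
    (alpha : R) (halpha : 0 < alpha < Num.min 1 (n%:R / 2))
    (eta : R -> R) (heta : increasing_homeo eta) (A : \bar R) :
  exists2 C : R, 0 < C &
    forall phi phiV : 'rV[R]_n -> 'rV[R]_n,
      homeomorphism phi phiV -> quasisymmetric eta phi ->
      (n = 1%N -> Ainfty_jacobian phi /\ Ainfty_jacobian phiV) ->
      Ainfty_char (jac phiV) = A ->
    forall (Q0 : dyadic n) (d : dyadic n -> R),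
      (forall I, descendants Q0 I -> 0 <= d I) ->
      packing_condition ((n%:R - 2 * alpha) / n%:R) phi Q0 d ->
    forall N : nat,
      let fN := wavelet_sum psi Q0 d N in
      ((\sum_(k < N.+1) \sum_(I <- gen Q0 k)
           d I * (vol (dcube R I) / vol (dcube R Q0))
                   `^ (1 - 2 * alpha / n%:R))%:E
         <= C%:E * Qalpha_norm alpha fN ^+ 2)%E /\
      (Qalpha_norm alpha (fN \o phi) <= C%:E)%E.
Proof.
have [al0 al1 aln] : [/\ 0 < alpha, alpha < 1 & 2 * alpha < n%:R].
  move: halpha => /andP[a0]; rewrite lt_min => /andP[a1 a2]; split => //.
  by rewrite mulrC -ltr_pdivlMr.
have n0 : (0 < n)%N.
  by rewrite -(ltr0n R); apply: lt_trans aln; rewrite mulr_gt0.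
have [K K1 hK] := quasisymmetric_qs_pair n0 heta.
have [B [M [B0 M1 hB]]] := wavelet_block_bounds hpsi.
have [C1 C10 hC1] := coefficient_sum_le n0 hpsi al0 aln.
have [C2 C20 hC2] := composition_energy_le n0 al0 al1 aln M1 B0 (K1 2)
  (lt_le_trans ltr01 (K1 M)) (K1 (K M)).
(* [C1] serves the first estimate, the square root of [C2] the second, since the norm is the root of
   an energy. *)
exists (C1 + C2 `^ 2^-1); first by rewrite ltr_wpDr ?powR_ge0.
move=> phi phiV hphi qs _ _ Q0 d d0 pack N fN.
have H := hK phi phiV hphi qs.
(* The sign of [d] is known only on the descendants of Q0; its absolute value agrees with it there
   and is nonnegative everywhere, as the estimates above require. *)
pose d' J := `|d J|.
have dd' J : descendants Q0 J -> d J = d' J by move=> QJ; rewrite /d' ger0_norm ?d0.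
have d'0 J : 0 <= d' J by exact: normr_ge0.
have pack' := packing_condition_eq dd' pack.
have gd' k J : J \in gen Q0 k -> d J = d' J.
  by move=> Jk; apply: dd'; exact: gen_descendants Jk.
have fNE : fN = wavelet_sum psi Q0 d' N.
  apply/funext => x; apply: eq_bigr => k _; rewrite big_seq [RHS]big_seq.
  by apply: eq_bigr => J Jk; rewrite (gd' _ _ Jk).
split.
  apply: (@le_trans _ _ (C1%:E * Qalpha_norm alpha fN ^+ 2)%E).
    rewrite fNE; apply: le_trans (hC1 Q0 d' N d'0).
    rewrite lee_fin le_eqVlt; apply/orP; left; apply/eqP.
    apply: eq_bigr => k _; rewrite big_seq [RHS]big_seq.
    by apply: eq_bigr => J Jk; rewrite (gd' _ _ Jk).
  by rewrite lee_wpmul2r ?sqre_ge0// lee_fin lerDl powR_ge0.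
apply: (@le_trans _ _ (C2 `^ 2^-1)%:E); last by rewrite lee_fin lerDr ltW.
have gE x : (fN \o phi) x = block_sum (wavelet_block psi) Q0 d' N (phi x).
  by rewrite /= fNE wavelet_sumE.
(* The sup bound supplied here depends on [N] and [d], which is harmless because only its finiteness
   matters. *)
apply: (@Qalpha_norm_le _ _ _ _ _
  (\sum_(k < N.+1) \sum_(J <- gen Q0 k) Num.sqrt (d' J) * B)) => //.
- exact: ltW.
- move=> x; apply: continuous_comp; first exact: (qs_cont H).
  exact: wavelet_sum_continuous.
- move=> x; rewrite gE; apply: le_trans (ler_norm_sum _ _ _) _.
  apply: ler_sum => k _; apply: le_trans (ler_norm_sum _ _ _) _.
  apply: ler_sum => J _; rewrite normrM ger0_norm ?sqrtr_ge0// ler_wpM2l ?sqrtr_ge0//.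
  by have [] := hB J.
- move=> a l l0; exact: (hC2 phi phiV H _ hB Q0 d' d'0 pack' N a l l0 _ gE).
Qed.
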